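(* Let $n\ge 1$, $u_T\in\mathrm{Lip}(\mathbb{R}^n)$ and $T>0$, and set $u_T^\ast:=S_T^+(S_T^-u_T)$, where $S_T^{\pm}$ are the forward and backward solution operators associated with the Hamiltonian $H$. (1) If $n=1$ and $H\in C^2(\mathbb{R})$ satisfies $H_{pp}(p)>0$ for all $p\in\mathbb{R}$ and $\lim_{|p|\to\infty}H(p)/|p|=+\infty$, then $u_T^\ast$ is the unique viscosity solution of $$\min\Big\{v-u_T,\ -\partial_{xx}v+\big(T\,H_{pp}(\partial_xv)\big)^{-1}\Big\}=0.$$ (2) If $n\ge1$ and $H(p)=\frac{\langle Ap,p\rangle}{2}$ for a symmetric positive definite $n\times n$ matrix $A$, then $u_T^\ast$ is the unique viscosity solution of $$\min\Big\{v-u_T,\ -\lambda_n\Big[D^2v-\frac{A^{-1}}{T}\Big]\Big\}=0.$$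
   Context: $\mathrm{Lip}(\mathbb{R}^n)$ is the set of Lipschitz continuous functions $\mathbb{R}^n\to\mathbb{R}$. $H_{pp}$ is the Hessian of $H$. For a symmetric $n\times n$ matrix $X$, $\lambda_n[X]$ is its largest eigenvalue. The obstacle problems are posed on the whole space $\mathbb{R}^n$. Viscosity solution of the obstacle problem $\min\{v-u_T,\,-\lambda_n[D^2v-\frac{[H_{pp}(Dv)]^{-1}}{T}]\}=0$ (of which the equations in (1) and (2) are the special cases $n=1$ and $H_{pp}\equiv A$): - An upper semicontinuous $v$ is a viscosity subsolution if for every twice-differentiable $\phi$, one has $\phi(x_0)-u_T(x_0)\le0$ or $-\lambda_n\big[D^2\phi(x_0)-\frac{[H_{pp}(\nabla\phi(x_0))]^{-1}}{T}\big]\le0$, whenever $x_0$ is a local maximum of $v-\phi$ and $v(x_0)=\phi(x_0)$. - A lower semicontinuous $v$ is a viscosity supersolution if for every twice-differentiable $\phi$, one has $\phi(x_0)-u_T(x_0)\ge0$ and $-\lambda_n\big[D^2\phi(x_0)-\frac{[H_{pp}(\nabla\phi(x_0))]^{-1}}{T}\big]\ge0$, whenever $x_0$ is a local minimum of $v-\phi$ and $v(x_0)=\phi(x_0)$. - A continuous $v$ is a viscosity solution if it is both a viscosity sub- and supersolution. Viscosity solution of evolution equations: for continuous $F:\mathbb{R}^n\to\mathbb{R}$, a uniformly continuous $u:[0,T]\times\mathbb{R}^n\to\mathbb{R}$ is a viscosity solution of $\partial_t u+F(D_xu)=0$ if for every $\varphi\in C^\infty([0,T]\times\mathbb{R}^n)$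 and $(t_0,x_0)\in(0,T)\times\mathbb{R}^n$: $\partial_t\varphi(t_0,x_0)+F(\nabla_x\varphi(t_0,x_0))\le 0$ whenever $(t_0,x_0)$ is a local maximum of $u-\varphi$, and $\ge 0$ whenever it is a local minimum of $u-\varphi$. A function $w$ is a backward viscosity solution of $\partial_t w+H(D_xw)=0$ if $v(t,x):=w(T-t,x)$ is a viscosity solution of $\partial_t v-H(D_xv)=0$. For $u_0\in\mathrm{Lip}(\mathbb{R}^n)$, $S_T^+u_0:=u(T,\cdot)\in\mathrm{Lip}(\mathbb{R}^n)$, where $u$ is the unique viscosity solution of $\partial_tu+H(D_xu)=0$ in $[0,T]\times\mathbb{R}^n$ with $u(0,\cdot)=u_0$. For $u_T\in\mathrm{Lip}(\mathbb{R}^n)$, $S_T^-u_T:=w(0,\cdot)\in\mathrm{Lip}(\mathbb{R}^n)$, where $w$ is the unique backward viscosity solution of $\partial_tw+H(D_xw)=0$ in $[0,T]\times\mathbb{R}^n$ with $w(T,\cdot)=u_T$. With $L(q)=\max_{p\in\mathbb{R}^n}[q\cdot p-H(p)]$, these operators are given by the well-known formulas $$S_T^+u_0(x)=\min_{y\in\mathbb{R}^n}\Big[u_0(y)+T\,L\Big(\frac{x-y}{T}\Big)\Big],\qquad S_T^-u_T(x)=\max_{y\in\mathbb{R}^n}\Big[u_T(y)-T\,L\Big(\frac{y-x}{T}\Big)\Big].$$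
   Formalization: Uniqueness is proved among Lipschitz viscosity solutions, not all continuous ones; among continuous functions it fails, e.g. n=1, H(p)=p²/2, u_T=0, where both v=0 and v=x²/(2T) are viscosity solutions. *)

(* Defs.v *)
From HB Require Import structures.
From mathcomp Require Import all_boot all_order all_algebra.
From mathcomp Require Import all_classical all_reals all_analysis.

Set Implicit Arguments.
Unset Strict Implicit.
Unset Printing Implicit Defensive.

Import Order.TTheory GRing.Theory Num.Theory.
Import numFieldNormedType.Exports.

Local Open Scope classical_set_scope.
Local Open Scope ring_scope.

(* R^n is 'rV[R]_n with its sup norm; Lipschitz and uniform continuity do not
   depend on the choice of the norm. *)

Section calculus.
Context {R : realType}.

(* On a finite-dimensional space V this is the usual class C^k: all directional
   derivatives of f are C^(k-1) iff all partial derivatives are. *)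
Fixpoint Ck (V : normedModType R) (k : nat) (f : V -> R) : Prop :=
  if k is k'.+1
  then (forall x, differentiable f x) /\ (forall v, Ck k' ('D_v f))
  else continuous f.

Definition Cinfty (V : normedModType R) (f : V -> R) : Prop :=
  forall k, Ck k f.

Definition grad n (f : 'rV[R]_n -> R) (x : 'rV[R]_n) : 'rV[R]_n :=
  \row_i 'D_('e_i) f x.

Definition hessian n (f : 'rV[R]_n -> R) (x : 'rV[R]_n) : 'M[R]_n :=
  \matrix_(i, j) 'D_('e_j) ('D_('e_i) f) x.

Definition twice_differentiable n (f : 'rV[R]_n -> R) : Prop :=
  (forall x, differentiable f x) /\ (forall x, differentiable (grad f) x).

(* For a symmetric X with n >= 1 the set of eigenvalues is finite and nonempty,
   so that the supremum is a maximum. *)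
Definition lambda_max n (X : 'M[R]_n) : R := sup [set a | eigenvalue X a].

Definition usc (V : topologicalType) (v : V -> R) : Prop :=
  lower_semicontinuous (fun x => (- v x)%:E).

Definition lsc (V : topologicalType) (v : V -> R) : Prop :=
  lower_semicontinuous (fun x => (v x)%:E).

Definition local_max (V : topologicalType) (f : V -> R) (x : V) : Prop :=
  \forall y \near x, f y <= f x.

Definition local_min (V : topologicalType) (f : V -> R) (x : V) : Prop :=
  \forall y \near x, f x <= f y.

End calculus.

(* Viscosity solutions of min {v - uT, G(Dv, D^2 v)} = 0 on R^n. *)
Section obstacle.
Context {R : realType} {n : nat}.
Variables (G : 'rV[R]_n -> 'M[R]_n -> R) (uT : 'rV[R]_n -> R).

Definition obstacle_subsolution (v : 'rV[R]_n -> R) : Prop :=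
  usc v /\
  forall phi : 'rV[R]_n -> R, twice_differentiable phi ->
  forall x0, local_max (fun x => v x - phi x) x0 -> v x0 = phi x0 ->
    phi x0 - uT x0 <= 0 \/ G (grad phi x0) (hessian phi x0) <= 0.

Definition obstacle_supersolution (v : 'rV[R]_n -> R) : Prop :=
  lsc v /\
  forall phi : 'rV[R]_n -> R, twice_differentiable phi ->
  forall x0, local_min (fun x => v x - phi x) x0 -> v x0 = phi x0 ->
    phi x0 - uT x0 >= 0 /\ G (grad phi x0) (hessian phi x0) >= 0.

Definition obstacle_solution (v : 'rV[R]_n -> R) : Prop :=
  [/\ continuous v, obstacle_subsolution v & obstacle_supersolution v].

(* Uniqueness is meant in Lip(R^n), the space on which the operators below act.
   Among all continuous functions it fails: for uT = 0 and H(p) = |p|^2/2 both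
   0 and |x|^2/(2T) (Euclidean norm) solve the obstacle problem. *)
Definition unique_obstacle_solution (v : 'rV[R]_n -> R) : Prop :=
  unique (fun w => lipschitz w /\ obstacle_solution w) v.

End obstacle.

Section hamilton_jacobi.
Context {R : realType} {n : nat}.

Definition unif_continuous_slab (T : R) (u : R * 'rV[R]_n -> R) : Prop :=
  forall e : R, 0 < e -> exists2 d : R, 0 < d &
  forall y z : R * 'rV[R]_n, 0 <= y.1 <= T -> 0 <= z.1 <= T ->
    `|y - z| < d -> `|u y - u z| < e.

(* A function on [0, T] x R^n is represented by a function on R x R^n whose
   values outside the slab are irrelevant. Test functions in
   C^oo([0, T] x R^n) are the restrictions of those in C^oo(R x R^n). *)
Definition hj_solution (F : 'rV[R]_n -> R) (T : R)
    (u : R * 'rV[R]_n -> R) : Prop :=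
  unif_continuous_slab T u /\
  forall phi : R * 'rV[R]_n -> R, Cinfty phi ->
  forall (t0 : R) (x0 : 'rV[R]_n), 0 < t0 < T ->
    let residual := derive1 (fun t => phi (t, x0)) t0 +
                    F (grad (fun x => phi (t0, x)) x0) in
    (local_max (fun z => u z - phi z) (t0, x0) -> residual <= 0) /\
    (local_min (fun z => u z - phi z) (t0, x0) -> residual >= 0).

Definition hj_backward_solution (H : 'rV[R]_n -> R) (T : R)
    (w : R * 'rV[R]_n -> R) : Prop :=
  hj_solution (fun p => - H p) T (fun z => w (T - z.1, z.2)).

(* [get] picks the viscosity solution with the given data (and is a junk value
   if there is none). *)
Definition S_plus (H : 'rV[R]_n -> R) (T : R) (u0 : 'rV[R]_n -> R)
    (x : 'rV[R]_n) : R :=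
  get [set u | hj_solution H T u /\ forall y, u (0, y) = u0 y] (T, x).

Definition S_minus (H : 'rV[R]_n -> R) (T : R) (uT : 'rV[R]_n -> R)
    (x : 'rV[R]_n) : R :=
  get [set w | hj_backward_solution H T w /\ forall y, w (T, y) = uT y] (0, x).

End hamilton_jacobi.

(* Main.v *)
(* Viscosity solutions of the evolution equations are unique (doubling of
   variables) and given by the Hopf-Lax formula. Hence u_T^* is the infimum of
   the "paraboloids" P(x) = c + T L((x - y) / T) that lie above u_T, and the
   infimum is attained at each point.

   Supersolution: a test function touching u_T^* from below at x0 lies below a
   paraboloid through x0, whose Hessian is [H_pp]^-1 / T.

   Subsolution: let phi touch u_T^* from above at x0, with u_T < u_T^* at x0 and
   D^2 phi < [H_pp]^-1 / T. The paraboloid with the same slope at x0 exceeds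
   u_T^* by a fixed amount on a small sphere, and therefore, since along a ray
   the difference of two paraboloids cannot increase after it has decreased,
   outside of that sphere too. It may thus be lowered while staying above u_T,
   which contradicts the minimality of u_T^*.

   Uniqueness: a subsolution stays below every paraboloid P >= u_T, by
   comparison with the flatter functions obtained by increasing T. For a
   supersolution v, at the points where v is touched from above by a smooth
   function (these are dense) the paraboloid with the same slope dominates v, by
   comparison with the steeper functions obtained by decreasing T. Hence
   v >= u_T^* at these points. *)

Require Import Defs.
From HB Require Import structures.
From mathcomp Require Import all_boot all_order all_algebra.
From mathcomp Require Import all_classical all_reals all_analysis.
From mathcomp Require Import ring lra.

Set Implicit Arguments.
Unset Strict Implicit.
Unset Printing Implicit Defensive.

Import Order.TTheory GRing.Theory Num.Theory.
Import numFieldNormedType.Exports.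

Local Open Scope classical_set_scope.
Local Open Scope ring_scope.

(** The Hessian condition is one-sided. For a supersolution it bounds the Hessian of a test function
    in every direction, so a single bad direction is a contradiction; for a subsolution the test
    function has to be strictly flatter in all directions. This is why the lower comparison can be
    run along one segment of direction d: penalizing the distance to its axis turns a dip along the
    segment into a local minimum in space, and the penalty has no second derivative along d. The
    price is that it shifts the gradient of the test function by some w orthogonal to d, and
    [H_pp]^-1 is evaluated at the shifted gradient. It does not see the shift if H_pp is constant,
    and w = 0 if n = 1. The ray property has the same two sources: the difference of two paraboloids
    is affine for quadratic H, and monotone for n = 1 because L is convex. [obstacle_structure]
    isolates these facts so that both cases share one argument. *)

Section near_norm.
Context {R : realType}.

Lemma near_normP (V : normedModType R) (x : V) (P : V -> Prop) :
  (\forall y \near x, P y) <->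
  exists2 d : R, 0 < d & forall y, `|y - x| < d -> P y.
Proof.
split.
- move=> /nbhs_ballP[d /= d0 dP]; exists d => // y yx; apply: dP.
  by rewrite -ball_normE /= distrC.
- move=> [d d0 dP]; apply/nbhs_ballP; exists d => //= y.
  by rewrite -ball_normE /= distrC; exact: dP.
Qed.

Lemma cts_normP (V W : normedModType R) (f : V -> W) (x : V) :
  {for x, continuous f} <->
  forall e : R, 0 < e -> exists2 d : R, 0 < d &
    forall y, `|y - x| < d -> `|f y - f x| < e.
Proof.
split.
- move=> /cvgrPdist_lt cf e e0; have /near_normP[d d0 dP] := cf _ e0.
  by exists d => // y /dP; rewrite distrC.
- move=> h; apply/cvgrPdist_lt => e e0; have [d d0 dP] := h _ e0.
  by apply/near_normP; exists d => // y /dP; rewrite distrC.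
Qed.

Lemma lipschitzP (V : normedModType R) (f : V -> R) : lipschitz f <->
  exists2 C : R, 0 <= C & forall x y, `|f x - f y| <= C * `|x - y|.
Proof.
split.
- move=> [M [_ Mf]]; exists (`|M| + 1); first by rewrite addr_ge0.
  by move=> x y; apply: (Mf (`|M| + 1) _ (x, y)) => //=; rewrite ltr_pwDr // ler_norm.
- move=> [C C0 h]; exists C; split; first exact: num_real.
  move=> M CM [x y] _ /=; apply: le_trans (h _ _) _.
  by rewrite ler_wpM2r // ltW.
Qed.

Lemma lipschitz_cts (V : normedModType R) (f : V -> R) (C : R) :
  (forall x y, `|f x - f y| <= C * `|x - y|) -> continuous f.
Proof.
move=> h x; apply/cts_normP => e e0.
have C1 : 0 < `|C| + 1 by rewrite ltr_wpDl.
exists (e / (`|C| + 1)); first by rewrite divr_gt0.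
move=> y; rewrite ltr_pdivlMr // mulrC => ye.
apply: le_lt_trans (h _ _) _; apply: le_lt_trans _ ye.
by rewrite ler_wpM2r // (le_trans (ler_norm _)) // lerDl.
Qed.

End near_norm.

(** * Inner product, quadratic forms and eigenvalues *)

Section inner_product.
Context {R : realType} {n : nat}.
Implicit Types (x y z h : 'rV[R]_n) (X Y : 'M[R]_n).

Definition dot x y : R := (x *m y^T) 0 0.
Definition qf X h : R := (h *m X *m h^T) 0 0.

Lemma dotE x y : dot x y = \sum_i x 0 i * y 0 i.
Proof. by rewrite /dot mxE; apply: eq_bigr => i _; rewrite mxE. Qed.

Lemma dotC x y : dot x y = dot y x.
Proof. by rewrite !dotE; apply: eq_bigr => i _; rewrite mulrC. Qed.

Lemma dotDl x y z : dot (x + y) z = dot x z + dot y z.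
Proof. by rewrite /dot mulmxDl mxE. Qed.

Lemma dotDr x y z : dot z (x + y) = dot z x + dot z y.
Proof. by rewrite dotC dotDl !(dotC z). Qed.

Lemma dotZl (a : R) x y : dot (a *: x) y = a * dot x y.
Proof. by rewrite /dot -scalemxAl mxE. Qed.

Lemma dotZr (a : R) x y : dot x (a *: y) = a * dot x y.
Proof. by rewrite dotC dotZl dotC. Qed.

Lemma dotNl x y : dot (- x) y = - dot x y.
Proof. by rewrite -scaleN1r dotZl mulN1r. Qed.

Lemma dotNr x y : dot x (- y) = - dot x y.
Proof. by rewrite dotC dotNl dotC. Qed.

Lemma dotBl x y z : dot (x - y) z = dot x z - dot y z.
Proof. by rewrite dotDl dotNl. Qed.

Lemma dotBr x y z : dot z (x - y) = dot z x - dot z y.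
Proof. by rewrite dotDr dotNr. Qed.

Lemma dot0l x : dot 0 x = 0.
Proof. by rewrite /dot mul0mx mxE. Qed.

Lemma dot0r x : dot x 0 = 0.
Proof. by rewrite dotC dot0l. Qed.

Lemma dot_ge0 x : 0 <= dot x x.
Proof. by rewrite dotE sumr_ge0 // => i _; rewrite -expr2 sqr_ge0. Qed.

Lemma ler_coord x i : `|x 0 i| <= `|x|.
Proof.
rewrite [leRHS]mx_normrE.
by apply: (le_bigmax_cond _ (fun ij : 'I_1 * 'I_n => `|x ij.1 ij.2|) (j := (0, i))).
Qed.

Lemma norm_coordE x : `|x| = 0 \/ exists i, `|x| = `|x 0 i|.
Proof.
have [x0|x0] := eqVneq `|x| 0; first by left.
right; have [[j i] /= h] := mx_norm_neq0 x0.
by exists i; rewrite [LHS]h (ord1 j).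
Qed.

(** The largest coordinate is one of the squares summed in [dot x x]. Through this bound Euclidean
    penalties control sup-norm distances. *)
Lemma norm_sq_le_dot x : `|x| ^+ 2 <= dot x x.
Proof.
have [->|[i ->]] := norm_coordE x; first by rewrite expr2 mul0r dot_ge0.
rewrite dotE (bigD1 i) //= -[x 0 i * _]expr2 real_normK ?num_real // lerDl.
by rewrite sumr_ge0 // => j _; rewrite -expr2 sqr_ge0.
Qed.

Lemma dot_le_norm x y : `|dot x y| <= n%:R * `|x| * `|y|.
Proof.
rewrite dotE (le_trans (ler_norm_sum _ _ _)) //.
apply: (@le_trans _ _ (\sum_(i < n) `|x| * `|y|)).
  by apply: ler_sum => i _; rewrite normrM ler_pM // ler_coord.
by rewrite sumr_const card_ord -mulrA mulr_natl.
Qed.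

Lemma dot_le x y : dot x y <= n%:R * `|x| * `|y|.
Proof. exact: le_trans (ler_norm _) (dot_le_norm _ _). Qed.

Lemma dot_self_eq0 x : dot x x = 0 -> x = 0.
Proof.
move=> xx; have := norm_sq_le_dot x; rewrite xx => h.
have /eqP : `|x| ^+ 2 = 0 by apply/eqP; rewrite eq_le h sqr_ge0.
by rewrite sqrf_eq0 normr_eq0 => /eqP.
Qed.

Lemma dot_self_gt0 x : x != 0 -> 0 < dot x x.
Proof.
move=> x0; rewrite lt_neqAle dot_ge0 andbT; apply: contra x0 => /eqP h.
by apply/eqP/dot_self_eq0.
Qed.

Lemma dot_delta x i : dot x ('e_i) = x 0 i.
Proof.
rewrite dotE (bigD1 i) //= mxE !eqxx mulr1 big1 ?addr0 // => j ji.
by rewrite mxE (negbTE ji) andbF mulr0.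
Qed.

(* The sup norm is dual to the l^1 norm; a unit coordinate vector attains it. *)
Lemma dot_direction x : exists2 e : 'rV[R]_n, `|e| <= 1 & dot e x = `|x|.
Proof.
have [x0|[i xi]] := norm_coordE x.
  by exists 0; rewrite ?normr0 // dot0l.
exists (Num.sg (x 0 i) *: 'e_i).
  rewrite normrZ mulr_ile1 //; first by rewrite normr_sg lern1 leq_b1.
  have [->|[j ->]] := norm_coordE ('e_i : 'rV[R]_n) => //.
  by rewrite mxE eqxx /= normr_nat lern1 leq_b1.
by rewrite dotZl dotC dot_delta xi normrEsg.
Qed.

Lemma dot_cts (y : 'rV[R]_n) : continuous (fun x => dot x y).
Proof.
apply: (@lipschitz_cts _ _ _ (n%:R * `|y|)) => a b.
by rewrite -dotBl (le_trans (dot_le_norm _ _)) // mulrAC.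
Qed.

Lemma qfE X h : qf X h = dot (h *m X) h.
Proof. by []. Qed.

Lemma qfD X Y h : qf (X + Y) h = qf X h + qf Y h.
Proof. by rewrite !qfE mulmxDr dotDl. Qed.

Lemma qfZ (a : R) X h : qf (a *: X) h = a * qf X h.
Proof. by rewrite !qfE -scalemxAr dotZl. Qed.

Lemma qfN X h : qf (- X) h = - qf X h.
Proof. by rewrite -scaleN1r qfZ mulN1r. Qed.

Lemma qfB X Y h : qf (X - Y) h = qf X h - qf Y h.
Proof. by rewrite qfD qfN. Qed.

Lemma qf1 h : qf 1%:M h = dot h h.
Proof. by rewrite qfE mulmx1. Qed.

Lemma qfsc (a : R) h : qf a%:M h = a * dot h h.
Proof. by rewrite -scalemx1 qfZ qf1. Qed.

Lemma qf0 X : qf X 0 = 0.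
Proof. by rewrite qfE mul0mx dot0l. Qed.

Lemma qfZv X (a : R) h : qf X (a *: h) = a ^+ 2 * qf X h.
Proof. by rewrite !qfE -scalemxAl dotZl dotZr mulrA. Qed.

Lemma dot_mulmxC X x y : dot (x *m X) y = dot x (y *m X^T).
Proof. by rewrite /dot trmx_mul trmxK mulmxA. Qed.

Lemma dot_mulmx_sym X x y : X^T = X -> dot (x *m X) y = dot (y *m X) x.
Proof. by move=> sX; rewrite dot_mulmxC sX dotC. Qed.

Lemma qfDv X x y : X^T = X ->
  qf X (x + y) = qf X x + 2 * dot (x *m X) y + qf X y.
Proof.
move=> sX; rewrite !qfE mulmxDl dotDl !dotDr (dot_mulmx_sym y x sX).
by rewrite mulr2n mulrDl mul1r !addrA.
Qed.

Lemma qf_outer (d h : 'rV[R]_n) : qf (d^T *m d) h = dot d h ^+ 2.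
Proof.
rewrite qfE /dot mulmxA -mulmxA [in LHS]mxE big_ord1 expr2; congr (_ * _).
by rewrite -/(dot h d) dotC.
Qed.

Lemma mulmx_le_norm X : exists2 C : R, 0 <= C & forall x, `|x *m X| <= C * `|x|.
Proof.
exists (\sum_i \sum_j `|X i j|).
  by apply: sumr_ge0 => i _; apply: sumr_ge0.
move=> x; have [->|[j ->]] := norm_coordE (x *m X).
  by rewrite mulr_ge0 //; apply: sumr_ge0 => i _; apply: sumr_ge0.
rewrite mxE (le_trans (ler_norm_sum _ _ _)) // mulr_suml ler_sum // => i _.
rewrite normrM mulrC ler_pM // ?ler_coord //.
by rewrite (bigD1 j) //= lerDl sumr_ge0.
Qed.

Lemma qf_cts X : continuous (qf X).
Proof.
move=> x; apply/cts_normP => e e0.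
have [C C0 hC] := mulmx_le_norm X; have [D D0 hD] := mulmx_le_norm X^T.
pose K := n%:R * C * (`|x| + 1) + n%:R * D * `|x| + 1.
have K0 : 0 < K by rewrite ltr_wpDl // addr_ge0 // !mulr_ge0 // addr_ge0.
exists (Num.min 1 (e / K)); first by rewrite lt_min ltr01 divr_gt0.
move=> y; rewrite lt_min => /andP[y1]; rewrite ltr_pdivlMr // => yK.
have -> : qf X y - qf X x = dot (y *m X) (y - x) + dot (y - x) (x *m X^T).
  by rewrite -dot_mulmxC !qfE mulmxBl dotBr dotBl; ring.
apply: le_lt_trans yK; apply: le_trans (ler_normD _ _) _.
have yx : `|y| <= `|x| + 1.
  by rewrite -(subrK x y) addrC (le_trans (ler_normD _ _)) // lerD2l ltW.
have h1 : `|dot (y *m X) (y - x)| <= n%:R * C * (`|x| + 1) * `|y - x|.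
  apply: le_trans (dot_le_norm _ _) _; apply: ler_wpM2r => //.
  by rewrite -mulrA ler_wpM2l // (le_trans (hC _)) // ler_wpM2l.
have h2 : `|dot (y - x) (x *m X^T)| <= n%:R * D * `|x| * `|y - x|.
  rewrite dotC; apply: le_trans (dot_le_norm _ _) _; apply: ler_wpM2r => //.
  by rewrite -mulrA ler_wpM2l.
have := normr_ge0 (y - x); rewrite /K; nra.
Qed.

End inner_product.

Section extrema.
Context {R : realType} {n : nat}.

Lemma ball_compact (r : R) : compact [set x : 'rV[R]_n | `|x| <= r].
Proof.
apply: bounded_closed_compact.
- exists r; split; first exact: num_real.
  by move=> M rM x /= /le_trans; apply; exact: ltW.
- apply: (@closed_comp _ _ (fun x : 'rV[R]_n => `|x|) [set y : R | y <= r]).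
    by move=> x _; exact: norm_continuous.
  exact: closed_le.
Qed.

Lemma coercive_max (f : 'rV[R]_n -> R) (r : R) : continuous f ->
  (forall x, r < `|x| -> f x <= f 0) -> exists x, forall y, f y <= f x.
Proof.
move=> cf hr.
(* Using [|r|] keeps the ball nonempty when [r] is negative. *)
have [||x _ hx] := @EVT_max_rV R n f _ _ (@ball_compact `|r|).
- by exists 0; rewrite /= normr0.
- exact: continuous_subspaceT.
exists x => y; have [yr|yr] := leP `|y| `|r|; first by apply: hx; rewrite inE.
apply: (@le_trans _ _ (f 0)); last by apply: hx; rewrite inE /= normr0.
by apply: hr; exact: le_lt_trans (ler_norm _) yr.
Qed.

Lemma coercive_min (f : 'rV[R]_n -> R) (r : R) : continuous f ->
  (forall x, r < `|x| -> f 0 <= f x) -> exists x, forall y, f x <= f y.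
Proof.
move=> cf hr; have [||x hx] := @coercive_max (- f) r.
- by move=> x; apply: continuousN; exact: cf.
- by move=> x /hr; rewrite !fctE lerN2.
by exists x => y; have := hx y; rewrite !fctE lerN2.
Qed.

End extrema.

Section rayleigh.
Context {R : realType} {n : nat}.
Implicit Types (X : 'M[R]_n) (h : 'rV[R]_n).

Lemma unit_sphere_compact : compact [set x : 'rV[R]_n | dot x x = 1].
Proof.
apply: bounded_closed_compact.
- exists 1; split; first exact: num_real.
  move=> M M1 x /= x1; apply: le_trans (ltW M1).
  by rewrite -(@expr_le1 _ 2) // -x1 norm_sq_le_dot.
- have -> : [set x : 'rV[R]_n | dot x x = 1] = qf 1%:M @^-1` [set y | y = 1].
    by apply/seteqP; split => x /=; rewrite qf1.
  apply: closed_comp; last exact: closed_eq.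
  by move=> x _; exact: qf_cts.
Qed.

(* A maximizer e of the form on the unit sphere is a zero of the nonnegative
   form of mu - X, hence in its kernel. *)
Lemma rayleigh_max X : (0 < n)%N -> X^T = X ->
  exists2 mu, eigenvalue X mu & forall h, qf X h <= mu * dot h h.
Proof.
move=> n0 sX.
have [||e] := @EVT_max_rV R n (qf X) _ _ unit_sphere_compact.
- exists 'e_(Ordinal n0); rewrite /= dot_delta mxE !eqxx //.
- by apply: continuous_subspaceT => x; exact: qf_cts.
rewrite inE /= => e1 he; pose mu := qf X e.
have hmu h : qf X h <= mu * dot h h.
  have [->|h0] := eqVneq h 0; first by rewrite qf0 dot0l mulr0.
  have hh := dot_self_gt0 h0.
  have s0 : 0 < Num.sqrt (dot h h) by rewrite sqrtr_gt0.
  have s2 : Num.sqrt (dot h h) ^+ 2 = dot h h by rewrite sqr_sqrtr ?dot_ge0.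
  have := he ((Num.sqrt (dot h h))^-1 *: h).
  rewrite inE /= dotZl dotZr mulrA -expr2 exprVn s2 mulVf ?gt_eqF // => /(_ erefl).
  by rewrite qfZv exprVn s2 mulrC ler_pdivrMr.
pose M : 'M[R]_n := mu%:M - X; pose v := e *m M.
have sM : M^T = M by rewrite /M raddfB /= tr_scalar_mx sX.
have M0 h : 0 <= qf M h by rewrite /M qfB qfsc subr_ge0.
have Me : qf M e = 0 by rewrite /M qfB qfsc e1 mulr1 subrr.
have v0 : v = 0.
  apply: dot_self_eq0; apply/eqP; rewrite eq_le dot_ge0 andbT leNgt.
  apply/negP => vv.
  (* A step of length [t] from [e] along [- v] changes the form by
     [- 2 * t * dot v v + t ^+ 2 * qf M v], which is negative for this [t]. The [+ 1] keeps the
     denominator positive. *)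
  pose t := dot v v / (qf M v + 1).
  have q1 : 0 < qf M v + 1 by rewrite ltr_wpDl.
  have t0 : 0 < t by rewrite divr_gt0.
  have := M0 (e + (- t) *: v).
  rewrite qfDv // Me add0r qfZv dotZr -/v sqrrN => h.
  have tq : t * (qf M v + 1) = dot v v by rewrite divfK // gt_eqF.
  have : 0 <= t * (- 2 * dot v v + t * qf M v) by move: h; congr (_ <= _); ring.
  rewrite pmulr_rge0 // => h2; move: tq vv t0 h2.
  by move: (qf M v) (dot v v) => a b; rewrite mulrDr; lra.
exists mu => //; apply/eigenvalueP; exists e.
  by move: v0; rewrite /v /M mulmxBr mul_mx_scalar => /eqP; rewrite subr_eq0 => /eqP.
by apply: contra_eq_neq e1 => ->; rewrite dot0l eq_sym oner_eq0.
Qed.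

Lemma eigenvalue_le X a c : eigenvalue X a ->
  (forall h, qf X h <= c * dot h h) -> a <= c.
Proof.
move=> /eigenvalueP[e ea e0] /(_ e).
by rewrite qfE ea dotZl ler_pM2r // dot_self_gt0.
Qed.

(** The Rayleigh maximum is an eigenvalue and bounds all the others, so it is the [sup] in
    [lambda_max]. *)
Lemma lambda_max_eigen X : (0 < n)%N -> X^T = X ->
  eigenvalue X (lambda_max X) /\ forall h, qf X h <= lambda_max X * dot h h.
Proof.
move=> n0 sX; have [mu emu hmu] := rayleigh_max n0 sX.
suff -> : lambda_max X = mu by [].
apply/eqP; rewrite eq_le; apply/andP; split.
- by apply: ge_sup; [exists mu | move=> a /= ea; exact: eigenvalue_le ea hmu].
- apply: ub_le_sup => //; exists mu => a /= ea; exact: eigenvalue_le ea hmu.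
Qed.

(** The constant is the least eigenvalue of [X], found as minus the Rayleigh maximum of [- X]; it is
    positive because the form is positive at its eigenvector. *)
Lemma posdef_coercive X : (0 < n)%N -> X^T = X ->
  (forall h, h != 0 -> 0 < qf X h) ->
  exists2 c, 0 < c & forall h, c * dot h h <= qf X h.
Proof.
move=> n0 sX pX; have sNX : (- X)^T = - X by rewrite raddfN /= sX.
have [mu /eigenvalueP[e emu e0] hmu] := rayleigh_max n0 sNX.
exists (- mu).
  have := pX _ e0; have := dot_self_gt0 e0.
  have -> : qf X e = (- mu) * dot e e.
    by rewrite mulNr -dotZl -emu -qfE qfN opprK.
  by move=> ? ?; rewrite -(@pmulr_lgt0 _ (dot e e)).
by move=> h; have := hmu h; rewrite qfN mulNr lerNl.
Qed.

End rayleigh.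

(** * Second-order calculus *)

Section differential_eps.
Context {R : realType}.

Lemma diff_epsP (V W : normedModType R) (f : V -> W) (x : V) (l : {linear V -> W}) :
  continuous l ->
  (forall e : R, 0 < e -> exists2 d : R, 0 < d &
     forall h, `|h| < d -> `|f (x + h) - f x - l h| <= e * `|h|) ->
  is_diff x f l.
Proof.
move=> cl hl.
have key : f \o shift x = cst (f x) + l +o_ 0 id.
  apply/eqaddoP => e e0; have [d d0 hd] := hl _ e0.
  apply/near_normP; exists d => // h; rewrite subr0 => /hd.
  rewrite (_ : (f \o shift x - (cst (f x) + l)) h = f (x + h) - f x - l h) //.
  by rewrite !fctE /= opprD addrA [h + x]addrC.
have dE := diff_unique cl key.
apply: DiffDef => //; apply/diff_locallyP; rewrite dE; split => //.
Qed.

Lemma diff_eps (V W : normedModType R) (f : V -> W) (x : V) :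
  differentiable f x ->
  forall e : R, 0 < e -> exists2 d : R, 0 < d &
     forall h, `|h| < d -> `|f (x + h) - f x - 'd f x h| <= e * `|h|.
Proof.
move=> /diff_locallyP[_ /eqaddoP h] e e0.
have /near_normP[d d0 hd] := h _ e0.
exists d => // k kd; have := hd k; rewrite subr0 => /(_ kd).
rewrite (_ : (f \o shift x - (cst (f x) + 'd f x)) k = f (x + k) - f x - 'd f x k) //.
by rewrite !fctE /= opprD addrA [k + x]addrC.
Qed.

Lemma diff_quadratic (V : normedModType R) (f : V -> R) (x : V)
    (l : {linear V -> R}) (C : R) :
  continuous l -> (forall h, `|f (x + h) - f x - l h| <= C * `|h| ^+ 2) ->
  is_diff x f l.
Proof.
move=> cl h; apply: diff_epsP => // e e0.
have C1 : 0 < `|C| + 1 by rewrite ltr_wpDl.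
exists (e / (`|C| + 1)); first by rewrite divr_gt0.
move=> k; rewrite ltr_pdivlMr // => ke; apply: le_trans (h k) _.
rewrite expr2 mulrA ler_wpM2r //; apply: le_trans (ltW ke).
by rewrite mulrC ler_wpM2l // (le_trans (ler_norm _)) // lerDl.
Qed.

End differential_eps.

Section gradient.
Context {R : realType} {n : nat}.
Implicit Types (f : 'rV[R]_n -> R) (x p h : 'rV[R]_n) (X : 'M[R]_n).

Lemma dot_is_linear p : linear (dot p : 'rV[R]_n -> R).
Proof. by move=> a u v; rewrite dotDr dotZr. Qed.

HB.instance Definition _ p :=
  GRing.isLinear.Build R 'rV[R]_n R _ (dot p) (dot_is_linear p).

Lemma dotr_cts p : continuous (dot p).
Proof. by have := @dot_cts R n p; rewrite (_ : dot^~ p = dot p) // funeqE => x; rewrite dotC. Qed.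

Lemma diff_grad f x h : differentiable f x -> 'd f x h = dot (grad f x) h.
Proof.
move=> df; rewrite {1}(row_sum_delta h) linear_sum dotE.
by apply: eq_bigr => i _; rewrite linearZ mxE deriveE // mulrC.
Qed.

Lemma grad_is_diff f x p : is_diff x f (dot p) -> grad f x = p.
Proof.
move=> df; apply/rowP => i; rewrite mxE deriveE // diff_val.
by rewrite dot_delta.
Qed.

(** The transpose comes from the row-vector convention: entry [(i, j)] of [hessian] differentiates
    component [i] of the gradient along ['e_j]. [hessian_sym] removes it later. *)
Lemma diff_grad_hessian f x h : differentiable (grad f) x ->
  'd (grad f) x h = h *m (hessian f x)^T.
Proof.
move=> dg.
have E j i : ('d (grad f) x 'e_j) 0 i = hessian f x i j.
  rewrite -deriveE // derive_mx; last exact: diff_derivable.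
  rewrite mxE [RHS]mxE (_ : (fun t => grad f t 0 i) = 'D_('e_i) f) //.
  by apply/funext => y; rewrite mxE.
rewrite {1}(row_sum_delta h) linear_sum; apply/rowP => i.
rewrite mxE summxE; apply: eq_bigr => j _.
by rewrite linearZ mxE E [_^T j i]mxE.
Qed.

(** Every test function built for the obstacle problem has this form: for symmetric [X] its value,
    gradient and Hessian at [x1] are [c], [p] and [X]. *)
Definition quad x1 (c : R) p X x : R := c + dot p (x - x1) + qf X (x - x1) / 2.

Lemma quad0 x1 c p X : quad x1 c p X x1 = c.
Proof. by rewrite /quad subrr dot0r qf0 mul0r !addr0. Qed.

Lemma qf_bound X : exists2 C : R, 0 <= C & forall h, `|qf X h| <= C * `|h| ^+ 2.
Proof.
have [C C0 hC] := mulmx_le_norm X; exists (n%:R * C); first by rewrite mulr_ge0.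
move=> h; apply: le_trans (dot_le_norm _ _) _.
by rewrite expr2 mulrA ler_wpM2r // -mulrA ler_wpM2l.
Qed.

Lemma quad_is_diff x1 c p X x : X^T = X ->
  is_diff x (quad x1 c p X) (dot (p + (x - x1) *m X)).
Proof.
move=> sX; have [C C0 hC] := qf_bound X.
apply: (@diff_quadratic _ _ _ _ _ (C / 2)); first exact: dotr_cts.
move=> h; have -> : quad x1 c p X (x + h) - quad x1 c p X x -
    dot (p + (x - x1) *m X) h = qf X h / 2.
  rewrite /quad [x + h - x1]addrAC (qfDv (x - x1) h sX) dotDr dotDl.
  by field.
rewrite normrM [X in _ * X]ger0_norm ?invr_ge0 //.
by have := hC h; lra.
Qed.

Lemma grad_quad x1 c p X : X^T = X ->
  grad (quad x1 c p X) = fun x => p + (x - x1) *m X.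
Proof.
by move=> sX; apply/funext => x; apply: grad_is_diff; exact: quad_is_diff.
Qed.

Lemma grad_quad_is_diff x1 c p X x : X^T = X ->
  is_diff x (grad (quad x1 c p X)) (mulmxr X).
Proof.
move=> sX; have [C C0 hC] := mulmx_le_norm X.
apply: diff_epsP.
  move=> y; apply/cts_normP => e e0.
  have C1 : 0 < C + 1 by rewrite ltr_wpDl.
  exists (e / (C + 1)); first by rewrite divr_gt0.
  move=> z; rewrite ltr_pdivlMr // => ze.
  rewrite /= -mulmxBl; apply: le_lt_trans (hC _) _.
  by apply: le_lt_trans ze; rewrite mulrC ler_wpM2l // lerDl.
move=> e e0; exists 1 => // h _; rewrite grad_quad // /=.
have -> : p + (x + h - x1) *m X - (p + (x - x1) *m X) - h *m X = 0.
  by rewrite [x + h - x1]addrAC mulmxDl addrA [_ + h *m X]addrC addrK subrr.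
by rewrite normr0 mulr_ge0 // ltW.
Qed.

Lemma hessian_quad x1 c p X x : X^T = X -> hessian (quad x1 c p X) x = X.
Proof.
move=> sX; have dg := grad_quad_is_diff x1 c p x sX.
have key h : h *m (hessian (quad x1 c p X) x)^T = h *m X.
  by rewrite -diff_grad_hessian // diff_val.
apply: trmx_inj; rewrite sX; apply/row_matrixP => i; rewrite !rowE; exact: key.
Qed.

Lemma twice_differentiable_quad x1 c p X : X^T = X ->
  twice_differentiable (quad x1 c p X).
Proof.
move=> sX; split => x.
  by have := quad_is_diff x1 c p x sX.
by have := grad_quad_is_diff x1 c p x sX.
Qed.

Lemma line_is_diff (x h : 'rV[R]_n) (t : R) :
  is_diff t (fun s : R => x + s *: h) (fun s => s *: h).
Proof.
have H : is_diff t (cst x + *:%R^~ h) (0 + *:%R^~ h).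
  by apply: is_diffD.
by rewrite add0r in H.
Qed.

Lemma line_is_derive f x h (t : R) : (forall y, differentiable f y) ->
  is_derive t 1 (fun s : R => f (x + s *: h)) (dot (grad f (x + t *: h)) h).
Proof.
move=> df; have dl := line_is_diff x h t.
have dc : is_diff t (f \o (fun s : R => x + s *: h))
    ('d f (x + t *: h) \o (fun s => s *: h)).
  by apply: is_diff_comp => //; exact: differentiableP.
have dc' : differentiable (fun s : R => f (x + s *: h)) t by case: dc.
apply: DeriveDef; first exact: diff_derivable.
rewrite deriveE // -[X in 'd X t](_ : f \o (fun s : R => x + s *: h) = _) //.
by rewrite diff_val /= scale1r diff_grad.
Qed.

Lemma line_cts f x h : (forall y, differentiable f y) ->
  continuous (fun s : R => f (x + s *: h)).
Proof.
move=> df t; have := line_is_derive x h t df => -[d _].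
by apply: differentiable_continuous; exact/derivable1_diffP.
Qed.

Lemma line_MVT f x h (a : R) : 0 < a -> (forall y, differentiable f y) ->
  exists2 c : R, 0 < c < a &
    f (x + a *: h) - f x = a * dot (grad f (x + c *: h)) h.
Proof.
move=> a0 df.
have [|c] := @MVT R (fun s : R => f (x + s *: h))
  (fun t => dot (grad f (x + t *: h)) h) 0 a a0 (fun t _ => line_is_derive x h t df).
  by apply: continuous_subspaceT; exact: line_cts.
rewrite in_itv /= => c0a; rewrite scale0r addr0 subr0 => ->.
by exists c => //; rewrite mulrC.
Qed.

End gradient.

Section second_order.
Context {R : realType} {n : nat}.
Variable f : 'rV[R]_n -> R.
Hypothesis f2 : twice_differentiable f.
Implicit Types (x u v h : 'rV[R]_n) (e s : R).

Lemma grad_eps x e : 0 < e -> exists2 d : R, 0 < d & forall h, `|h| < d ->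
  `|grad f (x + h) - grad f x - h *m (hessian f x)^T| <= e * `|h|.
Proof.
move=> e0; have [d d0 hd] := diff_eps (f2.2 x) e0.
by exists d => // h /hd; rewrite diff_grad_hessian //; exact: f2.2.
Qed.

(** Second derivatives need not be continuous. After subtraction of the second-order polynomial, the
    mean value theorem reduces the claim to the differentiability of the gradient at the single
    point [x]. *)
Lemma taylor2 x e : 0 < e -> exists2 d : R, 0 < d & forall h, `|h| < d ->
  `|f (x + h) - f x - dot (grad f x) h - qf (hessian f x) h / 2| <= e * `|h| ^+ 2.
Proof.
move=> e0; have e1 : 0 < e / (n%:R + 1) by rewrite divr_gt0 // ltr_wpDl.
have [d d0 hd] := grad_eps x e1; exists d => // h hh.
pose S : 'M[R]_n := 2^-1 *: (hessian f x + (hessian f x)^T).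
have sS : S^T = S by rewrite /S linearZ /= linearD /= trmxK addrC.
have qS k : qf S k = qf (hessian f x) k.
  rewrite /S qfZ qfD; have -> : qf (hessian f x)^T k = qf (hessian f x) k.
    by rewrite !qfE dot_mulmxC trmxK dotC.
  by field.
pose df := f \- quad x (f x) (grad f x) S.
have ddf y : differentiable df y.
  apply: differentiableB; first exact: f2.1.
  by have := quad_is_diff x (f x) (grad f x) y sS.
have gdf y : grad df y = grad f y - grad (quad x (f x) (grad f x) S) y.
  apply/rowP => i; rewrite !mxE /df deriveB //; apply: diff_derivable.
    exact: f2.1.
  by have := quad_is_diff x (f x) (grad f x) y sS.
have [c /andP[c0 c1]] := line_MVT x h ltr01 ddf.
rewrite scale1r mul1r gdf grad_quad // /df /= quad0 subrr subr0.
rewrite /quad [x + h - x]addrAC subrr add0r qS => E.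
have -> : f (x + h) - f x - dot (grad f x) h - qf (hessian f x) h / 2 =
  f (x + h) - (f x + dot (grad f x) h + qf (hessian f x) h / 2) by ring.
rewrite E [x + c *: h - x]addrAC subrr add0r opprD addrA.
(* The increment [c *: h] is parallel to [h], so only the quadratic form enters and [S] may be
   traded for the transposed Hessian. *)
have -> : dot (grad f (x + c *: h) - grad f x - (c *: h) *m S) h =
    dot (grad f (x + c *: h) - grad f x - (c *: h) *m (hessian f x)^T) h.
  rewrite !(dotBl _ _ h); congr (_ - _).
  by rewrite -!scalemxAl !dotZl -qfE qS dot_mulmxC trmxK dotC qfE.
have ch : `|c *: h| <= `|h| by rewrite normrZ gtr0_norm // ler_piMl // ltW.
apply: le_trans (dot_le_norm _ _) _.
have := hd _ (le_lt_trans ch hh).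
set A := `|_ - _ - _| => hA.
have hA' : A <= e / (n%:R + 1) * `|h|.
  by apply: le_trans hA _; rewrite ler_wpM2l // ltW.
rewrite expr2 mulrA ler_wpM2r //.
apply: (@le_trans _ _ (n%:R * (e / (n%:R + 1) * `|h|))); first by rewrite ler_wpM2l.
rewrite mulrA ler_wpM2r // mulrA ler_pdivrMr; last by rewrite ltr_wpDl.
by rewrite mulrC ler_pM2l // lerDl.
Qed.

(* The mixed second difference is symmetric in u and v, whence the symmetry of
   the Hessian. *)
Lemma hessian_bilinear_close x u v e : 0 < e ->
  exists2 d : R, 0 < d & forall s, 0 < s < d ->
   `|f (x + s *: v + s *: u) - f (x + s *: v) - f (x + s *: u) + f x
     - s ^+ 2 * dot (v *m (hessian f x)^T) u| <= e * s ^+ 2.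
Proof.
move=> e0; pose M : R := n%:R * (2 * `|u| + `|v|) * `|u| + 1.
have M0 : 0 < M by rewrite ltr_wpDl // !mulr_ge0 // addr_ge0 // mulr_ge0.
have [d d0 hd] := grad_eps x (divr_gt0 e0 M0).
have N0 : 0 < `|u| + `|v| + 1 by rewrite ltr_wpDl // addr_ge0.
exists (d / (`|u| + `|v| + 1)); first by rewrite divr_gt0.
move=> s /andP[s0]; rewrite ltr_pdivlMr // => sd.
(* The difference in direction [v] is kept as a function and the mean value theorem is applied in
   direction [u], so that only first-order information on the gradient at [x] is needed. *)
pose g := fun y => f (s *: v + y) - f y.
have df := f2.1.
have shft y : is_diff y (fun z => s *: v + z) id.
  have H : is_diff y (cst (s *: v) + id) (0 + id).
    by apply: is_diffD.
  by rewrite add0r in H.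
have dgv y : is_diff y (fun z => f (s *: v + z)) (dot (grad f (s *: v + y))).
  have h1 := differentiableP (df (s *: v + y)).
  have h2 : is_diff y (f \o (fun z => s *: v + z)) ('d f (s *: v + y) \o id).
    by apply: is_diff_comp.
  apply: is_diff_eq; apply/funext => z; rewrite /= diff_grad //.
have dgE y : is_diff y g (dot (grad f (s *: v + y) - grad f y)).
  have h1 : is_diff y f (dot (grad f y)).
    by apply: DiffDef; [exact: df | apply/funext => z; rewrite diff_grad].
  have h2 : is_diff y ((fun z => f (s *: v + z)) - f)
      (dot (grad f (s *: v + y)) - dot (grad f y)).
    exact: is_diffB.
  rewrite (_ : dot (grad f (s *: v + y) - grad f y) =
     dot (grad f (s *: v + y)) - dot (grad f y)) //.
  by apply/funext => z; rewrite fctE dotBl.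
have dg y : differentiable g y by have := dgE y.
have gg y : grad g y = grad f (s *: v + y) - grad f y by exact: grad_is_diff.
have [c /andP[c0 cs]] := line_MVT x u s0 dg.
rewrite /g gg => E.
have -> : f (x + s *: v + s *: u) - f (x + s *: v) - f (x + s *: u) + f x =
   f (s *: v + (x + s *: u)) - f (x + s *: u) - (f (s *: v + x) - f x).
  rewrite (_ : s *: v + (x + s *: u) = x + s *: v + s *: u); last by rewrite addrCA addrA.
  by rewrite [s *: v + x]addrC; ring.
rewrite E.
have cu : `|c *: u| <= s * `|u| by rewrite normrZ gtr0_norm // ler_wpM2r // ltW.
have sv : `|s *: v| = s * `|v| by rewrite normrZ gtr0_norm.
have ud : `|c *: u| < d.
  by apply: le_lt_trans cu _; apply: le_lt_trans sd; rewrite ler_wpM2l ?ltW //; have := normr_ge0 v; lra.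
have vd : `|s *: v + c *: u| < d.
  apply: le_lt_trans (ler_normD _ _) _; rewrite sv.
  apply: (@le_lt_trans _ _ (s * `|v| + s * `|u|)); first by rewrite lerD2l.
  by apply: le_lt_trans sd; rewrite -mulrDr ler_wpM2l ?ltW //; lra.
have := hd _ vd; have := hd _ ud.
set A := _ - _ - _ => hA; set B := _ - _ - _ => hB.
(* Both gradients are replaced by their linearizations at [x]. The linear parts differ exactly by
   the Hessian applied to [s *: v]; what remains is [B - A], small compared with [s]. *)
have -> : s * dot (grad f (s *: v + (x + c *: u)) - grad f (x + c *: u)) u -
   s ^+ 2 * dot (v *m (hessian f x)^T) u = s * dot (B - A) u.
  have -> : grad f (s *: v + (x + c *: u)) - grad f (x + c *: u) =
    B - A + s *: v *m (hessian f x)^T.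
    rewrite /A /B mulmxDl [s *: v + (x + _)]addrCA.
    rewrite -!scalemxAl; apply/rowP => i; rewrite !mxE; ring.
  by rewrite dotDl -scalemxAl dotZl; ring.
rewrite normrM gtr0_norm //.
have -> : e * s ^+ 2 = s * (e * s) by ring.
rewrite ler_pM2l //; apply: le_trans (dot_le_norm _ _) _.
have BA : `|B - A| <= e / M * (s * (2 * `|u| + `|v|)).
  apply: le_trans (ler_normB _ _) _; apply: le_trans (lerD hB hA) _.
  rewrite -mulrDr ler_wpM2l //; first by rewrite ltW // divr_gt0.
  have := ler_normD (s *: v) (c *: u); rewrite sv; lra.
apply: (@le_trans _ _ (n%:R * (e / M * (s * (2 * `|u| + `|v|))) * `|u|)).
  by rewrite ler_wpM2r // ler_wpM2l.
have -> : n%:R * (e / M * (s * (2 * `|u| + `|v|))) * `|u| = e * s * ((M - 1) / M).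
  by rewrite /M addrK; field; rewrite -/M gt_eqF.
rewrite ler_piMr // ?mulr_ge0 ?ltW // ltr_pdivrMr // mul1r; lra.
Qed.

Lemma hessian_sym x : (hessian f x)^T = hessian f x.
Proof.
have sym u v : dot (v *m (hessian f x)^T) u = dot (u *m (hessian f x)^T) v.
  apply/eqP; rewrite -subr_eq0 -normr_le0.
  apply/ler_addgt0Pr => e e0; rewrite add0r.
  have e2 : 0 < e / 2 by rewrite divr_gt0.
  have [d1 d10 h1] := hessian_bilinear_close x u v e2.
  have [d2 d20 h2] := hessian_bilinear_close x v u e2.
  pose s := Num.min d1 d2 / 2.
  have m0 : 0 < Num.min d1 d2 by rewrite lt_min d10.
  have s0 : 0 < s by rewrite divr_gt0.
  have sm : s < Num.min d1 d2 by rewrite /s ltr_pdivrMr //; lra.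
  move: sm; rewrite lt_min => /andP[sd1 sd2].
  have := h1 s; rewrite s0 sd1 => /(_ isT); rewrite [x + _ + _]addrAC.
  have := h2 s; rewrite s0 sd2 => /(_ isT).
  set a := dot (u *m _) v; set b := dot (v *m _) u.
  set F := f (x + s *: u + s *: v); set G := f (x + _); set H := f (x + s *: v).
  rewrite !ler_norml => /andP[k1 k2] /andP[k3 k4].
  have ss : 0 < s ^+ 2 by rewrite exprn_gt0.
  apply/andP; split; rewrite -(ler_pM2l ss); lra.
apply/matrixP => i j; have := sym ('e_i) ('e_j).
rewrite -!rowE !dot_delta [LHS]mxE [RHS]mxE => h.
by rewrite -h mxE.
Qed.

End second_order.

(** * Algebra of smooth functions *)

Section smooth_algebra.
Context {R : realType} {V : normedModType R}.
Implicit Types (f g : V -> R).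

(** Needed in the product rule, where the derivative of one factor multiplies the other factor
    itself. *)
Lemma Ck_pred k f : Ck k.+1 f -> Ck k f.
Proof.
elim: k f => [|k IH] f [df h] /=; first by move=> x; exact: differentiable_continuous.
by split=> // v; apply: IH; exact: h.
Qed.

Lemma Cinfty_cst (a : R) : Cinfty (cst a : V -> R).
Proof.
move=> k; elim: k a => [|k IH] a /=; first by move=> x; exact: cst_continuous.
split=> [x|v]; first exact: differentiable_cst.
rewrite (_ : 'D_v (cst a) = cst 0) //.
by apply/funext => x; rewrite derive_cst.
Qed.

Lemma Cinfty_lin (l : {linear V -> R}) : continuous l -> Cinfty l.
Proof.
move=> cl [|k] //=; split=> [x|v]; first exact: linear_differentiable.
rewrite (_ : 'D_v l = cst (l v)); first exact: Cinfty_cst.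
apply/funext => x; rewrite deriveE ?diff_lin //; exact: linear_differentiable.
Qed.

Lemma CkD k f g : Ck k f -> Ck k g -> Ck k (f \+ g).
Proof.
elim: k f g => [|k IH] f g; first by move=> cf cg x; apply: continuousD; [exact: cf|exact: cg].
move=> [df hf] [dg hg]; split=> [x|v]; first exact: differentiableD.
rewrite (_ : 'D_v (f \+ g) = 'D_v f \+ 'D_v g).
  by apply: IH; [exact: hf | exact: hg].
by apply/funext => x; rewrite deriveD //; exact: diff_derivable.
Qed.

Lemma CkM k f g : Ck k f -> Ck k g -> Ck k (f \* g).
Proof.
elim: k f g => [|k IH] f g; first by move=> cf cg x; apply: continuousM; [exact: cf|exact: cg].
move=> /[dup] /Ck_pred Cf [df hf] /[dup] /Ck_pred Cg [dg hg].
split=> [x|v]; first exact: differentiableM.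
rewrite (_ : 'D_v (f \* g) = (f \* 'D_v g) \+ (g \* 'D_v f)).
  by apply: CkD; apply: IH => //; [exact: hg | exact: hf].
apply/funext => x; rewrite deriveM //; exact: diff_derivable.
Qed.

Lemma CinftyD f g : Cinfty f -> Cinfty g -> Cinfty (f \+ g).
Proof. by move=> cf cg k; exact: CkD. Qed.

Lemma CinftyM f g : Cinfty f -> Cinfty g -> Cinfty (f \* g).
Proof. by move=> cf cg k; exact: CkM. Qed.

Lemma CinftyX f m : Cinfty f -> Cinfty (fun x => f x ^+ m).
Proof.
move=> cf; elim: m => [|m IH].
  by rewrite (_ : (fun _ => _) = cst 1); [exact: Cinfty_cst | apply/funext => x; rewrite expr0].
rewrite (_ : (fun _ => _) = f \* (fun x => f x ^+ m)); first exact: CinftyM.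
by apply/funext => x; rewrite exprS.
Qed.

Lemma Cinfty_sum m (F : 'I_m -> V -> R) : (forall i, Cinfty (F i)) ->
  Cinfty (fun x => \sum_i F i x).
Proof.
elim: m F => [|m IH] F CF.
  by rewrite (_ : (fun _ => _) = cst 0); [exact: Cinfty_cst | apply/funext => x; rewrite big_ord0].
rewrite (_ : (fun _ => _) = (fun x => \sum_(i < m) F (widen_ord (leqnSn m) i) x) \+ F ord_max).
  by apply: CinftyD => //; exact: IH.
by apply/funext => x; rewrite big_ord_recr.
Qed.

Lemma CinftyZ (a : R) f : Cinfty f -> Cinfty (fun x => a * f x).
Proof. by move=> cf; apply: (@CinftyM (cst a)) => //; exact: Cinfty_cst. Qed.

End smooth_algebra.

(** * Uniqueness for the Hamilton-Jacobi equation *)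

Section heine.
Context {R : realType}.

(** Heine's theorem in the form where only one of the two points has to lie in the ball. *)
Lemma ball_unif_cts n (F : 'rV[R]_n -> R) (r e : R) : continuous F -> 0 < e ->
  exists2 d : R, 0 < d & forall x y, `|x| <= r -> `|x - y| < d -> `|F x - F y| < e.
Proof.
move=> cF e0.
have /compact_near_coveringP H := @ball_compact R n r.
(* The modulus [d] is the parameter of the covering property and tends to 0 from the right. *)
have := H R (0 : R)^'+ (fun d x => forall y, `|x - y| < d -> `|F x - F y| < e) _.
case=> [x _|d d0 hd].
  have e2 : 0 < e / 2 by rewrite divr_gt0.
  have [d d0 hd] := (cts_normP _ _).1 (cF x) _ e2.
  exists ([set y | `|y - x| < d / 2], [set s : R | s < d / 2]) => /=.
    have d2 : 0 < d / 2 by rewrite divr_gt0.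
    have hx : \forall y \near x, `|y - x| < d / 2.
      by apply/near_normP; exists (d / 2).
    by split; [exact: hx | exact: nbhs_right_lt].
  move=> [y s] /= [yx sd] z yz.
  have h1 := hd y; have h2 := hd z.
  have -> : F y - F z = (F y - F x) - (F z - F x) by ring.
  apply: le_lt_trans (ler_normB _ _) _; rewrite (splitr e); apply: ltrD.
    by apply: h1; apply: lt_le_trans yx _; rewrite ler_pdivrMr // ler_pMr // ler1n.
  apply: h2; rewrite -(subrKA y) addrC.
  apply: le_lt_trans (ler_normD _ _) _; rewrite (splitr d) ltrD // distrC.
  exact: lt_trans yz sd.
exists (d / 2); first by rewrite divr_gt0.
move=> x y xr xy; apply: (hd (d / 2)) => //=.
  by rewrite sub0r normrN gtr0_norm ?divr_gt0 // ltr_pdivrMr // ltr_pMr // ltr1n.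
by rewrite divr_gt0.
Qed.

End heine.

Section slab.
Context {R : realType} {n : nat}.
Local Notation V := 'rV[R]_n.
Local Notation RV := (R * 'rV[R]_n)%type.
Variables (T : R).
Hypothesis T0 : 0 < T.
Implicit Types (u : RV -> R).

Definition in_slab (y : RV) := 0 <= y.1 <= T.

(** Values of a solution outside the slab are arbitrary; composing with this projection of the time
    makes it continuous everywhere. *)
Definition clamp (t : R) : R := Num.max 0 (Num.min t T).

Lemma clamp_in t : 0 <= clamp t <= T.
Proof. by rewrite /clamp le_max lexx ge_max (ltW T0) ge_min lexx orbT. Qed.

Lemma clamp_id t : 0 <= t <= T -> clamp t = t.
Proof. by move=> /andP[t0 tT]; rewrite /clamp min_l // max_r. Qed.

Lemma clamp_dist s t : `|clamp s - clamp t| <= `|s - t|.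
Proof.
rewrite /clamp; have [?|?] := leP s T; have [?|?] := leP t T.
- by have [?|?] := leP 0 s; have [?|?] := leP 0 t;
    rewrite ?subrr ?normr0 // !ler_norml; case: ler0P; lra.
- by have [?|?] := leP 0 s; have [?|?] := leP 0 T;
    rewrite ?subrr ?normr0 // !ler_norml; case: ler0P; lra.
- by have [?|?] := leP 0 T; have [?|?] := leP 0 t;
    rewrite ?subrr ?normr0 // !ler_norml; case: ler0P; lra.
- by rewrite subrr normr0.
Qed.

Lemma pair_norm_lt (t : R) (x : V) (d : R) : (`|(t, x)| < d) = (`|t| < d) && (`|x| < d).
Proof. by rewrite prod_normE /= gt_max. Qed.

Lemma clamp_cts u : unif_continuous_slab T u ->
  continuous (fun z : RV => u (clamp z.1, z.2)).
Proof.
move=> uc z; apply/cts_normP => e e0; have [d d0 hd] := uc _ e0.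
exists d => // -[s y] h; apply: hd => //=; [exact: clamp_in|exact: clamp_in|].
move: h; rewrite !pair_norm_lt /= => /andP[h1 ->]; rewrite andbT.
exact: le_lt_trans (clamp_dist _ _) h1.
Qed.

(** The slab is convex: a segment is cut into pieces shorter than the modulus of continuity for
    oscillation 1, and the number of pieces grows linearly with its length. *)
Lemma slab_growth u : unif_continuous_slab T u ->
  exists2 C : R, 0 <= C & forall y z, in_slab y -> in_slab z ->
    `|u y - u z| <= C * (1 + `|y - z|).
Proof.
move=> uc; have [d d0 hd] := uc _ ltr01.
pose d' := d / 2; have d'0 : 0 < d' by rewrite divr_gt0.
have step (m : nat) y z : in_slab y -> in_slab z -> `|y - z| <= m%:R * d' ->
    `|u y - u z| <= m%:R.
  elim: m y => [|m IH] y yT zT yz.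
    move: yz; rewrite mul0r normr_le0 subr_eq0 => /eqP ->.
    by rewrite subrr normr0.
  pose r : R := m.+1%:R^-1; have r0 : 0 < r by rewrite invr_gt0 ltr0n.
  have r1 : r <= 1 by rewrite invf_le1 ?ler1n ?ltr0n.
  have rm : r * m.+1%:R = 1 by rewrite mulVf ?pnatr_eq0.
  have rm' : r * m%:R = 1 - r by move: rm; rewrite -natr1; lra.
  (* The first of the [m.+1] subdivision points; the induction hypothesis covers the rest of the
     segment. *)
  pose w := y + r *: (z - y).
  have yw : `|y - w| <= d'.
    rewrite /w opprD addNKr normrN normrZ gtr0_norm // distrC.
    by rewrite -ler_pdivlMl // invrK.
  have wz : `|w - z| <= m%:R * d'.
    have -> : w - z = (1 - r) *: (y - z).
      by rewrite /w scalerBl scale1r -[z - y]opprB scalerN addrAC.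
    rewrite normrZ ger0_norm ?subr_ge0 // -rm'.
    have -> : m%:R * d' = m%:R * (r * (m.+1%:R * d')).
      by rewrite [r * _]mulrA rm mul1r.
    by rewrite [r * m%:R]mulrC -mulrA ler_wpM2l // ler_wpM2l // ltW.
  have wT : in_slab w.
    move: yT zT; rewrite /in_slab /w /=.
    rewrite -[y.1 + _]/(y.1 + r * (z.1 - y.1)) => /andP[? ?] /andP[? ?].
    by apply/andP; split; nra.
  rewrite -(subrKA (u w)) -natr1 addrC [in leRHS]addrC.
  apply: le_trans (ler_normD _ _) _; rewrite addrC lerD ?IH //.
  apply: ltW; apply: hd => //; apply: le_lt_trans yw _.
  by rewrite /d' ltr_pdivrMr // ltr_pMr // ltr1n.
exists (1 + d'^-1); first by rewrite addr_ge0 // invr_ge0 ltW.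
move=> y z yT zT.
have q0 : 0 <= `|y - z| / d' by rewrite divr_ge0 // ltW.
have /andP[m1 m2] := truncn_itv q0.
apply: le_trans (step (Num.truncn (`|y - z| / d')).+1 y z yT zT _) _.
  by rewrite -ler_pdivrMr // ltW.
rewrite -natr1; have := normr_ge0 (y - z).
have : 0 < d'^-1 by rewrite invr_gt0.
by move: m1; nra.
Qed.

End slab.

Section doubling_test.
Context {R : realType} {n : nat}.
Local Notation V := 'rV[R]_n.
Local Notation RV := (R * 'rV[R]_n)%type.

Lemma Cinfty_linear (W : normedModType R) (f : W -> R) :
  linear f -> continuous f -> Cinfty f.
Proof.
move=> lf cf; pose M := GRing.isLinear.Build _ _ _ _ _ lf.
pose l : {linear W -> R} := HB.pack f M.
by have := @Cinfty_lin _ _ l cf.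
Qed.

Lemma Cinfty_fst : Cinfty (fun z : RV => z.1).
Proof.
apply: Cinfty_linear; first by move=> a [x1 x2] [y1 y2].
by move=> z; exact: cvg_fst.
Qed.

Lemma Cinfty_coord (i : 'I_n) : Cinfty (fun z : RV => z.2 0 i).
Proof.
apply: Cinfty_linear; first by move=> a [x1 x2] [y1 y2]; rewrite /= !mxE.
move=> z; apply: (@continuous_comp _ _ _ (fun z : RV => z.2) (fun x : V => x 0 i)).
  exact: cvg_snd.
exact: coord_continuous.
Qed.

Lemma Cinfty_dist (y : V) : Cinfty (fun z : RV => dot (z.2 - y) (z.2 - y)).
Proof.
rewrite (_ : (fun _ => _) = (fun z : RV => \sum_i (z.2 0 i + - y 0 i) ^+ 2)).
  apply: Cinfty_sum => i; apply: CinftyX; apply: CinftyD (Cinfty_coord i) _.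
  exact: Cinfty_cst.
by apply/funext => z; rewrite dotE; apply: eq_bigr => i _; rewrite !mxE expr2.
Qed.

Variables (a b l k s0 : R) (N : nat) (y0 : V).

(** The penalty of [penalized] below as a function of one point, the other being frozen at
    [(s0, y0)], up to an additive constant. It is polynomial, hence smooth. *)
Definition doubling (z : RV) : R :=
  a * ((z.1 - s0) ^+ 2 + dot (z.2 - y0) (z.2 - y0)) + b * dot z.2 z.2 +
  (l * z.1 + k * z.1 ^+ N.+1).

Lemma Cinfty_doubling : Cinfty doubling.
Proof.
apply: CinftyD; [apply: CinftyD | apply: CinftyD].
- apply: CinftyZ; apply: CinftyD; last exact: Cinfty_dist.
  by apply: CinftyX; apply: CinftyD Cinfty_fst _; exact: Cinfty_cst.
- rewrite (_ : (fun _ => _) = (fun z : RV => b * dot (z.2 - 0) (z.2 - 0))).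
    by apply: CinftyZ; exact: Cinfty_dist.
  by apply/funext => z; rewrite subr0.
- exact: CinftyZ Cinfty_fst.
- by apply: CinftyZ; apply: CinftyX; exact: Cinfty_fst.
Qed.

Lemma doubling_dt t x :
  derive1 (fun t => doubling (t, x)) t =
  2 * a * (t - s0) + l + k * N.+1%:R * t ^+ N.
Proof.
pose p : {poly R} := a%:P * ((('X - s0%:P) ^+ 2 + (dot (x - y0) (x - y0))%:P)) +
  b%:P * (dot x x)%:P + (l%:P * 'X + k%:P * 'X ^+ N.+1).
have -> : (fun t => doubling (t, x)) = horner p.
  by apply/funext => r; rewrite /p /doubling !hornerE.
rewrite -derivE /p !poly.derivE !hornerE hornerMn hornerXn -[t ^+ N *+ _]mulr_natr /=; ring.
Qed.

Lemma doubling_dx t x :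
  grad (fun x => doubling (t, x)) x = (2 * a) *: (x - y0) + (2 * b) *: x.
Proof.
have sym (c : R) : (c%:M : 'M[R]_n)^T = c%:M by rewrite tr_scalar_mx.
pose f1 := quad y0 (a * (t - s0) ^+ 2 + l * t + k * t ^+ N.+1) 0 ((2 * a)%:M : 'M[R]_n).
pose f2 := quad (0 : V) 0 0 ((2 * b)%:M : 'M[R]_n).
have -> : (fun x => doubling (t, x)) = f1 + f2.
  apply/funext => z; rewrite fctE /f1 /f2 /quad /doubling /= !qfsc !dot0l subr0.
  by field.
apply: grad_is_diff.
have d1 := quad_is_diff y0 (a * (t - s0) ^+ 2 + l * t + k * t ^+ N.+1) 0 x (sym (2 * a)).
have d2 := quad_is_diff 0 0 0 x (sym (2 * b)).
have d12 := is_diffD d1 d2.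
rewrite (_ : dot (_ + _) = dot (0 + (x - y0) *m (2 * a)%:M) + dot (0 + (x - 0) *m (2 * b)%:M)) //.
apply/funext => z; rewrite fctE -dotDl !add0r subr0 !mul_mx_scalar //.
Qed.

Lemma doubling_neg_dt t x :
  derive1 (fun t => - doubling (t, x)) t =
  - (2 * a * (t - s0) + l + k * N.+1%:R * t ^+ N).
Proof.
rewrite -(doubling_dt t x) !derive1E.
have dd z : differentiable doubling z by have [] := Cinfty_doubling 1%N.
have d1 : differentiable (fun t => doubling (t, x)) t.
  have dp : differentiable (fun t : R => (t, x)) t.
    by apply: differentiable_pair; [exact: ex_diff | exact: differentiable_cst].
  exact: differentiable_comp dp (dd _).
rewrite (_ : (fun t => - doubling (t, x)) = - (fun t => doubling (t, x))) //.
by apply: deriveN; exact: diff_derivable.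
Qed.

Lemma doubling_neg_dx t x :
  grad (fun x => - doubling (t, x)) x = - ((2 * a) *: (x - y0) + (2 * b) *: x).
Proof.
rewrite -(doubling_dx t x).
have dd z : differentiable doubling z by have [] := Cinfty_doubling 1%N.
have d1 : differentiable (fun x => doubling (t, x)) x.
  have dp : differentiable (fun x : V => (t, x)) x.
    by apply: differentiable_pair; [exact: differentiable_cst | exact: ex_diff].
  exact: differentiable_comp dp (dd _).
apply/rowP => i; rewrite !mxE.
rewrite (_ : (fun x => - doubling (t, x)) = - (fun x => doubling (t, x))) //.
by rewrite deriveN //; exact: diff_derivable.
Qed.

End doubling_test.

(** * Comparison by doubling of variables *)

Section comparison.
Context {R : realType} {n : nat}.
Local Notation V := 'rV[R]_n.
Local Notation RV := (R * 'rV[R]_n)%type.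
Variables (T : R) (F : V -> R) (u v : RV -> R).
Hypothesis T0 : 0 < T.
Implicit Types (t s r : R) (x y z : V).

Section penalization.
Variables (a b l k : R) (N : nat).

(** The term in [a] couples the two points, [b] confines them in space, [l] makes the final
    inequality strict, and [k] is a barrier at the final time. *)
Definition penalized (p : RV * RV) : R :=
  u (clamp T p.1.1, p.1.2) - v (clamp T p.2.1, p.2.2) -
  (a * ((p.1.1 - p.2.1) ^+ 2 + dot (p.1.2 - p.2.2) (p.1.2 - p.2.2)) +
   b * (dot p.1.2 p.1.2 + dot p.2.2 p.2.2) +
   (l * (p.1.1 + p.2.1) + k * (p.1.1 ^+ N.+1 + p.2.1 ^+ N.+1))).

Lemma penalized_cts : unif_continuous_slab T u -> unif_continuous_slab T v ->
  continuous penalized.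
Proof.
move=> uu uv.
have c1 : continuous (fun p : RV * RV => p.1) by move=> p; exact: cvg_fst.
have c2 : continuous (fun p : RV * RV => p.2) by move=> p; exact: cvg_snd.
have c11 : continuous (fun p : RV * RV => p.1.1).
  by move=> p; apply: (@continuous_comp _ _ _ (fun p : RV * RV => p.1) fst); [exact: c1|exact: cvg_fst].
have c12 : continuous (fun p : RV * RV => p.1.2).
  by move=> p; apply: (@continuous_comp _ _ _ (fun p : RV * RV => p.1) snd); [exact: c1|exact: cvg_snd].
have c21 : continuous (fun p : RV * RV => p.2.1).
  by move=> p; apply: (@continuous_comp _ _ _ (fun p : RV * RV => p.2) fst); [exact: c2|exact: cvg_fst].
have c22 : continuous (fun p : RV * RV => p.2.2).
  by move=> p; apply: (@continuous_comp _ _ _ (fun p : RV * RV => p.2) snd); [exact: c2|exact: cvg_snd].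
have cdot (g : RV * RV -> V) : continuous g -> continuous (fun p => dot (g p) (g p)).
  move=> cg p; rewrite (_ : (fun p => _) = qf 1%:M \o g); last first.
    by apply/funext => q; rewrite /= qf1.
  by apply: continuous_comp; [exact: cg | exact: qf_cts].
have cX (g : RV * RV -> R) m : continuous g -> continuous (fun p => g p ^+ m).
  move=> cg p; rewrite (_ : (fun p => _) = (fun c : R => c ^+ m) \o g) //.
  by apply: continuous_comp; [exact: cg | exact: exprn_continuous].
have cu : continuous (fun p : RV * RV => u (clamp T p.1.1, p.1.2)).
  move=> p; apply: (@continuous_comp _ _ _ (fun p : RV * RV => p.1) (fun z : RV => u (clamp T z.1, z.2))).
    exact: c1.
  exact: clamp_cts.
have cv : continuous (fun p : RV * RV => v (clamp T p.2.1, p.2.2)).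
  move=> p; apply: (@continuous_comp _ _ _ (fun p : RV * RV => p.2) (fun z : RV => v (clamp T z.1, z.2))).
    exact: c2.
  exact: clamp_cts.
have cD (f g : RV * RV -> R) : continuous f -> continuous g ->
    continuous (fun p => f p + g p).
  by move=> cf cg p; apply: continuousD; [exact: cf | exact: cg].
have cB (W : normedModType R) (f g : RV * RV -> W) : continuous f -> continuous g ->
    continuous (fun p => f p - g p).
  by move=> cf cg p; apply: continuousB; [exact: cf | exact: cg].
have cZ (c : R) (f : RV * RV -> R) : continuous f -> continuous (fun p => c * f p).
  by move=> cf p; apply: continuousM; [exact: cst_continuous | exact: cf].
rewrite /penalized; apply: (cB); first exact: (cB).
apply: (cD); [apply: (cD) | apply: (cD)]; apply: (cZ); apply: (cD) => //.
- by apply: cX; exact: cB.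
- by apply: cdot; exact: cB.
- exact: (cdot (fun p => p.1.2)).
- exact: (cdot (fun p => p.2.2)).
- exact: (cX (fun p => p.1.1)).
- exact: (cX (fun p => p.2.1)).
Qed.

Hypotheses (a1 : 1 <= a) (b0 : 0 < b) (l0 : 0 <= l) (k0 : 0 <= k).
Variables (M C : R).
Hypothesis growth : forall t x s y, 0 <= t <= T -> 0 <= s <= T ->
  u (t, x) - v (s, y) <= M + C * `|x - y|.

(** Half of the spatial coupling absorbs the linear growth [C * |x - y|] at the price of [C ^+ 2],
    since [a >= 1]. The surviving terms are thereby bounded wherever [penalized] is positive. *)
Lemma penalized_le t x s y : 0 <= t <= T -> 0 <= s <= T ->
  penalized ((t, x), (s, y)) <= M + C ^+ 2 - (a / 2 * `|x - y| ^+ 2 +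
    a * (t - s) ^+ 2 + b * (dot x x + dot y y) + k * t ^+ N.+1 + k * s ^+ N.+1).
Proof.
have a0 : 0 <= a by apply: le_trans a1.
move=> tT sT; rewrite /penalized /= !clamp_id //.
have := growth x y tT sT; have := norm_sq_le_dot (x - y).
have [/andP[t0 _] /andP[s0 _]] := (tT, sT).
have lts : 0 <= l * (t + s) by rewrite mulr_ge0 // addr_ge0.
move: (`|x - y|) (dot (x - y) (x - y)) => m D mD.
have : C * m <= C ^+ 2 + a / 2 * m ^+ 2.
  have : 0 <= (2 * C - m) ^+ 2 by rewrite sqr_ge0.
  have : 0 <= (a - 1) * m ^+ 2 by rewrite mulr_ge0 ?sqr_ge0 // subr_ge0.
  have := sqr_ge0 C; rewrite !expr2; nra.
have : a * m ^+ 2 <= a * D.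
  by rewrite ler_wpM2l.
move: (t ^+ N.+1) (s ^+ N.+1) (u _) (v _) (dot x x) (dot y y) => *; lra.
Qed.

Lemma penalized_max p0 : unif_continuous_slab T u -> unif_continuous_slab T v ->
  in_slab T p0.1 -> in_slab T p0.2 -> 0 < penalized p0 ->
  exists p, [/\ in_slab T p.1, in_slab T p.2, penalized p0 <= penalized p &
    forall q, in_slab T q.1 -> in_slab T q.2 -> penalized q <= penalized p].
Proof.
move=> uu uv p01 p02 p0gt; have a1' := a1.
(* Positivity forces [dot x x] below [(M + C ^+ 2) / b]; adding 1 bounds [|x|] without a square
   root. *)
pose r := (M + C ^+ 2) / b + 1.
pose K := `[0, T]%classic `*` [set x : V | `|x| <= r].
have cK : compact (K `*` K).
  by do 2 apply: compact_setX; exact: segment_compact || exact: ball_compact.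
have big t x s y : 0 <= t <= T -> 0 <= s <= T ->
    0 < penalized ((t, x), (s, y)) -> `|x| <= r /\ `|y| <= r.
  move=> tT sT; have := penalized_le x y tT sT.
  have [/andP[t0 _] /andP[s0 _]] := (tT, sT).
  have kt : 0 <= k * t ^+ N.+1 by rewrite mulr_ge0 // exprn_ge0.
  have ks : 0 <= k * s ^+ N.+1 by rewrite mulr_ge0 // exprn_ge0.
  have a2 : 0 <= a / 2 * `|x - y| ^+ 2 by rewrite mulr_ge0 ?sqr_ge0 // divr_ge0 //; lra.
  have a3 : 0 <= a * (t - s) ^+ 2 by rewrite mulr_ge0 ?sqr_ge0 //; lra.
  move=> h1 h2.
  have h3 : b * (dot x x + dot y y) < M + C ^+ 2 by lra.
  have h4 : dot x x + dot y y < (M + C ^+ 2) / b by rewrite ltr_pdivlMr // mulrC.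
  have := norm_sq_le_dot x; have := norm_sq_le_dot y.
  have := dot_ge0 x; have := dot_ge0 y.
  by rewrite /r; split; rewrite !expr2 in h4 *; nra.
have inK p : in_slab T p.1 -> in_slab T p.2 -> 0 < penalized p -> (K `*` K) p.
  case: p => -[t x] [s y] /= pt ps /(big _ _ _ _ pt ps)[xr yr].
  by rewrite /K /=; split; split => //=; rewrite in_itv.
have [||p pK hp] := @compact_EVT_max _ R penalized (K `*` K) _ cK.
- by exists p0; exact: inK.
- by apply: continuous_subspaceT; exact: penalized_cts.
have pp0 : penalized p0 <= penalized p by apply: hp; rewrite inE; exact: inK.
move: pK; rewrite inE => -[[/= p1 _] [/= p2 _]].
rewrite !in_itv /= in p1 p2.
exists p; split => //.
move=> q q1 q2; have [q0|q0] := ltP 0 (penalized q).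
  by apply: hp; rewrite inE; exact: inK.
by apply: le_trans q0 _; rewrite ltW // (lt_le_trans p0gt).
Qed.

Hypotheses (solu : hj_solution F T u) (solv : hj_solution F T v).

(** Freezing either point turns the maximum into a test of one solution. In the difference of the
    two inequalities the time derivatives of the coupling cancel, the [l] terms add up, and the
    barrier terms have a favourable sign. *)
Lemma penalized_residual t x s y : 0 < t < T -> 0 < s < T ->
  (forall q, in_slab T q.1 -> in_slab T q.2 ->
     penalized q <= penalized ((t, x), (s, y))) ->
  2 * l <= F ((2 * a) *: (x - y) - (2 * b) *: y) -
           F ((2 * a) *: (x - y) + (2 * b) *: x).
Proof.
move=> tT sT hmax.
have ltW2 r : 0 < r < T -> 0 <= r <= T by move=> /andP[/ltW -> /ltW ->].
have near_in (r : R) (z : V) : 0 < r < T -> \forall q \near (r, z), 0 < q.1 < T.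
  move=> /andP[r0 rT]; apply/near_normP.
  exists (Num.min r (T - r)); first by rewrite lt_min r0 subr_gt0.
  move=> [r' z'] /=; rewrite pair_norm_lt => /andP[+ _].
  rewrite lt_min !ltr_norml => /andP[/andP[h1 _] /andP[_ h2]].
  by rewrite -(ltrD2r (- r) 0) sub0r h1 -(ltrD2r (- r) r').
have h1 : local_max (fun z : RV => u z - doubling a b l k s N y z) (t, x).
  have := near_in t x tT; apply: filterS => -[r z] /= /ltW2 rT.
  have := hmax ((r, z), (s, y)) rT (ltW2 _ sT).
  by rewrite /penalized /doubling /= !clamp_id ?(ltW2 _ sT) ?(ltW2 _ tT) //; lra.
have h2 : local_min (fun z : RV => v z - (- doubling a b l k t N x z)) (s, y).
  have := near_in s y sT; apply: filterS => -[r z] /= /ltW2 rT.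
  have := hmax ((t, x), (r, z)) (ltW2 _ tT) rT.
  rewrite /penalized /doubling /= !clamp_id ?(ltW2 _ sT) ?(ltW2 _ tT) //.
  rewrite -[z - x]opprB -[y - x]opprB !dotNl !dotNr !opprK.
  rewrite -[r - t]opprB -[s - t]opprB !sqrrN; lra.
have [r1 _] := solu.2 _ (Cinfty_doubling a b l k s N y) t x tT.
have CN : Cinfty (fun z : RV => - doubling a b l k t N x z).
  rewrite (_ : (fun z : RV => _) = (fun z : RV => -1 * doubling a b l k t N x z)).
    by apply: CinftyZ; exact: Cinfty_doubling.
  by apply/funext => z; rewrite mulN1r.
have [_ r2] := solv.2 _ CN s y sT.
have := r1 h1; have := r2 h2.
rewrite doubling_dt doubling_dx doubling_neg_dt doubling_neg_dx.
have -> : - ((2 * a) *: (y - x) + (2 * b) *: y) =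
  (2 * a) *: (x - y) - (2 * b) *: y by rewrite opprD -scalerN opprB.
have tN : 0 <= k * N.+1%:R * t ^+ N.
  by rewrite mulr_ge0 ?exprn_ge0 ?mulr_ge0 //; case/andP: tT => /ltW.
have sN : 0 <= k * N.+1%:R * s ^+ N.
  by rewrite mulr_ge0 ?exprn_ge0 ?mulr_ge0 //; case/andP: sT => /ltW.
lra.
Qed.

End penalization.

Hypotheses (cF : continuous F).
Hypotheses (solu : hj_solution F T u) (solv : hj_solution F T v).
Hypothesis uv0 : forall y, u (0, y) = v (0, y).

(** Pass through time 0, where the two functions agree; the times contribute at most a constant. *)
Lemma slab_difference_growth : exists M C : R, 0 <= C /\
  forall t x s y, 0 <= t <= T -> 0 <= s <= T ->
  u (t, x) - v (s, y) <= M + C * `|x - y|.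
Proof.
have [Cu Cu0 hu] := slab_growth solu.1.
have [Cv Cv0 hv] := slab_growth solv.1.
exists (Cu * (1 + T) + (Cu + Cv * (1 + T))), Cu; split => // t x s y tT sT.
have z0 : 0 <= (0 : R) <= T by rewrite lexx ltW.
have h1 := hu (t, x) (0, x) tT z0; have h2 := hu (0, x) (0, y) z0 z0.
have h3 := hv (0, y) (s, y) z0 sT.
have norm0 (r : R) (z : V) : 0 <= r <= T -> `|(r, z) - (0, z)| <= T.
  move=> /andP[r0 rT]; rewrite prod_normE /= subr0 subrr normr0 ge_max ger0_norm //.
  by rewrite rT ltW.
have n1 := norm0 t x tT; have n3 := norm0 s y sT.
rewrite distrC in n3.
have n2 : `|((0 : R), x) - (0, y)| = `|x - y|.
  by rewrite prod_normE /= subrr normr0 max_r.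
rewrite n2 in h2.
have {}h1 : `|u (t, x) - u (0, x)| <= Cu * (1 + T).
  by apply: le_trans h1 _; rewrite ler_wpM2l // lerD2l.
have {}h3 : `|v (0, y) - v (s, y)| <= Cv * (1 + T).
  by apply: le_trans h3 _; rewrite ler_wpM2l // lerD2l.
move: h1 h2 h3; rewrite !ler_norml uv0 (uv0 y) => /andP[_ ?] /andP[_ ?] /andP[_ ?].
lra.
Qed.

(* Powers of t/T keep the maximum of the doubled function away from the final
   time and are small at any prescribed earlier time. *)
Lemma exists_small_power (r K : R) : 0 <= r < 1 -> 0 < K -> exists N, K * r ^+ N.+1 <= 1.
Proof.
move=> /andP[r0 r1] K0.
have /cvg_expr/cvgrPdist_le/(_ K^-1) : `|r| < 1 by rewrite ger0_norm.
rewrite invr_gt0 => /(_ K0)[N _ hN]; exists N.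
have := hN N.+1 (leqnSn N); rewrite sub0r normrN ger0_norm ?exprn_ge0 //.
by rewrite -(ler_pM2l K0) divff // gt_eqF.
Qed.

(** The equation is tested only at interior times: the barrier keeps a maximum away from [T], and
    the agreement of [u] and [v] at time 0 keeps it away from 0. As [F] depends on the slope only,
    the coupling [a] is fixed once. It bounds the slopes, then uniform continuity of [F] on that
    range gives [eta], and [b] is chosen last so that the two slopes differ by less than [F] can
    notice. *)
Lemma hj_comparison x : u (T, x) <= v (T, x).
Proof.
have T0' := T0; rewrite leNgt; apply/negP => uvT.
(* Moving from [T] to [t1] costs at most [2 * s] and the penalties at [(t1, x)] at most [3 * s]; a
   twelfth leaves a value well above [s]. *)
pose s := (u (T, x) - v (T, x)) / 12.
have s0 : 0 < s by rewrite divr_gt0 // subr_gt0.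
have [du du0 hu] := solu.1 _ s0; have [dv dv0 hv] := solv.1 _ s0.
pose d := Num.min T (Num.min du dv).
have d0 : 0 < d by rewrite !lt_min T0 du0.
have dle : [/\ d <= T, d <= du & d <= dv] by rewrite /d !ge_min !lexx !orbT.
case: dle => dT ddu ddv.
pose t1 := T - d / 2.
have t1T : 0 < t1 < T by rewrite /t1; apply/andP; split; lra.
have t1T' : 0 <= t1 <= T by case/andP: t1T => /ltW -> /ltW ->.
have TT : 0 <= T <= T by rewrite lexx ltW.
have close (w : RV -> R) e : d <= e -> (forall y z : RV, 0 <= y.1 <= T -> 0 <= z.1 <= T ->
    `|y - z| < e -> `|w y - w z| < s) -> `|w (T, x) - w (t1, x)| < s.
  move=> de; apply => //=; apply: lt_le_trans de.
  rewrite pair_norm_lt /= subrr normr0 d0 andbT /t1 opprB addrC subrK.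
  by rewrite gtr0_norm; lra.
have gap1 : 10 * s < u (t1, x) - v (t1, x).
  have := close u du ddu hu; have := close v dv ddv hv.
  rewrite !ltr_norml => /andP[? ?] /andP[? ?].
  have : 12 * s = u (T, x) - v (T, x) by rewrite /s; field.
  by lra.
have [M [C [C0 growth]]] := slab_difference_growth.
pose M1 : R := `|M| + C ^+ 2 + 1.
have M10 : 0 < M1 by rewrite ltr_wpDl // addr_ge0 // sqr_ge0.
have MM1 : M + C ^+ 2 < M1 by rewrite /M1; have := ler_norm M; lra.
have [N hN] : exists N, (2 * M1 / s) * (t1 / T) ^+ N.+1 <= 1.
  apply: exists_small_power; last by rewrite divr_gt0 // mulr_gt0.
  case/andP: t1T => t10 t1T; rewrite divr_ge0 ?ltW //=.
  by rewrite ltr_pdivrMr // mul1r.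
(* The barrier reaches [M1] at time [T], which no penalty term can do where [penalized] is
   positive. *)
pose k := M1 / T ^+ N.+1.
have TN : 0 < T ^+ N.+1 by rewrite exprn_gt0.
have k0 : 0 < k by rewrite divr_gt0.
have kT : k * T ^+ N.+1 = M1 by rewrite divfK // gt_eqF.
have kt1 : 2 * (k * t1 ^+ N.+1) <= s.
  move: hN; rewrite expr_div_n => hN.
  have -> : 2 * (k * t1 ^+ N.+1) = s * (2 * M1 / s * (t1 ^+ N.+1 / T ^+ N.+1)).
    by rewrite /k; field; rewrite !gt_eqF.
  by rewrite -[leRHS]mulr1 ler_pM2l.
pose l := s / (2 * T).
have l0 : 0 < l by rewrite divr_gt0 // mulr_gt0.
have lt1 : l * (t1 + t1) <= s.
  have -> : s = l * (T + T) by rewrite /l; field; rewrite gt_eqF.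
  by rewrite ler_pM2l //; lra.
(* Strong enough to bring the two points of the maximum within [d] of each other, in time and in
   space. *)
pose a := 1 + 2 * M1 / d ^+ 2.
have dd : 0 < d ^+ 2 by rewrite exprn_gt0.
have a1 : 1 <= a by rewrite /a lerDl divr_ge0 ?ltW // mulr_gt0.
have a0 : 0 < a by exact: lt_le_trans ltr01 a1.
have ad : 2 * M1 <= a * d ^+ 2 by rewrite /a [leRHS]mulrDl divfK ?gt_eqF // lerDr mul1r ltW.
(* Bounds the slope coming from the coupling, with room 1 for the perturbation by [b]. *)
pose P := 2 * a * d + 1.
have [w w0 hw] := @ball_unif_cts R n F P l cF l0.
pose eta := Num.min 1 (w / 2).
have eta0 : 0 < eta by rewrite lt_min ltr01 divr_gt0.
(* The first bound limits the cost at [(t1, x)] to [s]. The second makes [(2 * b) *: q] smaller than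
   [eta] whenever [b * dot q q < M1]. *)
pose b := Num.min (s / (2 * (dot x x + 1))) (eta ^+ 2 / (8 * M1)).
have xx1 : 0 < dot x x + 1 by rewrite ltr_wpDl // dot_ge0.
have b0 : 0 < b.
  rewrite lt_min; apply/andP; split; first by rewrite divr_gt0 // mulr_gt0.
  by rewrite divr_gt0 ?exprn_gt0 // mulr_gt0.
have bs : b * (dot x x + dot x x) <= s.
  have : b <= s / (2 * (dot x x + 1)) by rewrite /b ge_min lexx.
  rewrite ler_pdivlMr; last by rewrite mulr_gt0.
  by have := dot_ge0 x; nra.
have be : b * (8 * M1) <= eta ^+ 2.
  by rewrite -ler_pdivlMr ?mulr_gt0 // /b ge_min lexx orbT.
have [eta1 etaw] : eta <= 1 /\ eta <= w / 2 by rewrite /eta !ge_min !lexx orbT.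
clearbody s d t1 M1 k l a eta b.
pose Phi := penalized a b l k N.
have Phi0 : s < Phi ((t1, x), (t1, x)).
  rewrite /Phi /penalized /= !clamp_id // !subrr dot0l expr2 mul0r addr0 mulr0 add0r.
  by rewrite mulrDr -mulr2n -mulr_natl; lra.
have Phi0' : 0 < Phi ((t1, x), (t1, x)) by exact: lt_trans Phi0.
have [[[t y] [r z]] [/= tT rT ge_max max]] :=
  penalized_max (p0 := ((t1, x), (t1, x))) a1 b0 (ltW l0) (ltW k0) growth solu.1 solv.1 t1T' t1T' Phi0'.
have sPhi : s < Phi ((t, y), (r, z)) by exact: lt_le_trans ge_max.
have := penalized_le b k N a1 (ltW l0) growth y z tT rT.
have [/andP[t_ge0 t_leT] /andP[r_ge0 r_leT]] := (tT, rT).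
rewrite -/Phi [b * (_ + _)]mulrDr => le_Phi.
have e1 : 0 <= k * t ^+ N.+1 by rewrite mulr_ge0 ?exprn_ge0 // ltW.
have e2 : 0 <= k * r ^+ N.+1 by rewrite mulr_ge0 ?exprn_ge0 // ltW.
have e3 : 0 <= a / 2 * `|y - z| ^+ 2 by rewrite mulr_ge0 ?sqr_ge0 // divr_ge0 // ltW.
have e4 : 0 <= a * (t - r) ^+ 2 by rewrite mulr_ge0 ?sqr_ge0 // ltW.
have e5 : 0 <= b * dot y y by rewrite mulr_ge0 ?dot_ge0 // ltW.
have e6 : 0 <= b * dot z z by rewrite mulr_ge0 ?dot_ge0 // ltW.
have [f1 f2 f3 f4 [f5 f6]] : [/\ k * t ^+ N.+1 < M1, k * r ^+ N.+1 < M1,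
    a / 2 * `|y - z| ^+ 2 < M1, a * (t - r) ^+ 2 < M1 &
    b * dot y y < M1 /\ b * dot z z < M1].
  have Ps : 0 < Phi ((t, y), (r, z)) by exact: lt_trans sPhi.
  move: le_Phi Ps e1 e2 e3 e4 e5 e6 MM1.
  move: (Phi _) (k * t ^+ _) (k * r ^+ _) (a / 2 * _) (a * (t - r) ^+ 2)
    (b * dot y y) (b * dot z z) (M + C ^+ 2); clear -T0 cF solu solv uv0.
  by move=> *; split; [lra..|split; lra].
have sqr_lt (m m' : R) : 0 <= m' -> m ^+ 2 < m' ^+ 2 -> `|m| < m'.
  move=> m'0; rewrite -[m ^+ 2]real_normK ?num_real // => h.
  by rewrite -(@ltr_pXn2r _ 2) // nnegrE.
have yz : `|y - z| < d.
  rewrite -[X in X < _]normr_id; apply: sqr_lt; first exact: ltW.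
  by rewrite -(ltr_pM2l a0); move: f3 ad; clear -T0 cF solu solv uv0; lra.
have tr : `|t - r| < d.
  apply: sqr_lt; first exact: ltW.
  by rewrite -(ltr_pM2l a0); move: f4 ad M10; clear -T0 cF solu solv uv0; lra.
have tltT : t < T.
  rewrite lt_neqAle t_leT andbT; apply/eqP => tE.
  by move: f1; rewrite tE kT ltxx.
have rltT : r < T.
  rewrite lt_neqAle r_leT andbT; apply/eqP => rE.
  by move: f2; rewrite rE kT ltxx.
have le_uv : Phi ((t, y), (r, z)) <= u (t, y) - v (r, z).
  rewrite /Phi /penalized /= !clamp_id // gerBl.
  apply: addr_ge0; [apply: addr_ge0 | apply: addr_ge0]; apply: mulr_ge0;
    by rewrite ?(ltW a0) ?(ltW b0) ?(ltW l0) ?(ltW k0) ?addr_ge0 ?sqr_ge0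
      ?dot_ge0 ?exprn_ge0.
(* At [t = 0] the value [u (0, y)] is [v (0, y)], within [s] of [v (r, z)], so the maximum would not
   exceed [s]. *)
have tgt0 : 0 < t.
  rewrite lt_neqAle t_ge0 andbT; apply/eqP => tE.
  have : `|v (0, y) - v (r, z)| < s.
    apply: hv => //=; first by rewrite lexx ltW.
    apply: lt_le_trans ddv; rewrite pair_norm_lt /= yz andbT.
    by move: tr; rewrite -tE.
  rewrite ltr_norml -uv0 => /andP[_ h]; move: le_uv; rewrite -tE => h'.
  by move: h h' sPhi; rewrite -tE; clear -T0 cF solu solv uv0; lra.
have rgt0 : 0 < r.
  rewrite lt_neqAle r_ge0 andbT; apply/eqP => rE.
  have : `|u (t, y) - u (0, z)| < s.
    apply: hu => //=; first by rewrite lexx ltW.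
    apply: lt_le_trans ddu; rewrite pair_norm_lt /= yz andbT.
    by move: tr; rewrite -rE.
  rewrite ltr_norml uv0 => /andP[_ h]; move: le_uv; rewrite -rE => h'.
  by move: h h' sPhi; rewrite -rE; clear -T0 cF solu solv uv0; lra.
have res : 2 * l <= F ((2 * a) *: (y - z) - (2 * b) *: z) -
           F ((2 * a) *: (y - z) + (2 * b) *: y).
  have [tT' rT'] : 0 < t < T /\ 0 < r < T by rewrite tgt0 rgt0.
  exact: (penalized_residual (ltW k0) solu solv tT' rT' max).
have small (q : V) : b * dot q q < M1 -> `|(2 * b) *: q| < eta.
  move=> bq; rewrite -[X in X < _]normr_id; apply: sqr_lt; first exact: ltW.
  rewrite normrZ exprMn gtr0_norm ?mulr_gt0 //.
  have := norm_sq_le_dot q => hq.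
  have : b * `|q| ^+ 2 < M1 by apply: le_lt_trans bq; rewrite ler_pM2l.
  move=> h; rewrite -(ltr_pM2l b0) in h.
  have -> : (2 * b) ^+ 2 * `|q| ^+ 2 = 4 * (b * (b * `|q| ^+ 2)) by ring.
  by move: h be (mulr_gt0 b0 M10); clear -T0 cF solu solv uv0; lra.
have sy := small _ f5; have sz := small _ f6.
have pP : `|(2 * a) *: (y - z)| <= 2 * a * d.
  rewrite normrZ gtr0_norm ?mulr_gt0 // ler_wpM2l ?mulr_ge0 // ltW //.
have : `|F ((2 * a) *: (y - z) - (2 * b) *: z) -
           F ((2 * a) *: (y - z) + (2 * b) *: y)| < l.
  apply: hw.
    apply: le_trans (ler_normB _ _) _; by move: pP sz eta1; rewrite /P; clear -T0 cF solu solv uv0; lra.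
  rewrite opprD addrACA subrr add0r -opprD normrN.
  by apply: le_lt_trans (ler_normD _ _) _; move: sy sz etaw; clear -T0 cF solu solv uv0; lra.
by rewrite ltr_norml => /andP[_]; move: res l0; clear -T0 cF solu solv uv0; lra.
Qed.

End comparison.

Lemma hj_unique (R : realType) n (T : R) (F : 'rV[R]_n -> R) u v :
  0 < T -> continuous F -> hj_solution F T u -> hj_solution F T v ->
  (forall y, u (0, y) = v (0, y)) -> forall x, u (T, x) = v (T, x).
Proof.
move=> T0 cF su sv uv0 x; apply/eqP; rewrite eq_le.
by rewrite !(@hj_comparison R n T F).
Qed.

(** * The Hopf-Lax formula *)

HB.lock Definition legendre (R : realType) n (H : 'rV[R]_n -> R) (q : 'rV[R]_n) : R :=
  sup [set dot p q - H p | p in setT].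

(** The action of the straight path with displacement [z] in time [t]. For [t = T] its translates
    are the paraboloids of the overview. *)
Definition lagrangian (R : realType) n (H : 'rV[R]_n -> R) (t : R) (z : 'rV[R]_n) : R :=
  t * legendre H (t^-1 *: z).

(** Time 0 is separate because [lagrangian H 0] is identically 0, as [0^-1 = 0], and not the
    expected penalty that is infinite off the origin. *)
HB.lock Definition hopf_lax (R : realType) n (H u0 : 'rV[R]_n -> R) (z : R * 'rV[R]_n) : R :=
  if z.1 <= 0 then u0 z.2
  else inf [set u0 y + lagrangian H z.1 (z.2 - y) | y in setT].

Section legendre.
Context {R : realType} {n : nat}.
Local Notation V := 'rV[R]_n.
Implicit Types (H : V -> R) (p q x y z : V) (t s h : R).

(** What the evolution equation requires of both Hamiltonians: class C^1, convexity and superlinear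
    growth. Second-order information enters only with the obstacle problem. *)
Record hamiltonian H : Prop := Hamiltonian {
  ham_diff : forall p, differentiable H p;
  ham_grad_cts : continuous (grad H);
  ham_convex : forall p p', H p + dot (grad H p) (p' - p) <= H p';
  ham_superlinear : forall M : R, exists K : R, forall p, K < `|p| -> M * `|p| <= H p
}.

Section fixed_hamiltonian.
Variable H : V -> R.
Hypothesis hamH : hamiltonian H.

Lemma ham_cts : continuous H.
Proof. by move=> p; exact: differentiable_continuous (ham_diff hamH p). Qed.

Lemma legendre_coercive (r : R) : exists K : R, forall p q, `|q| <= r -> K < `|p| ->
  dot p q - H p < - H 0.
Proof.
(* The slope beats [dot p q] by its first term and the constant [H 0] by its second one, as
   [|p| > 1] below; the last 1 gives strictness. *)
have [K hK] := ham_superlinear hamH (n%:R * `|r| + `|H 0| + 1).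
exists (Num.max K 1) => p q qr; rewrite gt_max => /andP[/hK h1 p1].
have h2 := dot_le p q.
have h3 : n%:R * `|p| * `|q| <= n%:R * `|p| * `|r|.
  by rewrite ler_wpM2l ?mulr_ge0 // (le_trans qr) // ler_norm.
have h4 : `|H 0| <= `|H 0| * `|p| by rewrite ler_peMr // ltW.
have h5 : - H 0 >= - `|H 0| by rewrite lerN2 ler_norm.
have h6 : (n%:R * `|r| + `|H 0| + 1) * `|p| = n%:R * `|p| * `|r| + `|H 0| * `|p| + `|p| by ring.
lra.
Qed.

Lemma legendre_argmax q : exists p, forall p', dot p' q - H p' <= dot p q - H p.
Proof.
have [K hK] := legendre_coercive `|q|.
apply: (@coercive_max R n (fun p => dot p q - H p) K).
  by move=> p; apply: (@continuousB _ _ _ (fun p : V => dot p q) H); [exact: dot_cts | exact: ham_cts].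
by move=> p Kp; rewrite dot0l sub0r ltW // hK.
Qed.

Lemma legendre_ge p q : dot p q - H p <= legendre H q.
Proof.
have [p0 hp0] := legendre_argmax q.
rewrite legendre.unlock.
by apply: ub_le_sup; [exists (dot p0 q - H p0) => _ [p' _ <-] | exists p].
Qed.

Lemma legendre_attained q : exists p, legendre H q = dot p q - H p.
Proof.
have [p hp] := legendre_argmax q; exists p.
apply/eqP; rewrite eq_le legendre_ge andbT legendre.unlock.
by apply: ge_sup; [exists (dot p q - H p), p | move=> _ [p' _ <-]].
Qed.

Lemma legendre_grad p : legendre H (grad H p) = dot p (grad H p) - H p.
Proof.
apply/eqP; rewrite eq_le legendre_ge andbT.
have [p' ->] := legendre_attained (grad H p).
by have := ham_convex hamH p p'; rewrite dotBr (dotC p) (dotC p'); lra.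
Qed.

(** Move from [x] in the direction [q - grad f x]: the first-order expansion lies below the
    supporting affine function unless this direction is zero. *)
Lemma supporting_grad (f : V -> R) x q : differentiable f x ->
  (\forall k \near (0 : V), f x + dot q k <= f (x + k)) -> grad f x = q.
Proof.
move=> df /near_normP[d0 d00 hd0]; pose k := q - grad f x.
suff : dot k k <= 0.
  move=> kk; apply/esym/eqP; rewrite -subr_eq0 -/k; apply/eqP/dot_self_eq0.
  by apply/eqP; rewrite eq_le kk dot_ge0.
apply/ler_addgt0Pr => e e0; rewrite add0r.
have k1 : 0 < `|k| + 1 by rewrite ltr_wpDl.
have [d d00' hd] := diff_eps df (divr_gt0 e0 k1).
pose s := Num.min d d0 / (2 * (`|k| + 1)).
have m0 : 0 < Num.min d d0 by rewrite lt_min d00'.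
have s0 : 0 < s by rewrite divr_gt0 // mulr_gt0.
have sk : `|s *: k| < Num.min d d0.
  rewrite normrZ gtr0_norm // /s mulrAC ltr_pdivrMr ?mulr_gt0 // ltr_pM2l //.
  by have := normr_ge0 k; lra.
move: sk; rewrite lt_min => /andP[skd skd0].
have h1 := hd0 (s *: k); rewrite subr0 in h1; have {}h1 := h1 skd0.
have := hd _ skd; rewrite diff_grad // ler_norml => /andP[_ h2].
have h3 : s * dot k k <= e / (`|k| + 1) * `|s *: k|.
  by move: h1 h2; rewrite !dotZr /k dotBl; lra.
rewrite -(ler_pM2l s0); apply: le_trans h3 _.
rewrite normrZ gtr0_norm //.
have -> : e / (`|k| + 1) * (s * `|k|) = s * (e * (`|k| / (`|k| + 1))) by ring.
rewrite ler_pM2l // -[leRHS]mulr1 ler_pM2l // ler_pdivrMr // mul1r.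
by rewrite lerDl.
Qed.

Lemma legendre_grad_inv p q : legendre H q = dot p q - H p -> grad H p = q.
Proof.
move=> E; apply: supporting_grad; first exact: ham_diff.
apply/near_normP; exists 1 => // k _; have := legendre_ge (p + k) q.
by rewrite E dotDl (dotC q); lra.
Qed.

Lemma ham_le p q : dot p q - legendre H q <= H p.
Proof. by have := legendre_ge p q; lra. Qed.

Lemma legendre_bounded (r : R) : exists2 K : R, 0 <= K & forall p q, `|q| <= r ->
  legendre H q = dot p q - H p -> `|p| <= K.
Proof.
have [K hK] := legendre_coercive r; exists `|K| => // p q qr E.
rewrite leNgt; apply/negP => Kp.
have := hK p q qr (le_lt_trans (ler_norm _) Kp).
by have := legendre_ge 0 q; rewrite E dot0l sub0r; lra.
Qed.

(** The maximizer for one slope is a competitor for the other, and maximizers for bounded slopes are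
    bounded; hence a local Lipschitz bound. *)
Lemma legendre_cts : continuous (legendre H).
Proof.
move=> q; apply/cts_normP => e e0.
have [K K0 hK] := legendre_bounded (`|q| + 1).
have lip q1 q2 : `|q1| <= `|q| + 1 -> legendre H q1 - legendre H q2 <= n%:R * K * `|q1 - q2|.
  move=> h; have [p E] := legendre_attained q1; have pK := hK _ _ h E.
  apply: (@le_trans _ _ (dot p (q1 - q2))).
    by rewrite E dotBr; have := legendre_ge p q2; lra.
  by apply: le_trans (dot_le _ _) _; rewrite ler_wpM2r // ler_wpM2l.
have C0 : 0 < n%:R * K + 1 by rewrite ltr_wpDl // mulr_ge0.
exists (Num.min 1 (e / (n%:R * K + 1))); first by rewrite lt_min ltr01 divr_gt0.
move=> q'; rewrite lt_min => /andP[q'1]; rewrite ltr_pdivlMr // => h.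
have q'q : `|q'| <= `|q| + 1.
  by rewrite -(subrK q q') addrC (le_trans (ler_normD _ _)) // lerD2l ltW.
have l1 := lip q' q q'q; have l2 := lip q q'; rewrite lerDl ler01 in l2.
have {}l2 := l2 isT; rewrite distrC in l2.
have le : n%:R * K * `|q' - q| < e.
  apply: le_lt_trans h; rewrite mulrC ler_wpM2l // lerDl //.
by rewrite ltr_norml; apply/andP; split; lra.
Qed.

(** Test the supremum with a vector of norm at most [M] dual to [q]; on that ball [H] is bounded. *)
Lemma legendre_superlinear (M : R) : 0 <= M ->
  exists2 C : R, 0 <= C & forall q, M * `|q| - C <= legendre H q.
Proof.
move=> M0.
have [||p0 _ hp0] := @EVT_max_rV R n H _ _ (@ball_compact R n M).
- by exists 0; rewrite /= normr0.
- by apply: continuous_subspaceT => ?; exact: ham_cts.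
exists `|H p0| => // q; have [e e1 eq] := dot_direction q.
apply: le_trans (legendre_ge (M *: e) q).
rewrite dotZl eq lerD2l lerN2; apply: le_trans (ler_norm _).
apply: hp0; rewrite inE /= normrZ ger0_norm //.
by rewrite -[leRHS]mulr1 ler_wpM2l.
Qed.

Lemma lagrangian_ge t z p : 0 < t -> dot p z - t * H p <= lagrangian H t z.
Proof.
move=> t0; have := legendre_ge p (t^-1 *: z).
by rewrite -(ler_pM2l t0) mulrBr dotZr mulrA divff ?gt_eqF // mul1r.
Qed.

Lemma lagrangian_attained t z : 0 < t ->
  exists2 p, lagrangian H t z = dot p z - t * H p & grad H p = t^-1 *: z.
Proof.
move=> t0; have [p E] := legendre_attained (t^-1 *: z); exists p.
  by rewrite /lagrangian E mulrBr dotZr mulrA divff ?gt_eqF // mul1r.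
exact: legendre_grad_inv.
Qed.

Lemma lagrangian_scale t q : 0 < t -> lagrangian H t (t *: q) = t * legendre H q.
Proof. by move=> t0; rewrite /lagrangian scalerA mulVf ?gt_eqF // scale1r. Qed.

(** Replacing a broken path by a straight one does not increase the action: the maximizer for the
    left side is a competitor in both terms on the right. *)
Lemma lagrangian_subadd t s z w : 0 < t -> 0 < s ->
  lagrangian H (t + s) (z + w) <= lagrangian H t z + lagrangian H s w.
Proof.
move=> t0 s0; have [|p -> _] := @lagrangian_attained (t + s) (z + w); first exact: addr_gt0.
have := lagrangian_ge z p t0; have := lagrangian_ge w p s0.
by rewrite dotDr mulrDl; lra.
Qed.

Lemma lagrangian_superlinear (M : R) : 0 <= M ->
  exists2 C : R, 0 <= C & forall t z, 0 < t -> M * `|z| - t * C <= lagrangian H t z.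
Proof.
move=> M0; have [C C0 hC] := legendre_superlinear M0; exists C => // t z t0.
have := hC (t^-1 *: z); rewrite -(ler_pM2l t0) normrZ gtr0_norm ?invr_gt0 //.
by rewrite mulrBr mulrCA [t * (_ * _)]mulrA divff ?gt_eqF // mul1r.
Qed.

Lemma lagrangian_cts t : continuous (lagrangian H t).
Proof.
have -> : lagrangian H t = cst t \* (fun z => legendre H (t^-1 *: z)) by [].
move=> z; apply: continuousM; first exact: cst_continuous.
apply: (@continuous_comp _ _ _ (fun z : V => t^-1 *: z) (legendre H)).
  exact: scaler_continuous.
exact: legendre_cts.
Qed.

End fixed_hamiltonian.

Lemma grad_opp H p : (forall p, differentiable H p) ->
  is_diff p (fun p => H (- p)) (dot (- grad H (- p))).
Proof.
move=> dH.
have h1 := differentiableP (dH (- p)).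
have h2 : is_diff p (fun p : V => - p) (fun p => - p).
  by have := is_diffN (is_diff_id p).
have h3 : is_diff p (H \o (fun p : V => - p)) ('d H (- p) \o (fun p => - p)).
  exact: is_diff_comp.
rewrite (_ : dot _ = 'd H (- p) \o (fun p => - p)) //.
by apply/funext => h; rewrite /= diff_grad // dotNl dotNr.
Qed.

Lemma hamiltonian_opp H : hamiltonian H -> hamiltonian (fun p => H (- p)).
Proof.
move=> hH.
have gE p : grad (fun p => H (- p)) p = - grad H (- p).
  by apply: grad_is_diff; apply: grad_opp; exact: ham_diff.
split.
- by move=> p; have [] := grad_opp p (ham_diff hH).
- rewrite (_ : grad _ = fun p => - grad H (- p)); last by apply/funext.
  move=> p; apply: (@continuousN _ _ _ (fun p => grad H (- p))).
  apply: (@continuous_comp _ _ _ (fun p : V => - p) (grad H)).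
    exact: opp_continuous.
  exact: ham_grad_cts.
- move=> p p'; rewrite gE; have := ham_convex hH (- p) (- p').
  by rewrite -opprD dotNr -dotNl.
- move=> M; have [K hK] := ham_superlinear hH M.
  by exists K => p; rewrite -normrN => /hK.
Qed.

Lemma lagrangian_opp H t z : lagrangian (fun p => H (- p)) t z = lagrangian H t (- z).
Proof.
rewrite /lagrangian legendre.unlock; congr (_ * sup _).
apply/seteqP; split => _ [p _ <-] /=; exists (- p) => //.
  by rewrite scalerN dotNl dotNr opprK.
by rewrite scalerN dotNl dotNr !opprK.
Qed.

End legendre.


Section hopf_lax.
Context {R : realType} {n : nat}.
Local Notation V := 'rV[R]_n.
Local Notation RV := (R * 'rV[R]_n)%type.
Implicit Types (p q x y z : V) (t s h : R).
Variables (H : V -> R) (u0 : V -> R) (C0 : R).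
Hypothesis hamH : hamiltonian H.
Hypothesis C0_ge0 : 0 <= C0.
Hypothesis u0_lip : forall x y, `|u0 x - u0 y| <= C0 * `|x - y|.

Local Notation Lam := (lagrangian H).
Local Notation L := (legendre H).

Lemma u0_le x y : u0 x <= u0 y + C0 * `|x - y|.
Proof. by have := u0_lip x y; rewrite ler_norml => /andP[_]; lra. Qed.

(** The action grows with slope [C0 + 1], one more than the Lipschitz constant of [u0], which makes
    the minimization coercive. *)
Lemma hopf_lax_argmin t x : 0 < t -> exists y, forall y',
  u0 y + Lam t (x - y) <= u0 y' + Lam t (x - y').
Proof.
move=> t0; have [|C C_ge0 hC] := @lagrangian_superlinear R n H hamH (C0 + 1).
  by have := C0_ge0; lra.
have [||w hw] := @coercive_min R n (fun w => u0 (x - w) + Lam t w) (t * C + Lam t 0).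
- move=> w; apply: (@continuousD _ _ _ (fun w : V => u0 (x - w)) (Lam t)); last exact: lagrangian_cts.
  apply: (@continuous_comp _ _ _ (fun w : V => x - w) u0).
    apply: (@continuousB _ _ _ (cst x) id); [exact: cst_continuous | exact: cvg_id].
  exact: lipschitz_cts.
- move=> w hw; rewrite subr0; have := hC t w t0; have := u0_le x (x - w).
  by rewrite subKr; lra.
by exists (x - w) => y'; have := hw (x - y'); rewrite !subKr.
Qed.

Local Notation hopf_lax := (hopf_lax H u0).

Lemma hopf_lax0 x : hopf_lax (0, x) = u0 x.
Proof. by rewrite hopf_lax.unlock /= lexx. Qed.

Lemma hopf_lax_le t x y : 0 < t -> hopf_lax (t, x) <= u0 y + Lam t (x - y).
Proof.
move=> t0; rewrite hopf_lax.unlock /= [t <= 0]leNgt t0 /=.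
have [y0 hy0] := hopf_lax_argmin x t0.
by apply: ge_inf; [exists (u0 y0 + Lam t (x - y0)) => _ [y' _ <-] | exists y].
Qed.

Lemma hopf_lax_attained t x : 0 < t ->
  exists y, hopf_lax (t, x) = u0 y + Lam t (x - y).
Proof.
move=> t0; have [y hy] := hopf_lax_argmin x t0; exists y.
apply/eqP; rewrite eq_le hopf_lax_le //= hopf_lax.unlock /= [t <= 0]leNgt t0 /=.
by apply: lb_le_inf; [exists (u0 y + Lam t (x - y)), y | move=> _ [y' _ <-]].
Qed.

(** Translate the minimizer together with the point: the action term is unchanged. *)
Lemma hopf_lax_lip t x x' : 0 <= t ->
  `|hopf_lax (t, x) - hopf_lax (t, x')| <= C0 * `|x - x'|.
Proof.
rewrite le_eqVlt => /predU1P[<-|t0]; first by rewrite !hopf_lax0.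
have key a b : hopf_lax (t, a) - hopf_lax (t, b) <= C0 * `|a - b|.
  have [y ->] := hopf_lax_attained b t0.
  have := hopf_lax_le a (y + (a - b)) t0; have := u0_le (y + (a - b)) y.
  have -> : a - (y + (a - b)) = b - y by apply/rowP => i; rewrite !mxE; ring.
  by rewrite [y + _ - y]addrAC subrr add0r; lra.
by rewrite ler_norml key andbT lerNl opprB distrC key.
Qed.

(** Append a straight piece of velocity [q] to an optimal path ending at [x - h *: q]. *)
Lemma hopf_lax_dpp t h x q : 0 <= t -> 0 < h ->
  hopf_lax (t + h, x) <= hopf_lax (t, x - h *: q) + h * L q.
Proof.
move=> t0 h0; rewrite -(lagrangian_scale H q h0).
move: t0; rewrite le_eqVlt => /predU1P[<-|t0].
  rewrite add0r hopf_lax0; have := hopf_lax_le x (x - h *: q) h0.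
  by rewrite subKr addrC.
have [y ->] := hopf_lax_attained (x - h *: q) t0.
apply: le_trans (hopf_lax_le x y (addr_gt0 t0 h0)) _.
rewrite -addrA lerD2l; apply: le_trans (lagrangian_subadd hamH _ _ t0 h0).
by rewrite addrAC subrK.
Qed.

(** Here [q] is the velocity of the optimal straight path to [x]; its part up to time [t - h] is a
    competitor for the earlier value. *)
Lemma hopf_lax_characteristic t x : 0 < t -> exists q, forall h, 0 < h <= t ->
  hopf_lax (t - h, x - h *: q) + h * L q <= hopf_lax (t, x).
Proof.
move=> t0; have [y E] := hopf_lax_attained x t0.
pose q := t^-1 *: (x - y).
have tq : t *: q = x - y by rewrite /q scalerA divff ?gt_eqF // scale1r.
exists q => h /andP[h0]; rewrite E -tq lagrangian_scale //.
rewrite le_eqVlt => /predU1P[->|ht].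
  by rewrite subrr hopf_lax0 tq subKr.
have th : 0 < t - h by rewrite subr_gt0.
have := hopf_lax_le (x - h *: q) y th.
have -> : x - h *: q - y = (t - h) *: q by rewrite scalerBl tq addrAC.
rewrite (lagrangian_scale H q th).
  move: (hopf_lax _) (L q) => a b; lra.
Qed.

(** Staying at [x] gives the upper bound. For the lower one, the optimal path may come from far
    away, but the superlinear cost of its velocity offsets the Lipschitz change [C0 * |q|]. *)
Lemma hopf_lax_time : exists2 C : R, 0 <= C & forall t h x, 0 <= t -> 0 <= h ->
  `|hopf_lax (t + h, x) - hopf_lax (t, x)| <= C * h.
Proof.
have [C C_ge0 hC] := legendre_superlinear hamH C0_ge0.
exists (C + `|L 0|); first by rewrite addr_ge0.
move=> t h x t0; rewrite le_eqVlt => /predU1P[<-|h0].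
  by rewrite addr0 subrr normr0 mulr0.
have up := hopf_lax_dpp x 0 t0 h0; rewrite scaler0 subr0 in up.
have [|q hq] := @hopf_lax_characteristic (t + h) x; first exact: ltr_wpDl.
have := hq h; rewrite h0 lerDr t0 addrK => /(_ isT) lo.
have := hopf_lax_lip x (x - h *: q) t0.
rewrite (subKr x) (normrZ h q) (gtr0_norm h0) ler_norml => /andP[_ l1].
have l2 : h * (C0 * `|q| - C) <= h * L q by rewrite ler_wpM2l ?hC // ltW.
have l3 : h * L 0 <= h * `|L 0| by rewrite ler_wpM2l ?ler_norm // ltW.
have l4 : 0 <= h * `|L 0| by rewrite mulr_ge0 // ltW.
have l5 : 0 <= h * C by rewrite mulr_ge0 // ltW.
move: up lo l1 l2 l3 l4 l5; move: (hopf_lax _) (hopf_lax (t, x)) (hopf_lax (t, _)).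
move: (L q) (L 0) (`|L 0|) (`|q|) => Lq L0 aL0 nq a b c *.
by rewrite ler_norml; apply/andP; split; lra.
Qed.

Lemma hopf_lax_unif_cts T : unif_continuous_slab T hopf_lax.
Proof.
have [C C_ge0 hC] := hopf_lax_time.
have time t s x : 0 <= t -> 0 <= s ->
    `|hopf_lax (t, x) - hopf_lax (s, x)| <= C * `|t - s|.
  move=> t0 s0; have [ts|st] := leP s t.
    have := hC s (t - s) x s0; rewrite subr_ge0 ts => /(_ isT).
    by rewrite [s + _]addrC (subrK s t) (@ger0_norm _ (t - s)) ?subr_ge0.
  have := hC t (s - t) x t0; rewrite subr_ge0 ltW // => /(_ isT).
  rewrite [t + _]addrC (subrK t s) [`|t - s|]distrC (@gtr0_norm _ (s - t)) ?subr_gt0 //.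
  by rewrite [leLHS]distrC.
move=> e e0; have CC : 0 < C + C0 + 1 by have := C0_ge0; lra.
exists (e / (C + C0 + 1)); first by rewrite divr_gt0.
move=> [t x] [s y] /= /andP[t0 _] /andP[s0 _].
rewrite ltr_pdivlMr // prod_normE /= => h.
rewrite -(subrKA (hopf_lax (s, x))); apply: le_lt_trans (ler_normD _ _) _.
apply: le_lt_trans h; have h1 := time t s x t0 s0; have h2 := hopf_lax_lip x y s0.
set m := Num.max _ _.
have m1 : `|t - s| <= m by rewrite /m le_max lexx.
have m2 : `|x - y| <= m by rewrite /m le_max lexx orbT.
have m3 : C * `|t - s| <= C * m by rewrite ler_wpM2l.
have m4 : C0 * `|x - y| <= C0 * m by rewrite ler_wpM2l.
have m0 : 0 <= m by exact: le_trans m1.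
lra.
Qed.

Lemma slab_expansion (phi : RV -> R) t x q (e : R) : differentiable phi (t, x) -> 0 < e ->
  exists2 d : R, 0 < d & forall h, 0 < h < d ->
   `|phi (t - h, x - h *: q) - phi (t, x) + h * (derive1 (fun t => phi (t, x)) t +
      dot (grad (fun x => phi (t, x)) x) q)| <= e * h.
Proof.
move=> dphi e0.
have Et : derive1 (fun t => phi (t, x)) t = 'd phi (t, x) (1, 0).
  have h1 : is_diff t (fun t : R => (t, x)) (fun s => (s, (0 : V))).
    exact: (is_diff_pair (is_diff_id t) (is_diff_cst x t)).
  have h2 : is_diff t (phi \o (fun t : R => (t, x))) ('d phi (t, x) \o (fun s => (s, (0 : V)))).
    by apply: is_diff_comp => //; exact: differentiableP.
  have dd : differentiable (fun t => phi (t, x)) t by have [] := h2.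
  rewrite derive1E deriveE // -[X in 'd X t](_ : phi \o (fun t : R => (t, x)) = _) //.
  by rewrite diff_val.
have Ex : dot (grad (fun x => phi (t, x)) x) q = 'd phi (t, x) (0, q).
  have h1 : is_diff x (fun x : V => (t, x)) (fun k : V => ((0 : R), k)).
    exact: (is_diff_pair (is_diff_cst t x) (is_diff_id x)).
  have h2 : is_diff x (phi \o (fun x : V => (t, x))) ('d phi (t, x) \o (fun k : V => ((0 : R), k))).
    by apply: is_diff_comp => //; exact: differentiableP.
  have dd : differentiable (fun x => phi (t, x)) x by have [] := h2.
  rewrite -diff_grad // -[X in 'd X x](_ : phi \o (fun x : V => (t, x)) = _) //.
  by rewrite diff_val.
(* The norm of the space-time direction [(1, q)]. *)
pose N := Num.max 1 `|q|.
have N0 : 0 < N by rewrite lt_max ltr01.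
have [d d0 hd] := diff_eps dphi (divr_gt0 e0 N0).
exists (d / N); first by rewrite divr_gt0.
move=> h /andP[h0]; rewrite ltr_pdivlMr // => hN.
have nE : `|((- h, - (h *: q)) : RV)| = h * N.
  by rewrite prod_normE /= !normrN normrZ gtr0_norm // /N maxr_pMr ?ltW // mulr1.
have := hd (- h, - (h *: q)); rewrite nE => /(_ hN).
have -> : ((t, x) + (- h, - (h *: q)) : RV) = (t - h, x - h *: q) by [].
have -> : 'd phi (t, x) (- h, - (h *: q)) = - (h * ('d phi (t, x) (1, 0) + 'd phi (t, x) (0, q))).
  have -> : ((- h, - (h *: q)) : RV) = (- h) *: (((1, 0) : RV) + ((0, q) : RV)).
    rewrite -[RHS]/((- h * (1 + 0), - h *: (0 + q)) : RV).
    by rewrite addr0 add0r mulr1 scaleNr.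
  by rewrite linearZ linearD /= -mulNr.
have -> : e / N * (h * N) = e * h by field; rewrite gt_eqF.
by rewrite -Et -Ex opprK.
Qed.

(** Both inequalities come from moving backward along a straight line. The subsolution test uses the
    velocity [grad H p], for which Fenchel's inequality is an equality; the supersolution test uses
    the characteristic, for which the inequality suffices. *)
Lemma hopf_lax_solution T : hj_solution H T hopf_lax.
Proof.
split; first exact: hopf_lax_unif_cts.
move=> phi Cphi t0 x0 /andP[t0_gt0 _].
have dphi : differentiable phi (t0, x0) by have [] := Cphi 1%N.
set tau := derive1 _ t0; set p := grad _ x0.
have cone (P : RV -> Prop) q : (\forall z \near (t0, x0), P z) ->
    exists2 d : R, 0 < d & forall h, 0 < h < d -> P (t0 - h, x0 - h *: q).
  move=> /near_normP[d d0 hd]; have N0 : 0 < 1 + `|q| by rewrite ltr_pwDl.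
  exists (d / (1 + `|q|)); first by rewrite divr_gt0.
  move=> h /andP[h0]; rewrite ltr_pdivlMr // => hN; apply: hd.
  rewrite pair_norm_lt [t0 - h - t0]addrAC [x0 - _ - x0]addrAC !subrr !add0r.
  rewrite !normrN normrZ gtr0_norm //; have := normr_ge0 q => qq.
  have : 0 <= h * `|q| by rewrite mulr_ge0 // ltW.
  by move=> hq; rewrite mulrDr mulr1 in hN; apply/andP; split; lra.
have pick q (e : R) (P : RV -> Prop) : 0 < e -> (\forall z \near (t0, x0), P z) ->
    exists h, [/\ 0 < h, h <= t0, P (t0 - h, x0 - h *: q) &
      `|phi (t0 - h, x0 - h *: q) - phi (t0, x0) + h * (tau + dot p q)| <= e * h].
  move=> e0 /(cone _ q)[d1 d10 h1].
  have [d2 d20 h2] := slab_expansion q dphi e0.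
  pose h := Num.min t0 (Num.min d1 d2) / 2.
  have m0 : 0 < Num.min t0 (Num.min d1 d2) by rewrite !lt_min t0_gt0 d10.
  have h0 : 0 < h by rewrite divr_gt0.
  have : h < Num.min t0 (Num.min d1 d2) by rewrite /h ltr_pdivrMr //; lra.
  rewrite !lt_min => /and3P[ht hd1 hd2]; exists h; split => //.
  - exact: ltW.
  - by apply: h1; rewrite h0.
  - by apply: h2; rewrite h0.
split=> ext.
- apply/ler_addgt0Pr => e e0; rewrite add0r.
  pose q := grad H p; have [h [h0 ht hP]] := pick q e _ e0 ext.
  rewrite ler_norml => /andP[_ hphi].
  have := hopf_lax_dpp x0 q (_ : 0 <= t0 - h) h0; rewrite subr_ge0 subrK => /(_ ht) dpp.
  rewrite -(ler_pM2l h0); have := legendre_grad hamH p; rewrite -/q => Lq.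
  have -> : H p = dot p q - L q by rewrite Lq; ring.
  by move: hP; rewrite [h * e]mulrC; lra.
- rewrite -[tau + H p]opprK oppr_ge0; apply/ler_addgt0Pr => e e0; rewrite add0r.
  have [q hq] := hopf_lax_characteristic x0 t0_gt0.
  have [h [h0 ht hP]] := pick q e _ e0 ext.
  rewrite ler_norml => /andP[hphi _].
  have := hq h; rewrite h0 ht => /(_ isT) dpp.
  have := ham_le hamH p q; rewrite -(ler_pM2l h0) => Hp.
  rewrite -(ler_pM2l h0) mulrN [h * e]mulrC.
  by move: hP Hp; lra.
Qed.

End hopf_lax.

(** * The forward and backward solution operators *)

Section operators.
Context {R : realType} {n : nat}.
Local Notation V := 'rV[R]_n.
Local Notation RV := (R * 'rV[R]_n)%type.
Variables (H : V -> R) (T : R).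
Hypothesis hamH : hamiltonian H.
Hypothesis T0 : 0 < T.

(** Existence ensures that [get] returns a genuine solution; comparison then identifies its value at
    time [T]. *)
Lemma S_plus_hopf_lax (u0 : V -> R) : lipschitz u0 ->
  S_plus H T u0 = fun x => hopf_lax H u0 (T, x).
Proof.
move=> /lipschitzP[C C_ge0 hC]; apply/funext => x; rewrite /S_plus.
set A := [set u | _].
have A0 : A (hopf_lax H u0).
  by split; [exact: hopf_lax_solution hamH C_ge0 hC T | exact: hopf_lax0].
have [su u0E] := getPex (ex_intro A _ A0).
apply: (hj_unique T0 (ham_cts hamH) su A0.1) => y.
by rewrite u0E A0.2.
Qed.

(** A change of sign swaps local maxima and minima. Together with the reversal of time it reduces
    the backward problem to a forward one with Hamiltonian [H (- p)]. *)
Lemma hj_solution_opp (u : RV -> R) : hj_solution (fun p => H (- p)) T u ->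
  hj_solution (fun p => - H p) T (fun z => - u z).
Proof.
move=> [uc hu]; split.
  move=> e e0; have [d d0 hd] := uc e e0; exists d => // y z yT zT yz.
  by rewrite -opprD normrN hd.
move=> phi Cphi t0 x0 t0T /=.
have CN : Cinfty (fun z => - phi z).
  rewrite (_ : (fun z => _) = (fun z => -1 * phi z)); first exact: CinftyZ.
  by apply/funext => z; rewrite mulN1r.
have dphi : differentiable phi (t0, x0) by have [] := Cphi 1%N.
have d1 : differentiable (fun t => phi (t, x0)) t0.
  have dp : differentiable (fun t : R => (t, x0)) t0.
    by apply: differentiable_pair; [exact: ex_diff | exact: differentiable_cst].
  exact: differentiable_comp dp dphi.
have d2 : differentiable (fun x => phi (t0, x)) x0.
  have dp : differentiable (fun x : V => (t0, x)) x0.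
    by apply: differentiable_pair; [exact: differentiable_cst | exact: ex_diff].
  exact: differentiable_comp dp dphi.
have [h1 h2] := hu _ CN t0 x0 t0T.
have Et : derive1 (fun t => - phi (t, x0)) t0 = - derive1 (fun t => phi (t, x0)) t0.
  by rewrite !derive1E; apply: deriveN; exact: diff_derivable.
have Ex : grad (fun x => - phi (t0, x)) x0 = - grad (fun x => phi (t0, x)) x0.
  apply/rowP => i; rewrite [LHS]mxE [RHS]mxE [in RHS]mxE.
  by apply: deriveN; exact: diff_derivable.
rewrite Et Ex opprK in h1 h2.
split=> ext.
- have : 0 <= - derive1 (fun t => phi (t, x0)) t0 + H (grad (fun x => phi (t0, x)) x0).
    by apply: h2; apply: filterS ext => z; lra.
  by lra.
- have : - derive1 (fun t => phi (t, x0)) t0 + H (grad (fun x => phi (t0, x)) x0) <= 0.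
    by apply: h1; apply: filterS ext => z; lra.
  by lra.
Qed.

Lemma S_minus_hopf_lax (uT : V -> R) : lipschitz uT ->
  S_minus H T uT =
  fun x => - hopf_lax (fun p => H (- p)) (fun y => - uT y) (T, x).
Proof.
move=> /lipschitzP[C C_ge0 hC]; apply/funext => x; rewrite /S_minus.
set A := [set w | _]; set w0 := hopf_lax _ _.
have hC' y z : `|- uT y - - uT z| <= C * `|y - z| by rewrite -opprD normrN.
have sw : hj_solution (fun p => - H p) T (fun z => - w0 z).
  apply: hj_solution_opp.
  exact: hopf_lax_solution (hamiltonian_opp hamH) C_ge0 hC' T.
have A0 : A (fun z => - w0 (T - z.1, z.2)).
  split; last by move=> y /=; rewrite subrr /w0 hopf_lax0 opprK.
  rewrite /hj_backward_solution.
  rewrite (_ : (fun z => _) = (fun z => - w0 z)) //.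
  by apply/funext => -[t y] /=; rewrite subKr.
have [su u0E] := getPex (ex_intro A _ A0).
have cN : continuous (fun p => - H p).
  by move=> p; apply: (@continuousN _ _ _ H); exact: ham_cts.
have := hj_unique T0 cN su sw; rewrite /= subrr; apply => y.
by rewrite subr0 u0E /w0 hopf_lax0 opprK.
Qed.

Lemma S_plus_le (u0 : V -> R) x y : lipschitz u0 ->
  S_plus H T u0 x <= u0 y + lagrangian H T (x - y).
Proof.
move=> lu; rewrite S_plus_hopf_lax //; have [C C_ge0 hC] := (lipschitzP _).1 lu.
exact: (hopf_lax_le hamH C_ge0 hC).
Qed.

Lemma S_plus_attained (u0 : V -> R) x : lipschitz u0 ->
  exists y, S_plus H T u0 x = u0 y + lagrangian H T (x - y).
Proof.
move=> lu; rewrite S_plus_hopf_lax //; have [C C_ge0 hC] := (lipschitzP _).1 lu.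
exact: (hopf_lax_attained hamH C_ge0 hC).
Qed.

Lemma S_plus_lipschitz (u0 : V -> R) : lipschitz u0 -> lipschitz (S_plus H T u0).
Proof.
move=> lu; rewrite S_plus_hopf_lax //; have [C C_ge0 hC] := (lipschitzP _).1 lu.
apply/lipschitzP; exists C => // x y.
by apply: (hopf_lax_lip hamH C_ge0 hC); exact: ltW.
Qed.

Lemma lipschitz_opp (f : V -> R) : lipschitz f -> lipschitz (fun x => - f x).
Proof.
move=> /lipschitzP[C C_ge0 hC]; apply/lipschitzP; exists C => // x y.
by rewrite -opprD normrN.
Qed.

Lemma S_minus_ge (uT : V -> R) y z : lipschitz uT ->
  uT z - lagrangian H T (z - y) <= S_minus H T uT y.
Proof.
move=> lu; rewrite S_minus_hopf_lax //.
have [C C_ge0 hC] := (lipschitzP _).1 (lipschitz_opp lu).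
have := hopf_lax_le (hamiltonian_opp hamH) C_ge0 hC y z T0.
by rewrite lagrangian_opp opprB; lra.
Qed.

Lemma S_minus_attained (uT : V -> R) y : lipschitz uT ->
  exists z, S_minus H T uT y = uT z - lagrangian H T (z - y).
Proof.
move=> lu; rewrite S_minus_hopf_lax //.
have [C C_ge0 hC] := (lipschitzP _).1 (lipschitz_opp lu).
have [z ->] := hopf_lax_attained (hamiltonian_opp hamH) C_ge0 hC y T0.
by exists z; rewrite lagrangian_opp opprB; ring.
Qed.

Lemma S_minus_lipschitz (uT : V -> R) : lipschitz uT -> lipschitz (S_minus H T uT).
Proof.
move=> lu; rewrite S_minus_hopf_lax //.
have [C C_ge0 hC] := (lipschitzP _).1 (lipschitz_opp lu).
apply: lipschitz_opp; apply/lipschitzP; exists C => // x y.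
by apply: (hopf_lax_lip (hamiltonian_opp hamH) C_ge0 hC); exact: ltW.
Qed.

End operators.

(** * Touching from one side *)

Section touching.
Context {R : realType} {n : nat}.
Local Notation V := 'rV[R]_n.
Implicit Types (p q x y z h k d : V) (X Y : 'M[R]_n).

Lemma small_multiple h (d : R) : 0 < d -> exists2 t0 : R, 0 < t0 &
  forall t, 0 < t < t0 -> `|t *: h| < d.
Proof.
move=> d0; have h1 : 0 < `|h| + 1 by rewrite ltr_wpDl.
exists (d / (`|h| + 1)); first by rewrite divr_gt0.
move=> t /andP[t0]; rewrite ltr_pdivlMr // => td.
rewrite normrZ gtr0_norm //; apply: le_lt_trans td.
by rewrite ler_wpM2l ?lerDl // ltW.
Qed.

(** Evaluate at [t *: h] and let [t] tend to 0. The terms of order [t], with [h = a - b], give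
    [a = b]; then those of order [t ^+ 2] compare the forms. *)
Lemma second_order_le a b X Y :
  (forall e : R, 0 < e -> exists2 d : R, 0 < d & forall h, `|h| < d ->
    dot a h + qf X h / 2 <= dot b h + qf Y h / 2 + e * dot h h) ->
  a = b /\ forall h, qf X h <= qf Y h.
Proof.
move=> H.
have key (e : R) h : 0 < e -> exists2 t0 : R, 0 < t0 & forall t, 0 < t < t0 ->
    dot (a - b) h <= t * ((qf Y h - qf X h) / 2 + e * dot h h).
  move=> e0; have [d d0 hd] := H e e0; have [t0 t00 ht] := small_multiple h d0.
  exists t0 => // t tt; have := hd _ (ht t tt); have /andP[tgt0 _] := tt.
  rewrite !dotZr dotZl !qfZv dotBl => h1; rewrite -(ler_pM2l tgt0).
  by move: h1; rewrite expr2; lra.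
have ab : a = b.
  apply/eqP; rewrite -subr_eq0; apply/eqP/dot_self_eq0/eqP.
  rewrite eq_le dot_ge0 andbT; set k := a - b.
  have [t0 t00 ht] := key 1 k ltr01.
  set M := (_ - _) / 2 + _ in ht.
  rewrite leNgt; apply/negP => kk.
  have M1 : 0 < `|M| + 1 by rewrite ltr_wpDl.
  pose t := Num.min t0 (dot k k / (`|M| + 1)) / 2.
  have m0 : 0 < Num.min t0 (dot k k / (`|M| + 1)) by rewrite lt_min t00 divr_gt0.
  have tgt0 : 0 < t by rewrite divr_gt0.
  have : t < Num.min t0 (dot k k / (`|M| + 1)) by rewrite /t ltr_pdivrMr //; lra.
  rewrite lt_min ltr_pdivlMr // => /andP[tt tk].
  have := ht t; rewrite tgt0 tt => /(_ isT).
  have : t * M <= t * `|M| by rewrite ler_wpM2l ?ler_norm // ltW.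
  by move: tk tgt0; rewrite mulrDr mulr1; lra.
split=> // h; apply/ler_addgt0Pr => e e0.
have hh1 : 0 < dot h h + 1 by rewrite ltr_wpDl // dot_ge0.
have e1 : 0 < e / (2 * (dot h h + 1)) by rewrite divr_gt0 // mulr_gt0.
have [t0 t00 ht] := key _ h e1.
have := ht (t0 / 2); rewrite divr_gt0 // ltr_pdivrMr // ltr_pMr // ltr1n => /(_ isT).
rewrite ab subrr dot0l pmulr_rge0 ?divr_gt0 //.
have : e / (2 * (dot h h + 1)) * dot h h <= e / 2.
  rewrite mulrAC ler_pdivrMr ?mulr_gt0 //.
  have -> : e / 2 * (2 * (dot h h + 1)) = e * (dot h h + 1) by field.
  by rewrite ler_pM2l // lerDl.
lra.
Qed.

Lemma cts_lsc (f : V -> R) : continuous f -> lsc f.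
Proof.
move=> cf x a; rewrite lte_fin => ax.
have ax' : 0 < f x - a by rewrite subr_gt0.
have [d d0 hd'] := (cts_normP _ _).1 (cf x) _ ax'.
exists [set y | `|y - x| < d].
  have : \forall y \near x, `|y - x| < d by apply/near_normP; exists d.
  exact.
by move=> y /= /hd'; rewrite lte_fin ltr_norml => /andP[+ _]; lra.
Qed.

Lemma cts_usc (f : V -> R) : continuous f -> usc f.
Proof.
by move=> cf; apply: cts_lsc => x; apply: (@continuousN _ _ _ f); exact: cf.
Qed.

(* Maximize the function minus a steep paraboloid centered at x0. *)
Lemma touched_above (f : V -> R) x0 (r : R) : lipschitz f -> 0 < r ->
  exists x1 p (k : R), [/\ `|x1 - x0| < r, 0 < k &
    forall x, f x <= f x1 + dot p (x - x1) + k * dot (x - x1) (x - x1)].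
Proof.
(* At distance at least [r] the penalty is at least [(C + 1) * |w|], more than [f] can gain
   there. *)
move=> /lipschitzP[C C0 hC] r0; pose k := (C + 1) / r.
have k0 : 0 < k by rewrite divr_gt0 // ltr_wpDl.
have kr : k * r = C + 1 by rewrite /k divfK // gt_eqF.
have fle (w : V) : f (x0 + w) <= f x0 + C * `|w|.
  by have := hC (x0 + w) x0; rewrite [x0 + w - x0]addrAC subrr add0r ler_norml => /andP[_]; lra.
have kd (w : V) : k * `|w| ^+ 2 <= k * dot w w by rewrite ler_pM2l // norm_sq_le_dot.
have [||w hw] := @coercive_max R n (fun w => f (x0 + w) - k * dot w w) r.
- move=> w; apply: (@continuousB _ _ _ (fun w : V => f (x0 + w)) (fun w => k * dot w w)).
    apply: (@continuous_comp _ _ _ (fun w : V => x0 + w) f).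
      by apply: (@continuousD _ _ _ (cst x0) id); [exact: cst_continuous | exact: cvg_id].
    exact: (lipschitz_cts hC).
  apply: (@continuousM _ _ (cst k) (fun w => dot w w)); first exact: cst_continuous.
  rewrite (_ : (fun w => dot w w) = qf 1%:M); first exact: qf_cts.
  by apply/funext => y; rewrite qf1.
- move=> w rw; rewrite addr0 dot0l mulr0 subr0; have := fle w; have := kd w.
  have : k * r * `|w| <= k * `|w| ^+ 2.
    by rewrite expr2 -mulrA ler_pM2l // ler_wpM2r // ltW.
  by rewrite kr mulrDl mul1r; have := normr_ge0 w; lra.
(* Re-expanding the square around the maximizer gives the slope [(2 * k) *: w]. *)
exists (x0 + w), ((2 * k) *: w), k; split => //.
- rewrite [x0 + w - x0]addrAC subrr add0r ltNge; apply/negP => rw.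
  have := hw 0; rewrite addr0 dot0l mulr0 subr0; have := fle w; have := kd w.
  have : k * r * `|w| <= k * `|w| ^+ 2 by rewrite expr2 -mulrA ler_pM2l // ler_wpM2r.
  by rewrite kr mulrDl mul1r; have := r0; lra.
- move=> x; have := hw (x - x0); rewrite [x0 + (x - x0)]addrC subrK.
  have -> : x - x0 = w + (x - (x0 + w)) by apply/rowP => i; rewrite !mxE; ring.
  move: (x - (x0 + w)) => e.
  by rewrite dotDl !dotDr dotZl (dotC e w); lra.
Qed.

Lemma touched_below (f : V -> R) x0 (r : R) : lipschitz f -> 0 < r ->
  exists x1 p (k : R), [/\ `|x1 - x0| < r, 0 < k &
    forall x, f x1 + dot p (x - x1) - k * dot (x - x1) (x - x1) <= f x].
Proof.
move=> /lipschitz_opp lf /(touched_above x0 lf)[x1 [p [k [h1 k0 h2]]]].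
exists x1, (- p), k; split => // x; have := h2 x; rewrite dotNl; lra.
Qed.

Lemma trmx_combination (a b c : R) X Y : X^T = X -> Y^T = Y ->
  (a *: X + b%:M + c *: Y)^T = a *: X + b%:M + c *: Y.
Proof. by move=> sX sY; rewrite !linearD /= !linearZ /= tr_scalar_mx sX sY. Qed.

(** For [d != 0], the orthogonal projection along [d]; its form is the squared distance to the line
    spanned by [d]. *)
Definition transverse d : 'M[R]_n := 1%:M - (dot d d)^-1 *: (d^T *m d).

Lemma transverse_sym d : (transverse d)^T = transverse d.
Proof.
by rewrite /transverse linearB /= trmx1 linearZ /= trmx_mul trmxK.
Qed.

Lemma qf_transverse d h : qf (transverse d) h = dot h h - dot d h ^+ 2 / dot d d.
Proof. by rewrite /transverse qfB qf1 qfZ qf_outer mulrC. Qed.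

Lemma mul_transverse d : d != 0 -> d *m transverse d = 0.
Proof.
move=> d0; have dd := dot_self_gt0 d0.
rewrite /transverse mulmxBr mulmx1 -scalemxAr mulmxA.
rewrite [d *m d^T](mx11_scalar _) -/(dot d d) mul_scalar_mx scalerA.
by rewrite mulVf ?gt_eqF // scale1r subrr.
Qed.

(* A strong penalization of the distance to the axis confines the minimum to
   the interior of a thin cylinder around the segment. *)
Lemma cylinder_min (g : V -> R) x1 d (s : R) : continuous g -> d != 0 ->
  0 <= g x1 -> 0 <= g (x1 + d) -> 0 < s < 1 -> g (x1 + s *: d) < 0 ->
  exists (K : R) xm, local_min (fun x => g x + K * qf (transverse d) (x - x1)) xm.
Proof.
move=> cg d0 g1 g2 /andP[s0 s1] gs.
have dd := dot_self_gt0 d0; pose P := transverse d.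
(* Cylindrical coordinates: [sg] is the position along the axis, from 0 at [x1] to 1 at [x1 + d],
   and [tau] is the squared distance to the axis. *)
pose sg x := dot d (x - x1) / dot d d; pose tau x := qf P (x - x1).
have csub : continuous (fun x : V => x - x1).
  move=> x; apply: (@continuousB _ _ _ id (cst x1)); [exact: cvg_id | exact: cst_continuous].
have csg : continuous sg.
  move=> x; apply: (@continuousM _ _ (fun x => dot d (x - x1)) (cst (dot d d)^-1)); last exact: cst_continuous.
  apply: (@continuous_comp _ _ _ (fun x => x - x1) (dot d)); first exact: csub.
  exact: dotr_cts.
have ctau : continuous tau.
  move=> x; apply: (@continuous_comp _ _ _ (fun x => x - x1) (qf P)); first exact: csub.
  exact: qf_cts.
pose C := [set x | 0 <= sg x /\ sg x <= 1 /\ tau x <= 1].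
have tauE x : tau x = dot (x - x1) (x - x1) - sg x ^+ 2 * dot d d.
  by rewrite /tau qf_transverse /sg; field; rewrite gt_eqF.
have bndC x : C x -> dot (x - x1) (x - x1) <= 1 + dot d d.
  move=> [a0 [a1 a2]]; move: a2; rewrite tauE => a2.
  have : sg x ^+ 2 * dot d d <= 1 * dot d d by rewrite ler_pM2r // expr_le1.
  lra.
have cC : compact C.
  apply: bounded_closed_compact.
    exists (`|x1| + (1 + dot d d) + 1); split; first exact: num_real.
    move=> M MM x /bndC hx; apply: le_trans (ltW MM).
    rewrite -(subrK x1 x); apply: le_trans (ler_normD _ _) _.
    have := norm_sq_le_dot (x - x1); have := normr_ge0 (x - x1).
    by rewrite expr2; nra.
  have -> : C = (sg @^-1` [set y | 0 <= y]) `&` (sg @^-1` [set y | y <= 1]) `&`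
      (tau @^-1` [set y | y <= 1]).
    by apply/seteqP; split => x /=; [move=> [? []] | move=> [[]]].
  apply: closedI; [apply: closedI|].
  - by apply: closed_comp; [move=> x _; exact: csg | exact: closed_ge].
  - by apply: closed_comp; [move=> x _; exact: csg | exact: closed_le].
  - by apply: closed_comp; [move=> x _; exact: ctau | exact: closed_le].
have sgl (t : R) : sg (x1 + t *: d) = t.
  by rewrite /sg [x1 + _ - x1]addrAC subrr add0r dotZr mulfK // gt_eqF.
have taul (t : R) : tau (x1 + t *: d) = 0.
  rewrite tauE sgl [x1 + _ - x1]addrAC subrr add0r dotZl dotZr; ring.
have Cs : C (x1 + s *: d) by rewrite /C /= sgl taul ler01 !ltW.
have [||xg _ hg] := @EVT_min_rV R n g C _ cC.
- by exists (x1 + s *: d).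
- exact: continuous_subspaceT.
pose M := `|g xg|; pose m := - g (x1 + s *: d).
have m0 : 0 < m by rewrite oppr_gt0.
have gM x : C x -> - M <= g x.
  move=> Cx; apply: (@le_trans _ _ (g xg)); first by rewrite lerNl /M -normrN ler_norm.
  by apply: hg; rewrite inE.
have [r1 r10 h1] := (cts_normP _ _).1 (cg x1) _ m0.
have [r2 r20 h2] := (cts_normP _ _).1 (cg (x1 + d)) _ m0.
(* Within [r] of either end of the segment [g] stays above [- m], the value at the dip; and [r < 1]
   leaves the lateral face outside the thin cylinder. *)
pose r := Num.min 1 (Num.min r1 r2) / 2.
have mr0 : 0 < Num.min 1 (Num.min r1 r2) by rewrite !lt_min ltr01 r10.
have r0 : 0 < r by rewrite divr_gt0.
have : r < Num.min 1 (Num.min r1 r2) by rewrite /r ltr_pdivrMr //; lra.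
rewrite !lt_min => /and3P[rr1 rrr1 rrr2].
have rho0 : 0 < r ^+ 2 by rewrite exprn_gt0.
(* Beyond distance [r] from the axis the penalty exceeds [M], hence any negative value of [g]. *)
pose K := (M + 1) / r ^+ 2.
have K0 : 0 < K by rewrite divr_gt0 // ltr_wpDl // normr_ge0.
have Kr : K * r ^+ 2 = M + 1 by rewrite /K divfK // gt_eqF.
have small (e : V) : dot e e <= r ^+ 2 -> `|e| <= r.
  move=> er; have := le_trans (norm_sq_le_dot e) er.
  by rewrite ler_pXn2r // nnegrE // ltW.
(* On the whole boundary the penalized function is larger than at the dip, where the penalty
   vanishes; so the minimum is interior. *)
have face x : C x -> (sg x = 0 \/ sg x = 1 \/ tau x = 1) -> - m < g x + K * tau x.
  move=> Cx bd; have gx := gM _ Cx.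
  have [tr|rt] := ltP (r ^+ 2) (tau x).
    have : M + 1 < K * tau x by rewrite -Kr ltr_pM2l.
    by lra.
  have big1 : tau x != 1.
    by rewrite lt_eqF // (le_lt_trans rt) // expr_lt1 // ltW.
  case: bd => [E|[E|E]]; last by rewrite E eqxx in big1.
  - have xE : `|x - x1| < r1.
      apply: le_lt_trans rrr1; apply: small.
      by move: rt; rewrite tauE E expr2 !mul0r subr0.
    have := h1 _ xE; rewrite ltr_norml => /andP[h _].
    have : 0 <= K * tau x.
      by rewrite mulr_ge0 ?(ltW K0) // tauE E expr2 !mul0r subr0 dot_ge0.
    by move: h g1; lra.
  - have ed : dot (x - (x1 + d)) (x - (x1 + d)) = tau x.
      have E' : dot d (x - x1) = dot d d.
        by move: E; rewrite /sg => /(congr1 ( *%R^~ (dot d d))); rewrite divfK ?gt_eqF // mul1r.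
      rewrite tauE E expr1n mul1r opprD addrA; move: E'.
      move: (x - x1) => y E'.
      by rewrite dotBl !dotBr (dotC y d) E'; ring.
    have xE : `|x - (x1 + d)| < r2.
      by apply: le_lt_trans rrr2; apply: small; rewrite ed.
    have := h2 _ xE; rewrite ltr_norml => /andP[h _].
    have : 0 <= K * tau x by rewrite -ed mulr_ge0 ?dot_ge0 // ltW.
    by move: h g2; lra.
have cf : continuous (fun x => g x + K * tau x).
  move=> x; apply: (@continuousD _ _ _ g (fun x => K * tau x)); first exact: cg.
  by apply: (@continuousM _ _ (cst K) tau); [exact: cst_continuous | exact: ctau].
have [||xm] := @EVT_min_rV R n (fun x => g x + K * tau x) C _ cC.
- by exists (x1 + s *: d).
- exact: continuous_subspaceT.
rewrite inE => Cm hm; exists K, xm.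
have fm : g xm + K * tau xm <= - m.
  have := hm (x1 + s *: d); rewrite inE taul mulr0 addr0 /m opprK.
  exact.
have [a0 [a1 a2]] := Cm.
have b0 : 0 < sg xm.
  rewrite lt_neqAle a0 andbT; apply/eqP => E.
  by have := face _ Cm (or_introl (esym E)); rewrite ltNge fm.
have b1 : sg xm < 1.
  rewrite lt_neqAle a1 andbT; apply/eqP => E.
  by have := face _ Cm (or_intror (or_introl E)); rewrite ltNge fm.
have b2 : tau xm < 1.
  rewrite lt_neqAle a2 andbT; apply/eqP => E.
  by have := face _ Cm (or_intror (or_intror E)); rewrite ltNge fm.
have near_lt (f : V -> R) (c : R) : continuous f -> f xm < c -> \forall x \near xm, f x < c.
  move=> cf' fc; have fc' : 0 < c - f xm by rewrite subr_gt0.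
  have [e e0 he] := (cts_normP _ _).1 (cf' xm) _ fc'.
  by apply/near_normP; exists e => // y /he; rewrite ltr_norml => /andP[_]; lra.
have n0 : \forall x \near xm, - sg x < 0.
  apply: (near_lt (fun x => - sg x)); last by rewrite oppr_lt0.
  by move=> x; apply: (@continuousN _ _ _ sg); exact: csg.
have n1 := near_lt _ _ csg b1; have n2 := near_lt _ _ ctau b2.
have : \forall x \near xm, C x.
  near=> x; split; last split.
  - by rewrite -oppr_le0 ltW //; near: x.
  - by rewrite ltW //; near: x.
  - by rewrite ltW //; near: x.
by apply: filterS => x Cx; apply: hm; rewrite inE.
Unshelve. all: by end_near. Qed.

End touching.

(** * The obstacle problem *)

Section obstacle_problem.
Context {R : realType} {n : nat}.
Local Notation V := 'rV[R]_n.
Implicit Types (p q x y z h k d w : V) (X : 'M[R]_n) (t s : R).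

(* [B p] plays the role of the inverse of the Hessian of H at p. The last two
   fields hold in dimension one and for quadratic H, not in general. *)
Record obstacle_structure (H : V -> R) (T : R) (B : V -> 'M[R]_n)
    (G : V -> 'M[R]_n -> R) : Prop := ObstacleStructure {
  obs_ham : hamiltonian H;
  obs_sym : forall p, (B p)^T = B p;
  obs_pos : forall p, exists2 c : R, 0 < c & forall h, c * dot h h <= qf (B p) h;
  obs_legendre : forall p (e : R), 0 < e -> exists2 d : R, 0 < d & forall h,
    `|h| < d -> `|legendre H (grad H p + h) - legendre H (grad H p) - dot p h
      - qf (B p) h / 2| <= e * dot h h;
  obs_ge0 : forall p X, X^T = X ->
    0 <= G p X <-> forall h, qf X h <= qf (B p) h / T;
  obs_gt0 : forall p X, X^T = X ->
    0 < G p X <-> exists2 c : R, 0 < c &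
      forall h, qf X h <= qf (B p) h / T - c * dot h h;
  obs_transverse : forall d p w, d != 0 -> dot w d = 0 -> B (p + w) = B p;
  obs_ray : forall x0 d y0 y1 s, 1 <= s ->
    let D x := lagrangian H T (x - y1) - lagrangian H T (x - y0) in
    D (x0 + d) < D x0 -> D (x0 + s *: d) <= D (x0 + d)
}.

Variables (H : V -> R) (T : R) (B : V -> 'M[R]_n) (G : V -> 'M[R]_n -> R).
Hypothesis T0 : 0 < T.
Hypothesis OS : obstacle_structure H T B G.

Local Notation Lam := (lagrangian H).
Local Notation L := (legendre H).
Let hamH := obs_ham OS.

(** Rescaling of [obs_legendre]: where its slope is [p], the paraboloid of parameter [t] has Hessian
    [B p / t]. Increasing [t] flattens it. *)
Lemma lagrangian_taylor t p (e : R) : 0 < t -> 0 < e ->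
  exists2 d : R, 0 < d & forall h, `|h| < d ->
    `|Lam t (t *: grad H p + h) - Lam t (t *: grad H p) - dot p h
      - qf (B p) h / (2 * t)| <= e * dot h h.
Proof.
move=> t0 e0; have [d d0 hd] := obs_legendre OS p (mulr_gt0 e0 t0).
exists (t * d); first by rewrite mulr_gt0.
move=> h ht; have htd : `|t^-1 *: h| < d.
  by rewrite normrZ gtr0_norm ?invr_gt0 // ltr_pdivrMl.
have := hd _ htd; rewrite -(ler_pM2l t0) => E.
have t1 : t != 0 by rewrite gt_eqF.
rewrite lagrangian_scale // /lagrangian scalerDr scalerA mulVf // scale1r.
move: E; rewrite dotZl !dotZr qfZv.
rewrite -[X in X * `|_|](gtr0_norm t0) -normrM.
set a := legendre _ _; set b := legendre _ _.
have -> : t * (a - b - t^-1 * dot p h - t^-1 ^+ 2 * qf (B p) h / 2) =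
  t * a - t * b - dot p h - qf (B p) h / (2 * t) by field.
have -> // : t * (e * t * (t^-1 * (t^-1 * dot h h))) = e * dot h h by field.
Qed.

Variable uT : V -> R.
Hypothesis uT_lip : lipschitz uT.

Let us := S_plus H T (S_minus H T uT).

Let g_lip : lipschitz (S_minus H T uT).
Proof. exact: S_minus_lipschitz. Qed.

Lemma envelope_lipschitz : lipschitz us.
Proof. exact: S_plus_lipschitz. Qed.

Lemma envelope_ge x : uT x <= us x.
Proof.
have [y E] := S_plus_attained hamH T0 x g_lip; rewrite /us E.
by have := S_minus_ge hamH T0 y x uT_lip; lra.
Qed.

(** For a given [y], [S_minus H T uT y] is the least [c] for which the paraboloid
    [c + Lam T (x - y)] lies above [uT]. *)
Lemma envelope_le y (c : R) : (forall x, uT x <= c + Lam T (x - y)) ->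
  forall x, us x <= c + Lam T (x - y).
Proof.
move=> hc x; have := S_plus_le hamH T0 x y g_lip.
have [z ->] := S_minus_attained hamH T0 y uT_lip.
by have := hc z; rewrite -/us; lra.
Qed.

Lemma envelope_attained x : exists y (c : R), us x = c + Lam T (x - y) /\
  forall x', us x' <= c + Lam T (x' - y).
Proof.
have [y E] := S_plus_attained hamH T0 x g_lip.
by exists y, (S_minus H T uT y); split => // x'; exact: S_plus_le.
Qed.

Lemma lip_cts (f : V -> R) : lipschitz f -> continuous f.
Proof. by move=> /lipschitzP[C _ hC]; exact: lipschitz_cts hC. Qed.

Lemma lagrangian_slope t z : 0 < t -> exists2 p, grad H p = t^-1 *: z & z = t *: grad H p.
Proof.
move=> t0; have [p _ gp] := lagrangian_attained hamH z t0.
by exists p => //; rewrite gp scalerA divff ?gt_eqF // scale1r.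
Qed.

Lemma local_maxP (f : V -> R) x : local_max f x <->
  exists2 d : R, 0 < d & forall h, `|h| < d -> f (x + h) <= f x.
Proof.
split.
- move=> /near_normP[d d0 hd]; exists d => // h hh; apply: hd.
  by rewrite [x + h - x]addrAC subrr add0r.
- move=> [d d0 hd]; apply/near_normP; exists d => // y /hd.
  by rewrite [x + _]addrC subrK.
Qed.

Lemma local_minP (f : V -> R) x : local_min f x <->
  exists2 d : R, 0 < d & forall h, `|h| < d -> f x <= f (x + h).
Proof.
split.
- move=> /near_normP[d d0 hd]; exists d => // h hh; apply: hd.
  by rewrite [x + h - x]addrAC subrr add0r.
- move=> [d d0 hd]; apply/near_normP; exists d => // y /hd.
  by rewrite [x + _]addrC subrK.
Qed.

Lemma taylor2_dot (f : V -> R) x (e : R) : twice_differentiable f -> 0 < e ->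
  exists2 d : R, 0 < d & forall h, `|h| < d ->
  `|f (x + h) - f x - dot (grad f x) h - qf (hessian f x) h / 2| <= e * dot h h.
Proof.
move=> f2 e0; have [d d0 hd] := taylor2 f2 x e0; exists d => // h /hd hh.
by apply: le_trans hh _; rewrite ler_pM2l // norm_sq_le_dot.
Qed.

Lemma envelope_supersolution : obstacle_supersolution G uT us.
Proof.
split; first by apply/cts_lsc/lip_cts/envelope_lipschitz.
move=> phi phi2 x0 /local_minP[d1 d10 h1] E.
have uE : 0 <= phi x0 - uT x0 by rewrite -E subr_ge0 envelope_ge.
split => //.
have [y [c [uc ule]]] := envelope_attained x0.
have [p gp zp] := lagrangian_slope (x0 - y) T0.
have sH := hessian_sym phi2 x0.
have [|gE qE] := @second_order_le R n (grad phi x0) p (hessian phi x0) (T^-1 *: B p).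
  move=> e e0; have e2 : 0 < e / 2 by rewrite divr_gt0.
  have [d2 d20 h2] := taylor2_dot x0 phi2 e2.
  have [d3 d30 h3] := lagrangian_taylor p T0 e2.
  exists (Num.min d1 (Num.min d2 d3)); first by rewrite !lt_min d10 d20.
  move=> h; rewrite !lt_min => /and3P[/h1 k1 /h2 k2 /h3 k3].
  move: k3; rewrite -zp ler_norml => /andP[_ k3].
  move: k2; rewrite ler_norml => /andP[k2 _].
  have := ule (x0 + h); rewrite [x0 + h - y]addrAC => k4.
  rewrite qfZ; have Tq : T^-1 * qf (B p) h / 2 = qf (B p) h / (2 * T) by field; rewrite gt_eqF.
  rewrite Tq; lra.
rewrite gE; apply/(obs_ge0 OS) => // h.
by have := qE h; rewrite qfZ mulrC.
Qed.

Lemma envelope_subsolution : obstacle_subsolution G uT us.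
Proof.
split; first by apply/cts_usc/lip_cts/envelope_lipschitz.
move=> phi phi2 x0 /local_maxP[d1 d10 h1] E.
have [le|gt] := leP (phi x0 - uT x0) 0; [by left | right].
rewrite leNgt; apply/negP => Gpos.
set p := grad phi x0 in Gpos.
have [c c0 hc] := (obs_gt0 OS p (hessian_sym phi2 x0)).1 Gpos.
(* With this center the paraboloid has slope [p] at [x0]. *)
pose q := grad H p; pose y0 := x0 - T *: q.
have x0y0 : x0 - y0 = T *: q by rewrite /y0 subKr.
pose c0' := us x0 - Lam T (T *: q).
(* The halved Hessians differ by [c / 2]; two Taylor errors of [c / 8] leave the gap [c / 4]. *)
have e8 : 0 < c / 8 by rewrite divr_gt0.
have [d2 d20 h2] := taylor2_dot x0 phi2 e8.
have [d3 d30 h3] := lagrangian_taylor p T0 e8.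
pose eta := (us x0 - uT x0) / 2.
have eta0 : 0 < eta by rewrite divr_gt0 // E.
have cP : continuous (fun x => uT x - (c0' + Lam T (x - y0))).
  move=> x; apply: (@continuousB _ _ _ uT (fun x => c0' + Lam T (x - y0))).
    exact: lip_cts.
  apply: (@continuousD _ _ _ (cst c0') (fun x => Lam T (x - y0))); first exact: cst_continuous.
  apply: (@continuous_comp _ _ _ (fun x : V => x - y0) (Lam T)).
    by apply: (@continuousB _ _ _ id (cst y0)); [exact: cvg_id | exact: cst_continuous].
  exact: lagrangian_cts.
have [d4 d40 h4] := (cts_normP _ _).1 (cP x0) _ eta0.
pose md := Num.min (Num.min d1 d2) (Num.min d3 d4).
have md0 : 0 < md by rewrite !lt_min d10 d20 d30.
pose r := md / 2; have r0 : 0 < r by rewrite divr_gt0.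
have rmd : r < md by rewrite /r ltr_pdivrMr //; lra.
have near_gap h : `|h| <= r -> us (x0 + h) <= c0' + Lam T (x0 + h - y0) - c / 4 * dot h h.
  move=> hr; have := le_lt_trans hr rmd; rewrite !lt_min => /andP[/andP[l1 l2] /andP[l3 _]].
  have := h1 _ l1; have := h2 _ l2; have := h3 _ l3; have := hc h.
  rewrite -/q -x0y0 [x0 + h - y0]addrAC !ler_norml => k0 /andP[k1 _] /andP[_ k2] k3.
  have Tq : qf (B p) h / T / 2 = qf (B p) h / (2 * T) by field; rewrite gt_eqF.
  move: k1 k2 k3; rewrite /c0' -x0y0 -Tq -/p; lra.
have near_obs h : `|h| <= r -> uT (x0 + h) <= c0' + Lam T (x0 + h - y0) - eta.
  move=> hr; have := le_lt_trans hr rmd; rewrite !lt_min => /andP[_ /andP[_ l4]].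
  have hh : `|x0 + h - x0| < d4 by rewrite [x0 + h - x0]addrAC subrr add0r.
  have := h4 _ hh; rewrite ltr_norml x0y0 => /andP[_]; rewrite /c0' /eta; lra.
pose m := c / 4 * r ^+ 2.
have m0 : 0 < m by rewrite mulr_gt0 ?divr_gt0 // exprn_gt0.
pose dl := Num.min eta m.
have dl0 : 0 < dl by rewrite lt_min eta0.
have dle : dl <= eta /\ dl <= m by rewrite /dl !ge_min !lexx orbT.
have key x : uT x <= c0' - dl + Lam T (x - y0).
  have [xr|rx] := leP `|x - x0| r.
    by have := near_obs _ xr; rewrite [x0 + (x - x0)]addrC subrK; lra.
  pose s := `|x - x0| / r; pose k := s^-1 *: (x - x0).
  have s1 : 1 <= s by rewrite /s ler_pdivlMr // mul1r ltW.
  have s0 : 0 < s by exact: lt_le_trans s1.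
  have kr : `|k| = r.
    rewrite /k normrZ gtr0_norm ?invr_gt0 // /s invfM invrK.
    by field; rewrite gt_eqF // (lt_trans r0).
  have xE : x = x0 + s *: k.
    by rewrite /k scalerA divff ?gt_eqF // scale1r addrC subrK.
  have kr' : `|k| <= r by rewrite kr.
  have gap := near_gap _ kr'.
  have kk : c / 4 * dot k k >= m.
    by rewrite /m ler_pM2l ?divr_gt0 // -kr norm_sq_le_dot.
  (* The paraboloid attaining [us] at [x0 + k] is not below the one of slope [p] at [x0], but is
     below it by [m] at [x0 + k]. Their difference has dropped along the ray, and [obs_ray] keeps it
     down as far as [x]. *)
  have [y1 [c1 [uc ule]]] := envelope_attained (x0 + k).
  have := ule x0; have := ule x; have := envelope_ge x.
  have := obs_ray OS (x0 := x0) (d := k) (y0 := y0) (y1 := y1) s1.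
  rewrite /= -xE => ray l1 l2 l3.
  have us0 : us x0 = c0' + Lam T (x0 - y0) by rewrite /c0' x0y0 subrK.
  have D1 : Lam T (x0 + k - y1) - Lam T (x0 + k - y0) < Lam T (x0 - y1) - Lam T (x0 - y0).
    by move: gap uc us0 l3 kk m0; lra.
  have := ray D1; move: gap uc l1 l2 kk (dle.2); lra.
have := envelope_le key x0; rewrite x0y0 /c0'; lra.
Qed.

(* Comparison with the slightly flatter paraboloid of parameter T + tau. *)
Lemma subsolution_le_paraboloid v y (c : R) : lipschitz v ->
  obstacle_subsolution G uT v -> (forall x, uT x <= c + Lam T (x - y)) ->
  forall x, v x <= c + Lam T (x - y).
Proof.
move=> v_lip [_ vsub] hc x'; rewrite leNgt; apply/negP => gtx.
have [Cv Cv0 hv] := (lipschitzP _).1 v_lip.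
have [|C C0 hC] := lagrangian_superlinear hamH (M := Cv + 1); first by lra.
pose m := v x' - (c + Lam T (x' - y)).
have m0 : 0 < m by rewrite subr_gt0.
(* [rho], [K] and [N] bound the distance of the later maximizer from [y], the slope of the original
   paraboloid there and the values of [H] and [L] that occur. They hold for all [tau <= T], so [tau]
   can be chosen after them. *)
pose rho := `|v y - c + 2 * T * C| .
have [K K0 hK] := legendre_bounded hamH (rho / T).
have [||pm _ hpm] := @EVT_max_rV R n H _ _ (@ball_compact R n K).
- by exists 0; rewrite /= normr0.
- by apply: continuous_subspaceT => z; exact: ham_cts.
pose N := `|L 0| + `|H pm| + 1.
have N0 : 0 < N by rewrite ltr_wpDl // addr_ge0.
(* Each of the two errors due to flattening, [tau * L 0] and [tau * H pm], is at most [m / 4]. *)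
pose tau := Num.min T (m / (4 * N)).
have tau0 : 0 < tau by rewrite lt_min T0 divr_gt0 // mulr_gt0.
have tauT : tau <= T by rewrite /tau ge_min lexx.
have tauN : tau * N <= m / 4.
  have -> : m / 4 = m / (4 * N) * N by field; rewrite gt_eqF.
  by rewrite ler_pM2r // /tau ge_min lexx orbT.
have tauL : tau * L 0 <= m / 4.
  apply: le_trans tauN; rewrite ler_pM2l // /N.
  have := ler_norm (L 0); have := normr_ge0 (H pm); lra.
have tauH : tau * H pm <= m / 4.
  apply: le_trans tauN; rewrite ler_pM2l // /N.
  have := ler_norm (H pm); have := normr_ge0 (L 0); lra.
pose t := T + tau; have t0 : 0 < t by rewrite addr_gt0.
have fle w : v (y + w) - (c + Lam t w) <= v y - c + 2 * T * C - `|w|.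
  have := hC t w t0; have := hv (y + w) y.
  rewrite [y + w - y]addrAC subrr add0r ler_norml => /andP[_ k1] k2.
  have : t * C <= 2 * T * C by rewrite ler_wpM2r // /t; lra.
  by move: k1 k2; rewrite mulrDl mul1r; lra.
have [||w hw] := @coercive_max R n (fun w => v (y + w) - (c + Lam t w))
    (v y - c + 2 * T * C - (v y - (c + Lam t 0))).
- move=> w; apply: (@continuousB _ _ _ (fun w => v (y + w)) (fun w => c + Lam t w)).
    apply: (@continuous_comp _ _ _ (fun w : V => y + w) v); last exact: lip_cts.
    by apply: (@continuousD _ _ _ (cst y) id); [exact: cst_continuous | exact: cvg_id].
  apply: (@continuousD _ _ _ (cst c) (Lam t)); first exact: cst_continuous.
  exact: lagrangian_cts.
- by move=> w hw; rewrite addr0; have := fle w; lra.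
have L0E : Lam tau 0 = tau * L 0 by rewrite /lagrangian scaler0.
(* By subadditivity, waiting at rest for the extra time [tau] raises the paraboloid by at most
   [tau * L 0]. *)
have big : m - m / 4 <= v (y + w) - (c + Lam t w).
  have := hw (x' - y); rewrite [y + (x' - y)]addrC subrK.
  have := lagrangian_subadd hamH (x' - y) 0 T0 tau0; rewrite addr0 L0E -/t.
  by have mE : m = v x' - (c + Lam T (x' - y)) by []; move: tauL mE; lra.
have [p gp zp] := lagrangian_slope w t0.
have wrho : `|w| <= rho.
  by have := fle w; rewrite /rho; have := ler_norm (v y - c + 2 * T * C); lra.
(* Conversely, flattening lowers the paraboloid at [y + w] by at most [tau * H p1]; so [v] is still
   above [uT] there and only the Hessian alternative remains. *)
have touch_uT : uT (y + w) < v (y + w).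
  have [p1 E1 g1] := lagrangian_attained hamH w T0.
  have p1K : `|p1| <= K.
    apply: (hK p1 (T^-1 *: w)).
      by rewrite normrZ gtr0_norm ?invr_gt0 // mulrC ler_pM2r ?invr_gt0.
    by rewrite -g1 legendre_grad.
  have := hpm p1; rewrite inE => /(_ p1K) => Hp.
  have Hp' : tau * H p1 <= tau * H pm by rewrite ler_pM2l.
  have := hc (y + w); rewrite [y + w - y]addrAC subrr add0r E1.
  have := lagrangian_ge hamH w p1 t0; rewrite /t mulrDl; lra.
have [cB cB0 hB] := obs_pos OS p.
(* The gap [(T^-1 - t^-1) * cB] equals [4 * e]: [2 * e] pays for the Taylor error in the test
   Hessian and [2 * e] gives strictness. *)
pose e := (T^-1 - t^-1) * cB / 4.
have Tt : 0 < T^-1 - t^-1.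
  by rewrite subr_gt0 ltf_pV2 // /t ltrDl.
have e0 : 0 < e by rewrite divr_gt0 // mulr_gt0.
pose X := t^-1 *: B p + (2 * e)%:M.
have sX : X^T = X by rewrite /X linearD /= linearZ /= tr_scalar_mx (obs_sym OS).
have qX h : qf X h = qf (B p) h / t + 2 * e * dot h h.
  by rewrite /X qfD qfZ qfsc mulrC.
have Gpos : 0 < G p X.
  apply/(obs_gt0 OS) => //; exists (2 * e); first by rewrite mulr_gt0.
  move=> h; rewrite qX; have := hB h; rewrite -(ler_pM2l Tt) /e; lra.
have [d d0 hd] := lagrangian_taylor p t0 e0; rewrite -zp in hd.
pose phi := quad (y + w) (v (y + w)) p X.
have lmax : local_max (fun x => v x - phi x) (y + w).
  apply/near_normP; exists d => // x xd.
  have := hd _ xd; rewrite ler_norml => /andP[_ k1].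
  have := hw (x - y); rewrite [y + (x - y)]addrC subrK.
  have -> : x - y = w + (x - (y + w)) by apply/rowP => i; rewrite !mxE; ring.
  rewrite /phi quad0 /quad qX => k2.
  have tq h : qf (B p) h / t / 2 = qf (B p) h / (2 * t) by field; rewrite gt_eqF.
  by move: k1; rewrite -tq; lra.
have phiE : v (y + w) = phi (y + w) by rewrite /phi quad0.
have := vsub phi (twice_differentiable_quad _ _ _ sX) _ lmax phiE.
rewrite -phiE /phi hessian_quad // grad_quad // subrr mul0mx addr0.
by case; [lra | rewrite leNgt Gpos].
Qed.

Lemma subsolution_le_envelope v : lipschitz v -> obstacle_subsolution G uT v ->
  forall x, v x <= us x.
Proof.
move=> v_lip vsub x; have [y [c [-> ule]]] := envelope_attained x.
apply: subsolution_le_paraboloid => // x'.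
by apply: le_trans (ule x'); exact: envelope_ge.
Qed.

Lemma dense_le (f1 f2 : V -> R) : lipschitz f1 -> lipschitz f2 ->
  (forall x0 (r : R), 0 < r -> exists x1, `|x1 - x0| < r /\ f1 x1 <= f2 x1) ->
  forall x, f1 x <= f2 x.
Proof.
move=> /lipschitzP[C1 C10 h1] /lipschitzP[C2 C20 h2] hd x.
apply/ler_addgt0Pr => e e0; have C0 : 0 < C1 + C2 + 1 by lra.
have [x1 [xr le1]] := hd x _ (divr_gt0 e0 C0).
move: xr; rewrite ltr_pdivlMr // => xr.
have := h1 x x1; have := h2 x1 x.
rewrite [`|x - x1|]distrC !ler_norml => /andP[_ k2] /andP[_ k1].
have := normr_ge0 (x1 - x); lra.
Qed.

(** The definition compares [v] with [uT] only where a test function touches from below; such points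
    are dense and both functions are continuous. *)
Lemma supersolution_ge_obstacle v : lipschitz v -> obstacle_supersolution G uT v ->
  forall x, uT x <= v x.
Proof.
move=> v_lip [_ vsup]; apply: dense_le => // x0 r r0.
have [x1 [p [k [x1r k0 hx]]]] := touched_below x0 v_lip r0.
exists x1; split => //.
pose X : 'M[R]_n := (- (2 * k))%:M.
have sX : X^T = X by rewrite /X tr_scalar_mx.
pose phi := quad x1 (v x1) p X.
have lmin : local_min (fun x => v x - phi x) x1.
  apply/near_normP; exists 1 => // x _.
  by have := hx x; rewrite /phi quad0 /quad /X qfsc; lra.
have phiE : v x1 = phi x1 by rewrite /phi quad0.
have [] := vsup phi (twice_differentiable_quad _ _ _ sX) _ lmin phiE.
by rewrite -phiE; lra.
Qed.

(** This is the rise from [x1] to [x1 + d] of the paraboloid of parameter [T - e] with initial slope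
    [p1 + e *: d]. Its continuity preserves a strict inequality known at [e = 0]. *)
Lemma perturbed_gap_cts p1 d : {for 0, continuous (fun e : R =>
  (T - e) * (L ((T - e)^-1 *: d + grad H (p1 + e *: d)) - L (grad H (p1 + e *: d))))}.
Proof.
have cT : {for (0 : R), continuous (fun e : R => T - e)}.
  by apply: (@continuousB _ _ _ (cst T) id); [exact: cst_continuous | exact: cvg_id].
have cQ : {for (0 : R), continuous (fun e : R => grad H (p1 + e *: d))}.
  apply: (@continuous_comp _ _ _ (fun e : R => p1 + e *: d) (grad H)); last exact: ham_grad_cts.
  apply: (@continuousD _ _ _ (cst p1) (fun e : R => e *: d)); first exact: cst_continuous.
  exact: scalel_continuous.
apply: (@continuousM _ _ (fun e : R => T - e) (fun e : R => L ((T - e)^-1 *: d +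
  grad H (p1 + e *: d)) - L (grad H (p1 + e *: d)))); first exact: cT.
apply: (@continuousB _ _ _ (fun e : R => L ((T - e)^-1 *: d + grad H (p1 + e *: d)))
  (fun e : R => L (grad H (p1 + e *: d)))); last first.
  apply: (@continuous_comp _ _ _ (fun e : R => grad H (p1 + e *: d)) L); first exact: cQ.
  exact: legendre_cts.
apply: (@continuous_comp _ _ _ (fun e : R => (T - e)^-1 *: d + grad H (p1 + e *: d)) L);
  last exact: legendre_cts.
apply: (@continuousD _ _ _ (fun e : R => (T - e)^-1 *: d) (fun e : R => grad H (p1 + e *: d)));
  last exact: cQ.
apply: (@continuous_comp _ _ _ (fun e : R => (T - e)^-1) (fun e : R => e *: d));
  last exact: scalel_continuous.
by apply: (@continuousV _ _ (fun e : R => T - e)); [rewrite subr0 gt_eqF | exact: cT].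
Qed.

(* Where v is touched from above with slope p1, the paraboloid with the same
   slope dominates v. Otherwise, on the segment towards a point where it does
   not, v dips below a steeper paraboloid of parameter T - e before rising
   above it, and is touched from below in between. *)
Lemma supersolution_le_paraboloid v x1 p1 (k : R) : lipschitz v ->
  obstacle_supersolution G uT v -> 0 < k ->
  (forall x, v x <= v x1 + dot p1 (x - x1) + k * dot (x - x1) (x - x1)) ->
  forall x, v x <= v x1 + Lam T (x - x1 + T *: grad H p1) - Lam T (T *: grad H p1).
Proof.
move=> v_lip [_ vsup] k0 hx x2; rewrite leNgt; apply/negP => gt2.
pose d := x2 - x1.
have d0 : d != 0.
  apply: contraTneq gt2; rewrite /d => E; rewrite E add0r.
  by move/eqP: E; rewrite subr_eq0 => /eqP ->; rewrite -leNgt addrK.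
have dd := dot_self_gt0 d0.
have LamE t q : 0 < t -> Lam t (d + t *: q) - Lam t (t *: q) =
    t * (L (t^-1 *: d + q) - L q).
  move=> t0; rewrite lagrangian_scale // mulrBr /lagrangian scalerDr scalerA.
  by rewrite mulVf ?gt_eqF // scale1r.
pose A (e : R) := (T - e) * (L ((T - e)^-1 *: d + grad H (p1 + e *: d))
  - L (grad H (p1 + e *: d))).
have A0 : 0 < v x2 - v x1 - A 0.
  have := LamE T (grad H p1) T0; move: gt2; rewrite -/d /A scale0r addr0 subr0; lra.
have [e1 e10 h1] := (cts_normP _ _).1 (@perturbed_gap_cts p1 d) _ A0.
pose e := Num.min T e1 / 2.
have me0 : 0 < Num.min T e1 by rewrite lt_min T0.
have e0 : 0 < e by rewrite divr_gt0.
have : e < Num.min T e1 by rewrite /e ltr_pdivrMr //; lra.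
rewrite lt_min => /andP[eT ee1].
have Ae : A e < v x2 - v x1.
  have := h1 e; rewrite subr0 gtr0_norm // -/(A e) -/(A 0) => /(_ ee1).
  by rewrite ltr_norml => /andP[_]; lra.
pose t := T - e; have t0 : 0 < t by rewrite subr_gt0.
(* The tilt by [e *: d] makes the paraboloid [f0] rise above [v] at the start of the segment. *)
pose p := p1 + e *: d; pose q := grad H p.
pose f0 x := v x1 + Lam t (x - x1 + t *: q) - Lam t (t *: q).
have cf0 : continuous f0.
  move=> x; apply: (@continuousB _ _ _ (fun x => v x1 + Lam t (x - x1 + t *: q))
    (cst (Lam t (t *: q)))); last exact: cst_continuous.
  apply: (@continuousD _ _ _ (cst (v x1)) (fun x => Lam t (x - x1 + t *: q)));
    first exact: cst_continuous.
  apply: (@continuous_comp _ _ _ (fun x : V => x - x1 + t *: q) (Lam t));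
    last exact: lagrangian_cts.
  apply: (@continuousD _ _ _ (fun x => x - x1) (cst (t *: q))); last exact: cst_continuous.
  by apply: (@continuousB _ _ _ id (cst x1)); [exact: cvg_id | exact: cst_continuous].
pose g x := v x - f0 x.
have cg : continuous g.
  by move=> x; apply: (@continuousB _ _ _ v f0); [exact: lip_cts | exact: cf0].
have g1 : 0 <= g x1 by rewrite /g /f0 subrr add0r addrK subrr.
have g2 : 0 <= g (x1 + d).
  rewrite /g /f0 [x1 + d - x1]addrAC subrr add0r -addrA LamE // -/t -/p -/q.
  by rewrite /d [x1 + _]addrC subrK -/d ltW //; move: Ae; rewrite /A -/t -/p -/q; lra.
have f0_ge x : v x1 + dot p (x - x1) <= f0 x.
  have Lq : Lam t (t *: q) = t * (dot p q - H p).
    by rewrite lagrangian_scale // /q legendre_grad.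
  have := lagrangian_ge hamH (x - x1 + t *: q) p t0.
  rewrite /f0 Lq dotDr dotZr; move: (Lam _ _) (dot p _) (dot p q) (H p).
  by move=> *; lra.
(* At [x1 + s *: d] the tilt gains [s * e * dot d d], while the upper bound on [v] gains
   [k * s ^+ 2 * dot d d]; [k * s < e] makes the first one win. *)
pose s := Num.min 1 (e / k) / 2.
have ms0 : 0 < Num.min 1 (e / k) by rewrite lt_min ltr01 divr_gt0.
have s0 : 0 < s by rewrite divr_gt0.
have : s < Num.min 1 (e / k) by rewrite /s ltr_pdivrMr //; lra.
rewrite lt_min ltr_pdivlMr // => /andP[s1 sk].
have gs : g (x1 + s *: d) < 0.
  have := hx (x1 + s *: d); have := f0_ge (x1 + s *: d).
  rewrite [x1 + _ - x1]addrAC subrr add0r /p dotDl !dotZr !dotZl => k1 k2.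
  have : s * dot d d * (s * k - e) < 0 by rewrite pmulr_rlt0 ?mulr_gt0 // subr_lt0.
  by rewrite /g; move: (f0 _) (v _) k1 k2 => *; lra.
have s01 : 0 < s < 1 by rewrite s0.
have [K [xm lm]] := @cylinder_min R n g x1 d s cg d0 g1 g2 s01 gs.
have [d1 d10 hmin] := (local_minP _ _).1 lm.
pose P := transverse d; have sP : P^T = P := transverse_sym d.
have [pm gpm zpm] := lagrangian_slope (xm - x1 + t *: q) t0.
have [cB cB0 hB] := obs_pos OS pm.
have Tt : 0 < t^-1 - T^-1 by rewrite subr_gt0 ltf_pV2 // /t gtrDl oppr_lt0.
pose e2 := (t^-1 - T^-1) * cB / 4.
have e20 : 0 < e2 by rewrite divr_gt0 // mulr_gt0.
have [d2 d20 h2] := lagrangian_taylor pm t0 e20; rewrite -zpm in h2.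
(* The gradient of the penalty, moved to the test function; it is orthogonal to [d]. *)
pose w := (- (2 * K)) *: ((xm - x1) *m P).
have wd : dot w d = 0.
  by rewrite /w dotZl dot_mulmxC sP mul_transverse // dot0r mulr0.
pose X := t^-1 *: B pm + (- (2 * e2))%:M + (- (2 * K)) *: P.
have sX : X^T = X := trmx_combination _ _ _ (obs_sym OS pm) sP.
have qX h : qf X h = qf (B pm) h / t - 2 * e2 * dot h h - 2 * K * qf P h.
  by rewrite /X qfD qfD qfZ qfZ qfsc; ring.
pose phi := quad xm (v xm) (pm + w) X.
have lmin : local_min (fun x => v x - phi x) xm.
  apply/local_minP; exists (Num.min d1 d2); first by rewrite lt_min d10.
  move=> h; rewrite lt_min => /andP[/hmin k1 /h2].
  rewrite ler_norml => /andP[k2 _].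
  have E1 : xm + h - x1 + t *: q = xm - x1 + t *: q + h.
    by apply/rowP => i; rewrite !mxE; ring.
  have E2 : xm + h - x1 = xm - x1 + h by apply/rowP => i; rewrite !mxE; ring.
  move: k1 k2; rewrite /g /f0 -/P E1 E2 (qfDv (xm - x1) h sP) /phi quad0 /quad.
  rewrite [xm + h - xm]addrAC (subrr xm) (add0r h) qX dotDl /w dotZl.
  have tq : qf (B pm) h / t / 2 = qf (B pm) h / (2 * t) by field; rewrite gt_eqF.
  rewrite -tq; move: (Lam _ _) (Lam _ _) (Lam _ _) (v _) (v _) (v _) => *.
  lra.
have phiE : v xm = phi xm by rewrite /phi quad0.
have [_] := vsup phi (twice_differentiable_quad _ _ _ sX) _ lmin phiE.
rewrite /phi hessian_quad // grad_quad // subrr mul0mx addr0.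
(* Along [d] the penalty has no curvature and [B] ignores the shift [w], so the steeper factor
   [t^-1] contradicts the bound with [T^-1]. *)
move/(obs_ge0 OS _ sX)/(_ d).
have qP : qf P d = 0 by rewrite qfE mul_transverse // dot0l.
rewrite qX (obs_transverse OS pm d0 wd) qP mulr0 subr0.
have := hB d; rewrite -(ler_pM2l Tt) => k1 k2.
have k3 : 0 < (t^-1 - T^-1) * (cB * dot d d) by rewrite !mulr_gt0.
by move: k1 k2; rewrite /e2; lra.
Qed.

Lemma envelope_le_supersolution v : lipschitz v -> obstacle_supersolution G uT v ->
  forall x, us x <= v x.
Proof.
move=> v_lip vsup; apply: dense_le => //; first exact: envelope_lipschitz.
move=> x0 r r0; have [x1 [p [k [x1r k0 hx]]]] := touched_above x0 v_lip r0.
exists x1; split => //; pose y := x1 - T *: grad H p.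
have dom := supersolution_le_paraboloid v_lip vsup k0 hx.
have yE x : x - y = x - x1 + T *: grad H p by rewrite /y opprB addrCA addrC.
have := @envelope_le y (v x1 - Lam T (T *: grad H p)) _ x1.
rewrite yE subrr add0r subrK; apply => x; rewrite yE.
by have := dom x; have := supersolution_ge_obstacle v_lip vsup x; lra.
Qed.

Lemma envelope_unique_solution : unique_obstacle_solution G uT us.
Proof.
split.
  split; first exact: envelope_lipschitz.
  split; first by apply/lip_cts/envelope_lipschitz.
    exact: envelope_subsolution.
  exact: envelope_supersolution.
move=> v [v_lip [_ vsub vsup]]; apply/funext => x; apply/eqP; rewrite eq_le.
by rewrite envelope_le_supersolution // subsolution_le_envelope.
Qed.

End obstacle_problem.

(** * Quadratic and one-dimensional Hamiltonians *)

Section quadratic_hamiltonian.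
Context {R : realType} {n : nat}.
Local Notation V := 'rV[R]_n.
Implicit Types (p q x y h d : V).
Variables (T : R) (A : 'M[R]_n).
Hypotheses (T0 : 0 < T) (n0 : (0 < n)%N) (sA : A^T = A).
Hypothesis pA : forall p, p != 0 -> 0 < qf A p.

Let H p : R := qf A p / 2.

Lemma quadE : H = quad 0 0 0 A.
Proof. by apply/funext => p; rewrite /quad subr0 dot0l !add0r. Qed.

Lemma grad_quadratic p : grad H p = p *m A.
Proof. by rewrite quadE grad_quad // subr0 add0r. Qed.

Lemma hamiltonian_quadratic : hamiltonian H.
Proof.
split.
- by move=> p; rewrite quadE; have := quad_is_diff 0 0 0 p sA.
- move=> p; apply: differentiable_continuous; rewrite quadE.
  by have := grad_quad_is_diff 0 0 0 p sA.
- move=> p p'; have -> : H p' = qf A (p + (p' - p)) / 2 by rewrite [p + _]addrC subrK.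
  rewrite grad_quadratic /H (qfDv p _ sA).
  have : 0 <= qf A (p' - p).
    by have [->|/pA/ltW//] := eqVneq (p' - p) 0; rewrite qf0.
  by lra.
- have [c c0 hc] := posdef_coercive n0 sA pA => M.
  exists (2 * `|M| / c) => p; rewrite ltr_pdivrMr // => hp.
  have h1 : c * `|p| ^+ 2 <= qf A p.
    by apply: le_trans (hc p); rewrite ler_pM2l // norm_sq_le_dot.
  have h2 : 2 * `|M| * `|p| <= `|p| * c * `|p| by rewrite ler_wpM2r // ltW.
  have h3 : M * `|p| <= `|M| * `|p| by rewrite ler_wpM2r // ler_norm.
  have h4 : `|p| * c * `|p| = c * `|p| ^+ 2 by ring.
  by rewrite /H; lra.
Qed.

Lemma posdef_unitmx : A \in unitmx.
Proof.
rewrite -row_free_unit -kermx_eq0; apply: contraT => /rowV0Pn[v /sub_kermxP vA /pA].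
by rewrite qfE vA dot0l ltxx.
Qed.

Lemma invmx_sym : (invmx A)^T = invmx A.
Proof. by rewrite trmx_inv sA. Qed.

Lemma legendre_quadratic q : legendre H q = qf (invmx A) q / 2.
Proof.
have uA := posdef_unitmx.
have E : q = grad H (q *m invmx A) by rewrite grad_quadratic mulmxKV.
rewrite {1}E (legendre_grad hamiltonian_quadratic) -E /H !qfE mulmxKV //.
by rewrite (dotC q); field.
Qed.

Lemma lagrangian_quadratic z : lagrangian H T z = qf (invmx A) z / (2 * T).
Proof.
rewrite /lagrangian legendre_quadratic qfZv; field.
by rewrite gt_eqF.
Qed.

Lemma quadratic_obstacle_structure :
  obstacle_structure H T (fun=> invmx A)
    (fun p X => - lambda_max (X - T^-1 *: invmx A)).
Proof.
have uA := posdef_unitmx; have sI := invmx_sym.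
have sM X : X^T = X -> (X - T^-1 *: invmx A)^T = X - T^-1 *: invmx A.
  by move=> sX; rewrite linearB /= linearZ /= sX sI.
have qM X h : qf (X - T^-1 *: invmx A) h = qf X h - qf (invmx A) h / T.
  by rewrite qfB qfZ mulrC.
split.
- exact: hamiltonian_quadratic.
- by [].
- move=> _; apply: posdef_coercive => // h h0.
  have k0 : h *m invmx A != 0.
    by apply: contra h0 => /eqP E; rewrite -(mulmxKV uA h) E mul0mx.
  by have := pA k0; rewrite !qfE mulmxKV // dotC.
- move=> p e e0; exists 1 => // h _; rewrite !legendre_quadratic (qfDv _ _ sI).
  rewrite grad_quadratic mulmxK //.
  have -> : (qf (invmx A) (p *m A) + 2 * dot p h + qf (invmx A) h) / 2 -
    qf (invmx A) (p *m A) / 2 - dot p h - qf (invmx A) h / 2 = 0 by field.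
  by rewrite normr0 mulr_ge0 ?dot_ge0 // ltW.
- move=> _ X sX; have [eig hl] := lambda_max_eigen n0 (sM X sX).
  rewrite oppr_ge0; split=> [l0 h|hX].
    have := hl h; rewrite qM; have : lambda_max (X - T^-1 *: invmx A) * dot h h <= 0.
      by rewrite mulr_le0_ge0 // dot_ge0.
    by lra.
  by apply: eigenvalue_le eig _ => h; rewrite qM mul0r subr_le0.
- move=> _ X sX; have [eig hl] := lambda_max_eigen n0 (sM X sX).
  rewrite oppr_gt0; split=> [l0|[c c0 hX]].
    exists (- lambda_max (X - T^-1 *: invmx A)); first by rewrite oppr_gt0.
    by move=> h; have := hl h; rewrite qM; lra.
  apply: (@le_lt_trans _ _ (- c)); last by rewrite oppr_lt0.
  by apply: eigenvalue_le eig _ => h; rewrite qM; have := hX h; lra.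
- by [].
- move=> x0 d y0 y1 s s1 D.
  (* Both actions have the same quadratic part, so their difference is affine along the ray, with
     slope [b]. *)
  pose b := dot ((y0 - y1) *m invmx A) d / T.
  have DE (t : R) : D (x0 + t *: d) = D x0 + t * b.
    rewrite /D !lagrangian_quadratic.
    have e1 : x0 + t *: d - y1 = x0 - y1 + t *: d by rewrite addrAC.
    have e0 : x0 + t *: d - y0 = x0 - y0 + t *: d by rewrite addrAC.
    rewrite e1 e0 (qfDv (x0 - y1) _ sI) (qfDv (x0 - y0) _ sI) !dotZr /b.
    have -> : y0 - y1 = (x0 - y1) - (x0 - y0) by apply/rowP => i; rewrite !mxE; ring.
    move: (x0 - y1) (x0 - y0) => u1 u0; rewrite mulmxBl dotBl; field.
    by rewrite gt_eqF.
  have D1 : D (x0 + d) = D x0 + b by have := DE 1; rewrite scale1r mul1r.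
  rewrite D1 DE gtrDl lerD2l => b0.
  by rewrite ger_nMl.
Qed.

End quadratic_hamiltonian.

Lemma grad_coord (R : realType) n (f : 'rV[R]_n -> R) x i : grad f x 0 i = 'D_('e_i) f x.
Proof. by rewrite /grad mxE. Qed.

Lemma hessian_coord (R : realType) n (f : 'rV[R]_n -> R) x i j :
  hessian f x i j = 'D_('e_j) ('D_('e_i) f) x.
Proof. by rewrite /hessian mxE. Qed.

(** * The one-dimensional case *)

Section one_dimensional.
Context {R : realType}.
Local Notation V := 'rV[R]_1.
Implicit Types (p q x y z h k d : V) (X : 'M[R]_1).

Lemma dot11 x y : dot x y = x 0 0 * y 0 0.
Proof. by rewrite dotE big_ord1. Qed.

Lemma norm11 x : `|x| ^+ 2 = dot x x.
Proof.
apply/eqP; rewrite eq_le norm_sq_le_dot /= dot11 -expr2 -[X in X <= _]real_normK ?num_real //.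
by rewrite ler_pXn2r ?nnegrE // ler_coord.
Qed.

Lemma qf11 X h : qf X h = X 0 0 * dot h h.
Proof. by rewrite [X in qf X]mx11_scalar qfsc. Qed.

(** The maximizers of the two terms on the left are competitors for the two on the right, in either
    assignment. As [a] and [b] do not point in opposite directions, the order of [p] and [p'] makes
    one of the assignments work. *)
Lemma lagrangian_supermodular (H : V -> R) (t : R) z a b : hamiltonian H ->
  0 < t -> 0 <= dot a b ->
  lagrangian H t (z + a) + lagrangian H t (z + b) <=
  lagrangian H t z + lagrangian H t (z + a + b).
Proof.
move=> hamH t0 ab.
have [p E _] := lagrangian_attained hamH (z + a) t0.
have [p' E' _] := lagrangian_attained hamH (z + b) t0.
have l1 := lagrangian_ge hamH z p t0; have l2 := lagrangian_ge hamH (z + a + b) p' t0.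
have l3 := lagrangian_ge hamH z p' t0; have l4 := lagrangian_ge hamH (z + a + b) p t0.
rewrite E E'; move: l1 l2 l3 l4.
rewrite !dotDr; move: (lagrangian _ _ _) (lagrangian _ _ _) (H p) (H p') => u v Hp Hp'.
have [|] : 0 <= dot p' a - dot p a \/ 0 <= dot p b - dot p' b; last 2 first.
- by move=> *; lra.
- by move=> *; lra.
rewrite -dotBl -dotBl !dot11 !mxE; move: ab; rewrite dot11.
move: (a 0 0) (b 0 0) (p 0 0) (p' 0 0) => a' b' r r' ab.
have [rr|/ltW rr] := leP r r'.
  have [a0|a0] := leP 0 a'; first by left; rewrite mulr_ge0 // subr_ge0.
  right; rewrite mulr_le0 // ?subr_le0 //.
  by rewrite leNgt; apply/negP => b0; move: ab; rewrite leNgt nmulr_rlt0 // b0.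
have [a0|a0] := leP a' 0; first by left; rewrite mulr_le0 // subr_le0.
by right; rewrite mulr_ge0 // ?subr_ge0 //; move: ab; rewrite pmulr_rge0.
Qed.

Variables (T : R) (H : V -> R).
Hypotheses (T0 : 0 < T) (H2 : Ck 2 H) (H_gt0 : forall p, 0 < hessian H p 0 0).
Hypothesis H_superlinear :
  forall M : R, exists K : R, forall p, K < `|p| -> M < H p / `|p|.

Let a p := hessian H p 0 0.

Lemma twice_differentiable_1d : twice_differentiable H.
Proof.
case: H2 => dH dDH; split => // x.
have -> : grad H = fun p => 'D_('e_0) H p *: ('e_0 : V).
  by apply/funext => p; apply/rowP => i; rewrite !ord1 !mxE eqxx mulr1.
apply: differentiableZl; exact: (dDH 'e_0).1.
Qed.

Lemma grad_monotone_1d x k : 0 <= dot (grad H (x + k) - grad H x) k.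
Proof.
case: H2 => dH dDH.
have [c _] := line_MVT x k ltr01 (dDH 'e_0).1.
rewrite scale1r mul1r => E.
rewrite dot11; have -> : (grad H (x + k) - grad H x) 0 0 = 'D_('e_0) H (x + k) - 'D_('e_0) H x.
  by rewrite [LHS]mxE [X in _ + X]mxE !grad_coord.
rewrite E dot11 (grad_coord ('D_('e_0) H)) -mulrA -expr2.
rewrite mulr_ge0 ?sqr_ge0 //; have := ltW (H_gt0 (x + c *: k)).
by rewrite (hessian_coord H).
Qed.

Lemma hamiltonian_1d : hamiltonian H.
Proof.
have [dH dG] := twice_differentiable_1d.
split => //.
- by move=> p; exact: differentiable_continuous.
- move=> p p'; have [c /andP[c0 c1] E] := line_MVT p (p' - p) ltr01 dH.
  move: E; rewrite scale1r mul1r [p + (p' - p)]addrC subrK => E.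
  have := grad_monotone_1d p (c *: (p' - p)).
  by rewrite dotZr dotBl pmulr_rge0 // => h; lra.
- move=> M; have [K hK] := H_superlinear M; exists (Num.max K 0) => p.
  rewrite gt_max => /andP[/hK h p0]; move: h; rewrite ltr_pdivlMr // => /ltW.
  exact.
Qed.

(* Taylor expansion of H at p0 gives, by duality, that of its conjugate; the
   convexity of H makes the bound global in the maximization variable. *)
Lemma legendre_taylor_1d p0 (e : R) : 0 < e -> exists2 d : R, 0 < d & forall h,
  `|h| < d -> `|legendre H (grad H p0 + h) - legendre H (grad H p0) - dot p0 h
    - (a p0)^-1 * dot h h / 2| <= e * dot h h.
Proof.
move=> e0; have hamH := hamiltonian_1d; have a0 : 0 < a p0 by exact: H_gt0.
set q0 := grad H p0; set b := a p0 in a0 *.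
(* The first bound keeps [b - eta] at least [b / 2]; the second then keeps the halved inverses of
   [b - eta] and [b + eta] within [e] of that of [b]. *)
pose eta := Num.min (b / 2) (e * b ^+ 2).
have b2 : 0 < b ^+ 2 by rewrite exprn_gt0.
have eta0 : 0 < eta by rewrite lt_min divr_gt0 // mulr_gt0.
have [eta1 eta2] : eta <= b / 2 /\ eta <= e * b ^+ 2 by rewrite /eta !ge_min !lexx orbT.
clearbody eta.
have be0 : 0 < b - eta by lra.
have be1 : 0 < b + eta by lra.
have up : (b - eta)^-1 / 2 <= b^-1 / 2 + e.
  have -> : b^-1 / 2 + e = (1 + 2 * b * e) / b / 2 by field; rewrite gt_eqF.
  rewrite ler_pM2r ?invr_gt0 // ler_pdivlMr // ler_pdivrMl //; nra.
have lo : b^-1 / 2 - e <= (b + eta)^-1 / 2.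
  have -> : b^-1 / 2 - e = (1 - 2 * b * e) / b / 2 by field; rewrite gt_eqF.
  rewrite ler_pM2r ?invr_gt0 // ler_pdivrMr // ler_pdivlMl //; nra.
have eta2' : 0 < eta / 2 by rewrite divr_gt0.
have [d0 d00 hd0] := taylor2_dot p0 twice_differentiable_1d eta2'.
have hlo k : `|k| < d0 -> (b - eta) / 2 * dot k k <= H (p0 + k) - H p0 - dot q0 k.
  move=> /hd0; rewrite -/q0 qf11 -/(a p0) -/b ler_norml => /andP[+ _]; lra.
have hup k : `|k| < d0 -> H (p0 + k) - H p0 - dot q0 k <= (b + eta) / 2 * dot k k.
  move=> /hd0; rewrite -/q0 qf11 -/(a p0) -/b ler_norml => /andP[_]; lra.
have Lq0 : legendre H q0 = dot p0 q0 - H p0 by exact: legendre_grad.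
pose r := d0 / 2; have r0 : 0 < r by rewrite divr_gt0.
have rd : r < d0 by rewrite /r ltr_pdivrMr //; lra.
(* The first bound puts the competitor [k] of the lower estimate inside the Taylor ball; the second
   one excludes maximizers outside that ball. *)
pose d := Num.min (d0 * (b + eta)) ((b - eta) * r / 2).
exists d; first by rewrite lt_min mulr_gt0 // divr_gt0 // mulr_gt0.
move=> h; rewrite lt_min => /andP[hh1 hh2].
have lower : dot p0 h + (b + eta)^-1 / 2 * dot h h <=
    legendre H (q0 + h) - legendre H q0.
  (* The maximizer of [dot k h - (b + eta) / 2 * dot k k]. *)
  pose k := (b + eta)^-1 *: h.
  have kd : `|k| < d0.
    by rewrite normrZ gtr0_norm ?invr_gt0 // ltr_pdivrMl // mulrC.
  have := legendre_ge hamH (p0 + k) (q0 + h); have := hup _ kd.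
  have kk : dot k k = (b + eta)^-1 * dot k h by rewrite /k dotZr.
  have kh : dot k h = (b + eta)^-1 * dot h h by rewrite /k dotZl.
  have -> : (b + eta) / 2 * dot k k = dot k h / 2.
    by rewrite kk; field; rewrite gt_eqF.
  rewrite Lq0 !dotDl !dotDr (dotC k q0) kh; lra.
have upper : legendre H (q0 + h) - legendre H q0 <=
    dot p0 h + (b - eta)^-1 / 2 * dot h h.
  have [p E] := legendre_attained hamH (q0 + h).
  rewrite E Lq0; pose k := p - p0; have pE : p = p0 + k by rewrite /k addrC subrK.
  clearbody k.
  suff : dot k h - (H (p0 + k) - H p0 - dot q0 k) <= (b - eta)^-1 / 2 * dot h h.
    by rewrite pE !dotDl !dotDr (dotC k q0); lra.
  have pos : 0 <= (b - eta)^-1 / 2 * dot h h.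
    by rewrite mulr_ge0 ?dot_ge0 // divr_ge0 // invr_ge0 ltW.
  have [kd|kd] := ltP `|k| d0.
    have := hlo _ kd.
    (* Completing the square bounds the quadratic expression for every [k] in the ball. *)
    have : 0 <= dot (h - (b - eta) *: k) (h - (b - eta) *: k) by exact: dot_ge0.
    rewrite dotBl !dotBr !dotZl !dotZr (dotC h k) => sq hk.
    have -> : (b - eta)^-1 / 2 * dot h h = dot h h / (2 * (b - eta)).
      by field; rewrite gt_eqF.
    rewrite ler_pdivlMr ?mulr_gt0 //.
    have := mulr_ge0 (ltW be0) (_ : 0 <= H (p0 + k) - H p0 - dot q0 k - (b - eta) / 2 * dot k k).
    rewrite subr_ge0 => /(_ hk); lra.
  apply: le_trans pos; have k0 : 0 < `|k| by exact: lt_le_trans kd.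
  (* By convexity the growth of [H] above its tangent on the sphere of radius [r] extends at least
     linearly along the ray through [k1]. There it already exceeds [dot k1 h], so such a [k]
     contributes at most 0. *)
  pose s := `|k| / r; pose k1 := s^-1 *: k.
  have s1 : 1 <= s by rewrite /s ler_pdivlMr // mul1r (le_trans _ kd) // ltW.
  have s0 : 0 < s by exact: lt_le_trans s1.
  have k1r : `|k1| = r.
    by rewrite /k1 normrZ gtr0_norm ?invr_gt0 // /s invfM invrK; field; rewrite gt_eqF.
  have kE : k = s *: k1 by rewrite /k1 scalerA divff ?gt_eqF // scale1r.
  clearbody k1 s; have k1d : `|k1| < d0 by rewrite k1r.
  have := hlo _ k1d; rewrite -norm11 k1r => low.
  have c1 := ham_convex hamH (p0 + k1) (p0 + k); have c2 := ham_convex hamH (p0 + k1) p0.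
  have E1 : p0 + k - (p0 + k1) = (s - 1) *: k1.
    by rewrite kE opprD addrACA subrr add0r scalerBl scale1r.
  have E2 : p0 - (p0 + k1) = - k1 by rewrite opprD addNKr.
  rewrite E1 dotZr in c1; rewrite E2 dotNr in c2.
  have c3 : 0 <= (s - 1) * (dot (grad H (p0 + k1)) k1 - (H (p0 + k1) - H p0)).
    by rewrite mulr_ge0 ?subr_ge0 //; lra.
  have kh : dot k1 h <= r * ((b - eta) * r / 2).
    apply: le_trans (ler_norm _) _; apply: le_trans (dot_le_norm _ _) _.
    by rewrite mul1r k1r ler_pM2l // ltW.
  rewrite kE !dotZr dotZl -kE.
  have : s * (dot k1 h - (H (p0 + k1) - H p0 - dot q0 k1)) <= 0.
    by rewrite pmulr_rle0 // subr_le0; apply: le_trans kh _; lra.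
  by move: c1 c3; lra.
have hh0 := dot_ge0 h.
have u2 : (b - eta)^-1 / 2 * dot h h <= (b^-1 / 2 + e) * dot h h by rewrite ler_wpM2r.
have l2 : (b^-1 / 2 - e) * dot h h <= (b + eta)^-1 / 2 * dot h h by rewrite ler_wpM2r.
by rewrite ler_norml; apply/andP; split; lra.
Qed.

Lemma one_dim_obstacle_structure :
  obstacle_structure H T (fun p => (a p)^-1%:M)
    (fun p X => - X 0 0 + (T * hessian H p 0 0)^-1).
Proof.
have hamH := hamiltonian_1d.
have one : dot ('e_0 : V) 'e_0 = 1 by rewrite dot_delta mxE !eqxx.
split.
- exact: hamH.
- by move=> p; rewrite tr_scalar_mx.
- by move=> p; exists (a p)^-1; [rewrite invr_gt0; exact: H_gt0 | move=> h; rewrite qfsc].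
- move=> p e e0; have [d d0 hd] := legendre_taylor_1d p e0.
  by exists d => // h /hd; rewrite qfsc.
- move=> p X _; rewrite addrC subr_ge0 invfM -/(a p); split=> [le h|hX].
    by rewrite qf11 qfsc mulrAC ler_wpM2r ?dot_ge0 // mulrC.
  by have := hX 'e_0; rewrite qf11 qfsc one !mulr1 mulrC.
- move=> p X _; rewrite addrC subr_gt0 invfM -/(a p); split=> [lt|[c c0 hX]].
    exists (T^-1 * (a p)^-1 - X 0 0); first by rewrite subr_gt0.
    by move=> h; rewrite qf11 qfsc; lra.
  by have := hX 'e_0; rewrite qf11 qfsc one !mulr1; lra.
(* In dimension one a vector orthogonal to [d != 0] vanishes. *)
- move=> d p w d0 wd; suff -> : w = 0 by rewrite addr0.
  apply/rowP => i; rewrite !ord1 mxE; move/eqP: wd; rewrite dot11 mulf_eq0.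
  case/orP => /eqP // d00; case/eqP: d0; apply/rowP => j.
  by rewrite !ord1 mxE.
- move=> x0 d y0 y1 s s1 D Dlt.
  pose b := y0 - y1.
  have DE x : D x = lagrangian H T (x - y0 + b) - lagrangian H T (x - y0).
    by rewrite /D /b addrA subrK.
  (* A strict decrease of [D] along [d] forces [b] and [d] to point in opposite directions, since
     otherwise supermodularity makes [D] nondecreasing. *)
  have bd : dot b d < 0.
    rewrite ltNge; apply/negP => bd.
    have := lagrangian_supermodular (x0 - y0) hamH T0 bd.
    have e1 : x0 - y0 + b + d = x0 + d - y0 + b by apply/rowP => i; rewrite !mxE; ring.
    have e2 : x0 - y0 + d = x0 + d - y0 by rewrite addrAC.
    by move: Dlt; rewrite !DE e1 e2; lra.
  (* Supermodularity is now applied backward, from [x0 + s *: d] to [x0 + d], which is a move in the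
     direction of [b]. *)
  have bs : 0 <= dot b (- ((s - 1) *: d)).
    by rewrite dotNr dotZr -mulrN mulr_ge0 ?subr_ge0 // oppr_ge0 ltW.
  have := lagrangian_supermodular (x0 + s *: d - y0) hamH T0 bs.
  have e1 : x0 + s *: d - y0 + b + - ((s - 1) *: d) = x0 + d - y0 + b.
    by apply/rowP => i; rewrite !mxE; ring.
  have e2 : x0 + s *: d - y0 + - ((s - 1) *: d) = x0 + d - y0.
    by apply/rowP => i; rewrite !mxE; ring.
  by rewrite !DE e1 e2; lra.
Qed.

End one_dimensional.

Theorem theorem2p5 (R : realType) (T : R) (T_gt0 : 0 < T) :
  (forall (uT : 'rV[R]_1 -> R) (H : 'rV[R]_1 -> R),
     lipschitz uT ->
     Ck 2 H ->
     (forall p, 0 < hessian H p 0 0) ->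
     (forall M : R, exists K : R, forall p, K < `|p| -> M < H p / `|p|) ->
     unique_obstacle_solution
       (fun p X => - X 0 0 + (T * hessian H p 0 0)^-1)
       uT (S_plus H T (S_minus H T uT))) /\
  (forall (n : nat) (uT : 'rV[R]_n -> R) (A : 'M[R]_n),
     (1 <= n)%N ->
     lipschitz uT ->
     A^T = A ->
     (forall p : 'rV[R]_n, p != 0 -> 0 < (p *m A *m p^T) 0 0) ->
     let H := fun p : 'rV[R]_n => (p *m A *m p^T) 0 0 / 2 in
     unique_obstacle_solution
       (fun p X => - lambda_max (X - T^-1 *: invmx A))
       uT (S_plus H T (S_minus H T uT))).
Proof.
split.
- move=> uT H uT_lip H2 H_gt0 H_sup.
  exact: envelope_unique_solution T_gt0 (one_dim_obstacle_structure T_gt0 H2 H_gt0 H_sup) uT uT_lip.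
- move=> n uT A n0 uT_lip sA pA H.
  exact: envelope_unique_solution T_gt0 (quadratic_obstacle_structure T_gt0 n0 sA pA) uT uT_lip.
Qed.
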